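(* Assume Condition 1, let $n\to\infty$, $K=K_n\to\infty$, and let $\tau=\tau_n>0$ be possibly random with $\tau_n\to0$ and $\tau_n\sqrt n\to\infty$ in probability. Then there is a finite $B$ with $|\varphi|_{\mathcal E}<B$ such that $P(|b_{n,\tau_n}|_{\mathcal E}<B)\to1$, and $|b_{n,\tau_n}-\varphi|_{\mathcal E}\to0$ in probability.
   Context: Let $(\varepsilon_t)_{t\in\mathbb{Z}}$ be i.i.d. real random variables with $\mathbb{E}\varepsilon_t=0$, $\mathbb{E}\varepsilon_t^2=\sigma^2\in(0,\infty)$, $\mathbb{E}\varepsilon_t^4<\infty$. Fix $\lambda>1/2$ and positive constants $\lambda_k$, $k\ge1$, with $c_1k^\lambda\le\lambda_k\le c_2k^\lambda$ for some constants $0<c_1\le c_2<\infty$. For a real sequence $b=(b_k)_{k\ge1}$ put $|b|_{\mathcal E}^2=\sum_{k\ge1}\lambda_k^2b_k^2$, $\mathcal E=\{b:|b|_{\mathcal E}<\infty\}$, and $\mathcal E_K=\{b\in\mathcal E: b_k=0\text{ for }k>K\}$. Condition 1: $\varphi=(\varphi_k)_{k\ge1}\in\mathcal E$; $1-\sum_{k\ge1}\varphi_kz^k\neq0$ for all complex $z$ with $|z|\le1$; and $(Y_t)_{t\in\mathbb{Z}}$ is the causal solution (each $Y_t$ measurable w.r.t. $\sigma(\varepsilon_s:s\le t)$, with $\sup_t\mathbb{E}Y_t^2<\infty$) of $Y_t=\sum_{k\ge1}\varphi_kY_{t-k}+\varepsilon_t$, $t\in\mathbb{Z}$. For $a\in\mathcal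 E$, $X_t(a)=\sum_{k\ge1}a_kY_{t-k}$. The sample is $Y_{-(K-1)},\dots,Y_n$. Penalized estimator ($\tau>0$): $b_{n,\tau}=\arg\min_{b\in\mathcal E_K}\{\frac1n\sum_{t=1}^n(Y_t-X_t(b))^2+\tau|b|_{\mathcal E}^2\}$. *)

(* Defs.v *)
From mathcomp Require Import all_boot all_order all_algebra.
From mathcomp Require Import all_classical all_reals all_analysis.
From mathcomp Require Import complex.
Set Implicit Arguments. Unset Strict Implicit. Unset Printing Implicit Defensive.
Import Order.TTheory GRing.Theory Num.Theory.
Local Open Scope classical_set_scope.
Local Open Scope ring_scope.

(* Sequences b = (b_k)_{k>=1} are functions nat -> R; the value at index 0
   is ignored by every definition below (except E_K, where it is forced to 0). *)
Section Seqs.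
Context {R : realType}.

Definition rser (F : nat -> R) : R := limn (fun N => \sum_(1 <= k < N) F k).

Definition enorm2 (lam b : nat -> R) : \bar R :=
  (\sum_(1 <= k <oo) ((lam k ^+ 2 * b k ^+ 2)%:E))%E.

Definition in_Espace (lam b : nat -> R) : Prop := (enorm2 lam b < +oo)%E.

(* |b|_E (meaningful for b \in E) *)
Definition enorm (lam b : nat -> R) : R := Num.sqrt (fine (enorm2 lam b)).

Definition in_EK (lam : nat -> R) (K : nat) (b : nat -> R) : Prop :=
  in_Espace lam b /\ b 0%N = 0 /\ forall k, (K < k)%N -> b k = 0.

(* 1 - sum_{k>=1} phi_k z^k <> 0 for all complex z with |z| <= 1;
   the complex series is written through its real and imaginary parts. *)
Definition ar_invertible (phi : nat -> R) : Prop :=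
  forall z : R[i], (complex.Re z) ^+ 2 + (complex.Im z) ^+ 2 <= 1 ->
    ~ (rser (fun k => phi k * complex.Re (z ^+ k)) = 1 /\
       rser (fun k => phi k * complex.Im (z ^+ k)) = 0).

Definition Xt (Y : int -> R) (a : nat -> R) (t : int) : R :=
  rser (fun k => a k * Y (t - k%:Z)).

Definition Qcrit (lam : nat -> R) (Y : int -> R) (n : nat) (tau : R)
  (b : nat -> R) : R :=
  n%:R^-1 * (\sum_(1 <= t < n.+1) (Y t%:Z - Xt Y b t%:Z) ^+ 2)
  + tau * fine (enorm2 lam b).

Definition is_pen_est (lam : nat -> R) (Y : int -> R) (K n : nat) (tau : R)
  (b : nat -> R) : Prop :=
  in_EK lam K b /\ forall b', in_EK lam K b' -> Qcrit lam Y n tau b <= Qcrit lam Y n tau b'.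
End Seqs.

Section Prob.
Context {R : realType} {d : measure_display} {Omega : measurableType d}.
Variable P : probability Omega R.

Definition mutually_independent (eps : int -> Omega -> R) : Prop :=
  forall (I : seq int) (B : int -> set R), uniq I ->
    (forall i, measurable (B i)) ->
    P (\bigcap_(i in [set` I]) (eps i @^-1` B i)) =
    (\big[*%E/1%E]_(i <- I) P (eps i @^-1` B i))%E.

Definition identically_distributed (eps : int -> Omega -> R) : Prop :=
  forall s t (B : set R), measurable B -> P (eps s @^-1` B) = P (eps t @^-1` B).

Definition past_sigma (eps : int -> Omega -> R) (t : int) : set (set Omega) :=
  <<s [set A | exists s, s <= t /\ exists B : set R, measurable B /\ A = eps s @^-1` B] >>.

Definition past_measurable (eps : int -> Omega -> R) (t : int) (Z : Omega -> R) : Prop :=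
  forall B : set R, measurable B -> past_sigma eps t (Z @^-1` B).

Definition cvg_in_prob (Z : nat -> Omega -> R) (c : R) : Prop :=
  forall e : R, 0 < e ->
    (fun n => P [set w | e <= `|Z n w - c|]) @ \oo --> 0%E.

Definition cvg_in_prob_pinfty (Z : nat -> Omega -> R) : Prop :=
  forall M : R, (fun n => P [set w | Z n w <= M]) @ \oo --> 0%E.
End Prob.

(* Main.v *)
(* By Wiener's lemma the inverse psi of the power series 1 - sum_k phi_k z^k is absolutely summable,
   so Y_t = sum_i psi_i eps_{t-i} almost surely. The terms eps_{t-p} eps_{t-q} - E[eps_{t-p} eps_{t-q}]
   are orthogonal in t, hence each sample autocovariance has mean square error O(1/n), uniformly in
   the lags. As sum_k lambda_k^-2 is finite, so is E(n T_n) uniformly in n, where T_n is the sum over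
   all pairs of lags (j, k) of the squared errors weighted by (lambda_j lambda_k)^-2. Since
   tau_n sqrt n -> oo, T_n <= (eta tau_n)^2 with probability close to 1; on that event the stochastic
   error of the quadratic criterion is at most eta tau_n times products of norms of E. Comparing the
   criterion at the estimator with its value at the truncation of phi, and using that the covariance
   form dominates the l2 norm, bounds the distance from the estimator to that truncation: either it
   is small in the norm of E, or it is O(l2 tail of phi beyond K) in l2, and then
   lambda_k <= c2 K^lambda <= (c2 / c1) lambda_j for k <= K < j makes it small in the norm of E too.
   The choice B = |phi|_E + 1 gives the first claim by the triangle inequality. *)
From HB Require Import structures.
Require Import Defs.
From mathcomp Require Import all_boot all_order all_algebra.
From mathcomp Require Import all_classical all_reals all_analysis.
From mathcomp Require Import measurable_realfun complex cyclic cyclotomic separable.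
From mathcomp Require Import lra ring zify.
Set Implicit Arguments. Unset Strict Implicit. Unset Printing Implicit Defensive.
Import Order.TTheory GRing.Theory Num.Theory.
Import numFieldNormedType.Exports.
Local Open Scope classical_set_scope.
Local Open Scope ring_scope.

(** * Wiener's lemma for absolutely summable sequences *)

(** The criterion has curvature of order one in l2 but only of order [tau] in the norm of E, and the
    sampling error must be absorbed by the latter: this is why it has to stay below [eta * tau] and
    why tau_n sqrt n must diverge. The penalty also biases the minimiser through lambda_k^2 phi_k, a
    sequence that need not be square summable. Cutting it at a fixed [M] leaves a finite constant
    times tau_n, paired with the l2 error, and a small tail of phi, paired with the error in E. The
    variance bounds depend on no number of lags, so no rate for K_n enters. Y has only second
    moments at the outset, hence these bounds are proved for finite sums of innovations and passed
    to Y by Fatou's lemma. Wiener's lemma is reached without contour integrals: Cauchy's estimates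
    come from averages over roots of unity and are applied to reciprocals of polynomials only. The
    estimator is given pointwise as a minimiser; its measurability, needed to compare probabilities
    of events, is derived from the normal equations. *)

Section Convolution.
Context {A : comNzRingType}.
Implicit Types f g h : nat -> A.

(** Cauchy product of formal power series; [conv f g =1 cdelta] says that [g] is the reciprocal of
    [f]. *)
Definition conv f g (k : nat) : A := \sum_(i < k.+1) f i * g (k - i)%N.
Definition cdelta (k : nat) : A := (k == 0%N)%:R.
Definition convX f (n : nat) : nat -> A := iter n (conv f) cdelta.

(** Cutting both sequences at [N] leaves the coefficients below [N] unchanged, so the ring laws of
    [conv] are inherited from polynomial multiplication. *)
Lemma conv_poly f g k N : (k < N)%N ->
  conv f g k = (\poly_(i < N) f i * \poly_(i < N) g i)`_k.
Proof.
move=> kN; rewrite coefM; apply: eq_bigr => i _; rewrite !coef_poly.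
by rewrite (leq_ltn_trans (leq_subr _ _) kN) (leq_ltn_trans _ kN) // -ltnS.
Qed.

Lemma convC f g : conv f g =1 conv g f.
Proof. by move=> k; rewrite !(@conv_poly _ _ k k.+1) // mulrC. Qed.

Lemma eq_conv f f' g g' N :
  (forall k, (k < N)%N -> f k = f' k) -> (forall k, (k < N)%N -> g k = g' k) ->
  forall k, (k < N)%N -> conv f g k = conv f' g' k.
Proof.
move=> ff gg k kN; apply: eq_bigr => i _.
by rewrite ff ?gg ?(leq_ltn_trans (leq_subr _ _) kN) ?(leq_ltn_trans _ kN) // -ltnS.
Qed.

Lemma eq_conv1 f f' g g' : f =1 f' -> g =1 g' -> conv f g =1 conv f' g'.
Proof. by move=> ff gg k; apply: (@eq_conv _ _ _ _ k.+1). Qed.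

Lemma convA f g h : conv f (conv g h) =1 conv (conv f g) h.
Proof.
move=> k.
have E (u v w : nat -> A) : conv u (conv v w) k =
   (\poly_(i < k.+1) u i * (\poly_(i < k.+1) v i * \poly_(i < k.+1) w i))`_k.
  rewrite coefM; apply: eq_bigr => i _; rewrite coef_poly ltn_ord.
  by rewrite (@conv_poly _ _ _ k.+1) // ltnS leq_subr.
by rewrite E convC E mulrA mulrC.
Qed.

Lemma conv1 f : conv cdelta f =1 f.
Proof.
move=> k; rewrite /conv big_ord_recl /cdelta eqxx mul1r subn0 big1 ?addr0 // => i _.
by rewrite mul0r.
Qed.

Lemma conv1r f : conv f cdelta =1 f.
Proof. by move=> k; rewrite convC conv1. Qed.

Lemma convCA f g h : conv f (conv g h) =1 conv g (conv f h).
Proof.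
move=> k; rewrite convA (eq_conv1 (convC f g) (fun=> erefl)).
by rewrite -convA.
Qed.

Lemma convDr f g h k : conv f (fun i => g i + h i) k = conv f g k + conv f h k.
Proof. by rewrite /conv -big_split; apply: eq_bigr => i _; rewrite mulrDr. Qed.

Lemma convBl f g h k : conv (fun i => f i - g i) h k = conv f h k - conv g h k.
Proof. by rewrite /conv -sumrB; apply: eq_bigr => i _; rewrite mulrBl. Qed.

Lemma conv_sumr (I : Type) (s : seq I) f (g : I -> nat -> A) k :
  conv f (fun i => \sum_(n <- s) g n i) k = \sum_(n <- s) conv f (g n) k.
Proof.
rewrite /conv exchange_big; apply: eq_bigr => i _.
by rewrite mulr_sumr.
Qed.

Lemma conv_inj f g h h' : conv f g =1 cdelta ->
  conv f h =1 conv f h' -> h =1 h'.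
Proof.
move=> fg E k; rewrite -(conv1 h) -(conv1 h').
have gf : cdelta =1 conv g f by move=> i; rewrite convC fg.
rewrite (eq_conv1 gf (fun=> erefl)) -convA (eq_conv1 (fun=> erefl) E).
rewrite convA; apply: eq_conv1 => // i; by rewrite gf.
Qed.

Lemma convX_inv f g n : conv f g =1 cdelta -> conv (convX f n) (convX g n) =1 cdelta.
Proof.
move=> fg; elim: n => [|n IH] k; first by rewrite conv1.
rewrite [convX f _]iterS -/(convX f n) [convX g _]iterS -/(convX g n).
rewrite -convA (eq_conv1 (fun=> erefl) (convCA _ _ _)).
rewrite (eq_conv1 (fun=> erefl) (eq_conv1 (fun=> erefl) IH)).
by rewrite (eq_conv1 (fun=> erefl) (conv1r _)) fg.
Qed.

Lemma convX_order f n k : f 0%N = 0 -> (k < n)%N -> convX f n k = 0.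
Proof.
move=> f0; elim: n k => // n IH k kn.
rewrite [convX _ _]iterS -/(convX f n) /conv big1 // => -[[|i] ik] _ /=.
  by rewrite f0 mul0r.
rewrite IH ?mulr0 //.
case: k => [|k] in kn ik * => //.
by rewrite subSS (leq_ltn_trans (leq_subr _ _)).
Qed.

Lemma conv_lowr f g n : (forall k, (k < n)%N -> f k = 0) ->
  forall k, (k < n)%N -> conv f g k = 0.
Proof.
move=> f0 k kn; rewrite /conv big1 // => i _; rewrite f0 ?mul0r //.
by rewrite (leq_trans _ kn) // ltn_ord.
Qed.

(** Iterates psi = g + (g q) psi, which is (p - q) psi = 1 multiplied by g = 1/p. The exact
    remainder is kept instead of a limit. *)
Lemma neumann p q g psi : conv p g =1 cdelta ->
  conv (fun k => p k - q k) psi =1 cdelta ->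
  forall L, psi =1 fun k => \sum_(n < L) conv (convX q n) (convX g n.+1) k
                    + conv (conv (convX q L) (convX g L)) psi k.
Proof.
move=> pg fpsi.
have E k : psi k = g k + conv (conv q g) psi k.
  move: k; apply: (@conv_inj p g) => // k.
  have -> : conv p psi k = cdelta k + conv q psi k by rewrite -fpsi convBl subrK.
  rewrite convDr pg; congr (_ + _); rewrite convA; apply: eq_conv1 => // i.
  by rewrite convCA (eq_conv1 (fun=> erefl) pg) conv1r.
elim=> [|L IH] k.
  rewrite big_ord0 add0r.
  by rewrite (eq_conv1 (conv1 _) (fun=> erefl)) conv1.
rewrite IH big_ord_recr /= -addrA; congr (_ + _).
rewrite (eq_conv1 (fun=> erefl) E) convDr; congr (_ + _).
  rewrite -convA; apply: eq_conv1 => // i.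
  exact: convC.
rewrite convA; apply: eq_conv1 => // i.
change (conv (conv (convX q L) (convX g L)) (conv q g) i =
        conv (conv q (convX q L)) (conv g (convX g L)) i).
rewrite -!convA -[RHS]convCA; apply: eq_conv1 => // j.
rewrite convCA; apply: eq_conv1 => // l; exact: convC.
Qed.

End Convolution.

Section L1Bound.
Context {K : numDomainType}.
Implicit Types f g : nat -> K.

Lemma sum_norm_conv f g N :
  \sum_(k < N) `|conv f g k| <= (\sum_(k < N) `|f k|) * \sum_(k < N) `|g k|.
Proof.
pose F := \poly_(i < N) `|f i|; pose G := \poly_(i < N) `|g i|.
have -> : \sum_(k < N) `|f k| = \sum_(k < N) F`_k.
  by apply: eq_bigr => k _; rewrite coef_poly ltn_ord.
have -> : \sum_(k < N) `|g k| = \sum_(k < N) G`_k.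
  by apply: eq_bigr => k _; rewrite coef_poly ltn_ord.
apply: (@le_trans _ _ (\sum_(k < N) \sum_(i < N | (i <= k)%N) F`_i * G`_(k - i))).
  apply: ler_sum => k _; rewrite (le_trans (ler_norm_sum _ _ _)) //.
  rewrite (big_ord_widen N (fun i : nat => `|f i * g (k - i)%N|)) //.
  rewrite le_eqVlt; apply/orP; left; apply/eqP; apply: eq_bigr => i ik.
  rewrite normrM !coef_poly ltn_ord.
  by rewrite (leq_ltn_trans (leq_subr _ _)).
rewrite mulr_suml (exchange_big_dep predT) //=; apply: ler_sum => i _.
rewrite -mulr_sumr ler_wpM2l //; first by rewrite coef_poly; case: ifP.
have -> : \sum_(k < N | (i <= k)%N) G`_(k - i) = \sum_(i <= k < N) G`_(k - i).
  by rewrite big_geq_mkord.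
rewrite -{1}[i : nat]add0n big_addn -(big_mkord xpredT (fun k => G`_k)).
have -> : \sum_(0 <= k < N - i) G`_(k + i - i) = \sum_(0 <= k < N - i) G`_k.
  by apply: eq_bigr => k _; rewrite addnK.
rewrite [leRHS](big_cat_nat (n := (N - i)%N)) ?leq_subr //= lerDl sumr_ge0 // => k _.
by rewrite coef_poly; case: ifP.
Qed.

Lemma sum_norm_convX f n N e : 0 <= e -> \sum_(k < N) `|f k| <= e ->
  \sum_(k < N) `|convX f n k| <= e ^+ n.
Proof.
move=> e0 fe; elim: n => [|n IH].
  case: N {fe} => [|N]; first by rewrite big_ord0.
  by rewrite big_ord_recl /= big1 ?addr0 ?expr0 ?normr1 // => i _; rewrite normr0.
rewrite [convX f _]iterS -/(convX f n) exprS (le_trans (sum_norm_conv _ _ _)) //.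
by rewrite ler_pM // sumr_ge0.
Qed.

(** Bounded partial sums make sense in any ordered domain, so the same notion serves the real and
    the complex sequences, with no topology involved. *)
Definition l1 f := exists B, forall N, \sum_(k < N) `|f k| <= B.

Lemma l1_conv f g : l1 f -> l1 g -> l1 (conv f g).
Proof.
move=> [B fB] [B' gB]; exists (B * B') => N.
by rewrite (le_trans (sum_norm_conv _ _ _)) // ler_pM // sumr_ge0.
Qed.

End L1Bound.

(** * Cauchy's coefficient estimate through roots of unity *)

Section DiscreteCauchy.
Context {C : numClosedFieldType}.

(** In characteristic zero X^n - 1 is separable, hence has n distinct roots, and n distinct n-th
    roots of unity include a primitive one. *)
Lemma prim_root_exists (n : nat) : (n > 0)%N -> exists z : C, n.-primitive_root z.
Proof.
pose p : {poly C} := 'X^n - 1; have [r Dp] := closed_field_poly_normal p.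
move=> n_gt0; rewrite (monicP _) ?monicXnsubC // scale1r in Dp.
have rn1: all n.-unity_root r by apply/allP=> z; rewrite -root_prod_XsubC -Dp.
have sz_r: (n < (size r).+1)%N.
  by rewrite -(size_prod_XsubC r id) -Dp size_XnsubC.
have [|z] := hasP (has_prim_root n_gt0 rn1 _ sz_r); last by exists z.
by rewrite -separable_prod_XsubC -Dp separable_Xn_sub_1 // pnatr_eq0 -lt0n.
Qed.

Lemma sum_prim_root (n : nat) (w : C) (i j : nat) : n.-primitive_root w ->
  (i < n)%N -> (j < n)%N ->
  \sum_(l < n) (w ^+ l) ^+ i / (w ^+ l) ^+ j = n%:R * (i == j)%:R.
Proof.
move=> wn iltn jltn.
have w0 : w != 0.
  apply: contraTneq (oner_neq0 C) => w0; rewrite -(prim_expr_order wn) w0.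
  by rewrite expr0n gtn_eqF ?eqxx // (leq_ltn_trans _ iltn).
have [<-|ij] := eqVneq i j.
  rewrite (eq_bigr (fun=> 1)) => [|l _]; last by rewrite mulfV // !expf_neq0.
  by rewrite sumr_const card_ord mulr1.
(* A geometric sum in x = w^(i-j), where x^n = 1 and x <> 1. *)
rewrite mulr0; pose x := w ^+ i / w ^+ j.
rewrite (eq_bigr (fun l : 'I_n => x ^+ l)); last first.
  by move=> l _; rewrite /x exprMn exprVn -!exprM ![(l * _)%N]mulnC.
have x1 : x - 1 != 0.
  rewrite subr_eq0; apply: contra_neq ij => /(congr1 (fun y => y * w ^+ j)).
  rewrite divfK ?expf_neq0 // mul1r => /eqP.
  by rewrite (eq_prim_root_expr wn) !modn_small // => /eqP.
apply: (mulfI x1); rewrite mulr0 -subrX1 /x exprMn exprVn -!exprM.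
by rewrite ![(_ * n)%N]mulnC !exprM (prim_expr_order wn) !expr1n divr1 subrr.
Qed.

(* The mean of [G(w) / w^k] over the roots of unity [w] of large order is [G_k]. *)
Lemma coef_le_unit_circle (G : {poly C}) (B : C) (k : nat) :
  (forall z, `|z| = 1 -> `|G.[z]| <= B) -> `|G`_k| <= B.
Proof.
(* With [N] at least the size of [G] no two exponents of [G] are congruent modulo [N], so averaging
   isolates a single coefficient. *)
move=> GB; pose N := maxn k.+1 (size G).
have kN : (k < N)%N by rewrite leq_maxl.
have N0 : (0 < N)%N by rewrite (leq_ltn_trans _ kN).
have [w wN] := prim_root_exists N0.
have w1 l : `|w ^+ l| = 1.
  rewrite normrX; suff -> : `|w| = 1 by rewrite expr1n.
  by apply/eqP; rewrite -(@eqrXn2 _ N) // -?normrX ?(prim_expr_order wN) ?normr1 ?expr1n.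
have E : \sum_(l < N) G.[w ^+ l] / (w ^+ l) ^+ k = N%:R * G`_k.
  transitivity (\sum_(i < N) \sum_(l < N) G`_i * ((w ^+ l) ^+ i / (w ^+ l) ^+ k)).
    rewrite exchange_big; apply: eq_bigr => l _ /=.
    rewrite (@horner_coef_wide _ N) ?leq_maxr // mulr_suml.
    by apply: eq_bigr => i _; rewrite mulrA.
  rewrite (bigD1 (Ordinal kN)) //= -mulr_sumr (sum_prim_root wN) // eqxx mulr1 mulrC.
  rewrite big1 ?addr0 // => i; rewrite -val_eqE /= => /negbTE ik.
  by rewrite -mulr_sumr (sum_prim_root wN) // ik !mulr0.
have N0' : 0 < N%:R :> C by rewrite ltr0n.
rewrite -(ler_pM2l N0') -[X in X * `|_|]gtr0_norm // -normrM -E.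
rewrite (le_trans (ler_norm_sum _ _ _)) //.
rewrite -[N in leRHS]card_ord -sum1_card natr_sum mulr_suml; apply: ler_sum => l _.
by rewrite normrM normfV normrX w1 expr1n divr1 mul1r GB.
Qed.

End DiscreteCauchy.

Section PolynomialInverse.
Context {C : numClosedFieldType}.
Hypothesis arch : forall x : C, exists n : nat, `|x| < n%:R.
Implicit Types P : {poly C}.

(** If terms above [e] occurred arbitrarily far, partial sums would exceed every multiple of [e];
    the Archimedean hypothesis contradicts this. Nothing else about limits in [C] is available
    here. *)
Lemma l1_small (g : nat -> C) e : l1 g -> 0 < e ->
  exists L, forall l, (L <= l)%N -> `|g l| <= e.
Proof.
move=> [B gB] e0; apply: contrapT => noL.
have big n : exists N, n%:R * e <= \sum_(k < N) `|g k|.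
  elim: n => [|n [N IH]]; first by exists 0%N; rewrite mul0r sumr_ge0.
  have [l lN gl] : exists2 l, (N <= l)%N & e < `|g l|.
    apply: contrapT => no; apply: noL; exists N => l Nl.
    rewrite real_leNgt ?normr_real ?(gtr0_real e0) //; apply/negP => gl; by apply: no; exists l.
  exists l.+1; rewrite big_ord_recr /= -addn1 natrD mulrDl mul1r lerD ?(ltW gl) //.
  rewrite (le_trans IH) // -!(big_mkord xpredT (fun k => `|g k|)).
  by rewrite [leRHS](big_cat_nat (n := N)) //= lerDl sumr_ge0.
have [n Bn] := arch (B / e).
have [N bigN] := big n.
have B0 : 0 <= B by apply: le_trans (gB 0%N); rewrite big_ord0.
have := le_trans bigN (gB N); rewrite -ler_pdivlMr // => /le_lt_trans.
by move=> /(_ _ (le_lt_trans (real_ler_norm (ger0_real (divr_ge0 B0 (ltW e0)))) Bn)); rewrite ltxx.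
Qed.

(** The geometric expansion of 1/(X - z), summable because |z| > 1. *)
Lemma XsubC_inverse (z : C) : 1 < `|z| ->
  conv (fun i => ('X - z%:P)`_i) (fun k => - z ^- k.+1) =1 cdelta /\
  l1 (fun k => - z ^- k.+1).
Proof.
move=> z1; have z0 : z != 0 by rewrite -normr_gt0 (lt_trans _ z1).
split=> [k|].
  rewrite /conv; case: k => [|k].
    by rewrite big_ord1 coefB coefX coefC /= sub0r subn0 mulrNN expr1 mulfV.
  rewrite 2!big_ord_recl big1 ?addr0 => [|i _]; last first.
    by rewrite coefB coefX coefC /= subrr mul0r.
  rewrite !coefB !coefX !coefC /= sub0r !subr0 mul1r mulrNN subn0 subSS subn0.
  by rewrite /cdelta /= [z ^+ k.+2]exprS invfM mulrA divff // mul1r subrr.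
have z1' : 0 < `|z| - 1 by rewrite subr_gt0.
exists (`|z| - 1)^-1 => N; rewrite -[leRHS]mul1r ler_pdivlMr //.
rewrite (eq_bigr (fun k : 'I_N => `|z|^-1 * `|z|^-1 ^+ k)); last first.
  by move=> k _; rewrite normrN normfV normrX exprVn exprS invfM.
rewrite -mulr_sumr mulrC mulrA mulrBl mul1r mulfV ?normr_eq0 //.
by rewrite -opprB mulNr -subrX1 opprB lerBlDr lerDl exprn_ge0 // invr_ge0.
Qed.

Lemma polynomial_inverse P : (forall z, `|z| <= 1 -> P.[z] != 0) ->
  exists2 g, conv (fun i => P`_i) g =1 cdelta & l1 g.
Proof.
move=> P0; have [r Pr] := closed_field_poly_normal P.
have lc0 : lead_coef P != 0.
  rewrite lead_coef_eq0; apply: contraTneq (P0 0 _) => [->|]; last by rewrite normr0.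
  by rewrite horner0 eqxx.
have r1 : all (fun z => 1 < `|z|) r.
  apply/allP => z zr; rewrite real_ltNge //; apply/negP => z1.
  by have := P0 z z1; rewrite -rootE Pr rootZ // root_prod_XsubC zr.
have [g [gr gs]] : exists g, conv (fun i => (\prod_(z <- r) ('X - z%:P))`_i) g =1 cdelta
    /\ l1 g.
  elim: r r1 {Pr} => [_|z r IH /andP[z1 r1]].
    exists cdelta; split.
      by move=> k; rewrite conv1r big_nil coef1.
    exists 1 => -[|N]; first by rewrite big_ord0 ler01.
    by rewrite big_ord_recl /= big1 ?addr0 ?normr1 // => i _; rewrite normr0.
  have [h [hr hs]] := IH r1; have [kz ks] := XsubC_inverse z1.
  exists (conv (fun k => - z ^- k.+1) h); split; last exact: l1_conv.
  move=> k; rewrite big_cons.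
  rewrite (eq_conv1 (fun j => coefM _ _ j) (fun=> erefl)).
  rewrite -/(conv _ _) -convA (eq_conv1 (fun=> erefl) (convCA _ _ _)).
  by rewrite convA (eq_conv1 kz hr) conv1.
exists (fun k => (lead_coef P)^-1 * g k).
  move=> k; rewrite -gr; apply: eq_bigr => i _.
  by rewrite {1}Pr coefZ mulrACA mulfV // mul1r.
have [B gB] := gs; exists (`|lead_coef P|^-1 * B) => N.
rewrite (eq_bigr (fun k : 'I_N => `|lead_coef P|^-1 * `|g k|)).
  by rewrite -mulr_sumr ler_wpM2l ?gB // invr_ge0.
by move=> k _; rewrite normrM normfV.
Qed.

(** Cauchy's estimate for 1/P. As [g] is not a polynomial, it is cut at a large [L]: then P * G
    equals 1 up to at most [size P] tiny coefficients of degree at least [L], so |G| <= (1 + e) / nu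
    on the unit circle, and [e] is arbitrary. *)
Lemma inverse_coef_le P (nu : C) g k : 0 < nu ->
  (forall z, `|z| <= 1 -> nu <= `|P.[z]|) -> conv (fun i => P`_i) g =1 cdelta ->
  `|g k| <= nu^-1.
Proof.
move=> nu0 Pnu Pg.
have gs : l1 g.
  have [|h Ph hs] := @polynomial_inverse P.
    by move=> z /Pnu nuP; rewrite -normr_gt0 (lt_le_trans nu0).
  have gh : g =1 h by apply: (conv_inj Pg) => j; rewrite Pg Ph.
  have [B hB] := hs; exists B => N.
  by rewrite (eq_bigr (fun k : 'I_N => `|h k|)) ?hB // => j _; rewrite gh.
pose d := size P; pose SP := \sum_(i < d) `|P`_i|.
have SP0 : 0 <= SP by exact: sumr_ge0.
have SPn n : \sum_(i < n) `|P`_i| <= SP.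
  rewrite /SP -!(big_mkord xpredT (fun i => `|P`_i|)).
  have [nd|dn] := leqP n d; first by rewrite [leRHS](big_cat_nat (leq0n n) nd) //= lerDl sumr_ge0.
  rewrite (big_cat_nat (leq0n d) (ltnW dn)) //= gerDl big_nat big1 // => i /andP[di _].
  by rewrite nth_default ?normr0.
suff H e : 0 < e -> `|g k| * nu <= 1 + e.
  rewrite -[leRHS]mul1r ler_pdivlMr // real_leNgt ?realM ?normr_real ?gtr0_real //.
  apply/negP; rewrite -subr_gt0 => y0.
  have := H _ (divr_gt0 y0 (ltr0n _ 2)); rewrite -lerBlDl => /lt_le_trans.
  have y2 : (`|g k| * nu - 1) / 2 < `|g k| * nu - 1.
    by rewrite gtr_pMr // invf_lt1 // ltr1n.
  by move=> /(_ _ y2); rewrite ltxx.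
move=> e0.
(* At most [d] spurious coefficients survive, each below [e' * SP], so together they stay below [e];
   the two added units keep the denominator positive. *)
pose e' := e / (d.+1%:R * (SP + 1)).
have e'0 : 0 < e' by rewrite divr_gt0 // mulr_gt0 ?ltr0n // ltr_wpDl.
have [L0 gL0] := l1_small gs e'0.
pose L := maxn (L0 + d) k.+1; pose G := \poly_(i < L) g i.
have kL : (k < L)%N by rewrite leq_maxr.
have TE j : (j < L)%N -> (P * G)`_j = cdelta j.
  move=> jL; rewrite -Pg coefM; apply: eq_bigr => i _.
  by rewrite coef_poly (leq_ltn_trans (leq_subr _ _)).
have TL j : (L <= j)%N -> `|(P * G)`_j| <= e' * SP.
  move=> Lj; rewrite coefM (le_trans (ler_norm_sum _ _ _)) //.
  apply: (@le_trans _ _ (\sum_(i < j.+1) e' * `|P`_i|)).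
    apply: ler_sum => i _; rewrite normrM mulrC.
    have [id|di] := ltnP i d; last by rewrite (nth_default _ di) normr0 !mulr0.
    rewrite ler_wpM2r // coef_poly; case: ifP => _; last by rewrite normr0 ltW.
    apply: gL0; rewrite leq_subRL; last by rewrite -ltnS.
    rewrite (leq_trans _ Lj) // (leq_trans _ (leq_maxl _ _)) // addnC leq_add2l.
    exact: ltnW.
  by rewrite -mulr_sumr ler_wpM2l // ltW.
have szPG : (size (P * G)%R <= L + d)%N.
  rewrite (leq_trans (size_polyMleq _ _)) // -subn1 leq_subLR.
  by rewrite addnC -/d (leq_trans (leq_add (size_poly _ _) (leqnn _))) // leq_addl.
have PG z : `|z| = 1 -> `|(P * G).[z]| <= 1 + e.
  move=> z1; rewrite (horner_coef_wide _ szPG) big_split_ord /= (le_trans (ler_normD _ _)) // lerD //.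
    rewrite (bigD1 (Ordinal (leq_ltn_trans (leq0n k) kL))) //= big1 ?addr0.
      by rewrite TE ?(leq_ltn_trans _ kL) // /cdelta eqxx expr0 mulr1 normr1.
    by move=> i; rewrite -val_eqE /= => /negbTE i0; rewrite TE // /cdelta i0 mul0r.
  rewrite (le_trans (ler_norm_sum _ _ _)) //.
  apply: (@le_trans _ _ (\sum_(i < d) e' * SP)).
    apply: ler_sum => i _; rewrite normrM normrX z1 expr1n mulr1 TL //.
    exact: leq_addr.
  rewrite sumr_const card_ord -mulr_natl /e' mulrCA -mulrA ger_pMr //.
  rewrite mulrC ler_pdivrMr ?mul1r ?mulr_gt0 ?ltr0n ?ltr_wpDl //.
  by rewrite ler_pM ?ler_nat // lerDl.
have -> : g k = G`_k by rewrite coef_poly kL.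
rewrite -ler_pdivlMr //; apply: coef_le_unit_circle => z z1.
rewrite ler_pdivlMr // (le_trans _ (PG z z1)) // hornerM normrM mulrC.
by rewrite ler_wpM2r // Pnu // z1.
Qed.

Lemma convX_coef P n : convX (fun i => P`_i) n =1 fun i => (P ^+ n)`_i.
Proof.
elim: n => [|n IH] k; first by rewrite expr0 coef1.
rewrite exprS coefM -/(conv (fun i => P`_i) (fun i => (P ^+ n)`_i) k).
exact: eq_conv1.
Qed.

(** The unit-circle estimate applied to the dilated power P(rho z)^n, whose reciprocal has
    coefficients [convX g n k * rho ^+ k]. *)
Lemma inverse_power_coef_le P (rho mu : C) g n k : 0 < rho -> 0 < mu ->
  (forall z, `|z| <= rho -> mu <= `|P.[z]|) -> conv (fun i => P`_i) g =1 cdelta ->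
  `|convX g n k| <= rho^-1 ^+ k * mu^-1 ^+ n.
Proof.
move=> rho0 mu0 Pmu Pg.
pose Q := \poly_(i < size (P ^+ n)) ((P ^+ n)`_i * rho ^+ i).
have Qi i : Q`_i = (P ^+ n)`_i * rho ^+ i.
  by rewrite coef_poly; case: ltnP => // ni; rewrite nth_default // mul0r.
have Qz z : Q.[z] = P.[rho * z] ^+ n.
  rewrite -horner_exp (horner_coef (P ^+ n)) (@horner_coef_wide _ (size (P ^+ n)) Q) ?size_poly //.
  by apply: eq_bigr => i _; rewrite Qi exprMn mulrA.
rewrite exprVn mulrC ler_pdivlMr ?exprn_gt0 // exprVn.
rewrite -[X in _ * X <= _]gtr0_norm ?exprn_gt0 // -normrM.
apply: (@inverse_coef_le Q _ (fun i => convX g n i * rho ^+ i)).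
- exact: exprn_gt0.
- move=> z z1; rewrite Qz normrX lerXn2r ?nnegrE ?(ltW mu0) //.
  by rewrite Pmu // normrM gtr0_norm // ger_pMr.
- move=> i; rewrite /conv; transitivity (conv (convX (fun i => P`_i) n) (convX g n) i * rho ^+ i).
    rewrite mulr_suml; apply: eq_bigr => j _; rewrite Qi convX_coef mulrACA -exprD subnKC //.
    by rewrite -ltnS.
  rewrite (convX_inv n Pg) /cdelta; case: i => [|i]; first by rewrite expr0 mulr1.
  by rewrite mul0r.
Qed.

(* Newman's proof of Wiener's lemma: the inverse of [P - q] is the Neumann series of the
   [q ^ n / P ^ n.+1], and the inverse of a power of [P] has coefficients decaying like [rho ^- k]. *)
Lemma wiener_bound P (q psi : nat -> C) (rho mu e : C) :
  1 < rho -> 0 <= e -> e < mu ->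
  (forall z, `|z| <= rho -> mu <= `|P.[z]|) ->
  q 0%N = 0 -> (forall N, \sum_(k < N) `|q k| <= e) ->
  conv (fun k => P`_k - q k) psi =1 cdelta ->
  forall N, \sum_(k < N) `|psi k| <= rho / (rho - 1) / (mu - e).
Proof.
move=> rho1 e0 emu Pmu q0 qe fpsi N.
have mu0 : 0 < mu := le_lt_trans e0 emu.
have rho0 : 0 < rho := lt_trans ltr01 rho1.
have [|g Pg _] := @polynomial_inverse P.
  move=> z z1; rewrite -normr_gt0 (lt_le_trans mu0) // Pmu //.
  by rewrite (le_trans z1) // ltW.
(* As many Neumann terms as coefficients: the remainder contains q^N, of order at least [N] since
   [q 0 = 0], and so vanishes in the range considered. No convergence has to be discussed. *)
have E := neumann Pg fpsi N.
(* The factor rho / (rho - 1) is not raised to the power [n], unlike what submultiplicativity of the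
   l1 norm would give; the Neumann series therefore has ratio e / mu < 1, however close [rho] is to
   1. *)
have gsum n : \sum_(k < N) `|convX g n k| <= rho / (rho - 1) * mu^-1 ^+ n.
  apply: (@le_trans _ _ (\sum_(k < N) rho^-1 ^+ k * mu^-1 ^+ n)).
    by apply: ler_sum => k _; apply: (inverse_power_coef_le _ _ rho0 mu0 Pmu Pg).
  rewrite -mulr_suml ler_wpM2r //; first by rewrite exprn_ge0 // invr_ge0 ltW.
  rewrite ler_pdivlMr ?subr_gt0 //.
  have -> : rho - 1 = rho * (1 - rho^-1) by rewrite mulrBr mulfV ?gt_eqF // mulr1.
  rewrite mulrCA ger_pMr // mulrC -opprB mulNr -subrX1 opprB lerBlDr lerDl.
  by rewrite exprn_ge0 // invr_ge0 ltW.
apply: (@le_trans _ _ (\sum_(n < N) e ^+ n * (rho / (rho - 1) * mu^-1 ^+ n.+1))).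
  apply: (@le_trans _ _ (\sum_(k < N) \sum_(n < N) `|conv (convX q n) (convX g n.+1) k|)).
    apply: ler_sum => k _; rewrite E [X in _ + X](_ : _ = 0) ?addr0 ?ler_norm_sum //.
    apply: (@conv_lowr _ _ _ N) => // i iN; apply: (@conv_lowr _ _ _ N) => // j jN.
    exact: convX_order.
  rewrite exchange_big; apply: ler_sum => n _ /=.
  rewrite (le_trans (sum_norm_conv _ _ _)) // ler_pM ?sumr_ge0 ?(gsum n.+1) //.
  exact: sum_norm_convX.
rewrite (eq_bigr (fun n : 'I_N => rho / (rho - 1) / mu * (e / mu) ^+ n)); last first.
  by move=> n _; rewrite exprS exprMn; ring.
rewrite -mulr_sumr -!mulrA ler_wpM2l ?(ltW rho0) // ler_wpM2l ?invr_ge0 ?subr_ge0 ?(ltW rho1) //.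
rewrite ler_pdivrMl // ler_pdivlMr ?subr_gt0 //.
have -> : mu - e = mu * (1 - e / mu) by rewrite mulrBr mulr1 mulrCA mulfV ?gt_eqF // mulr1.
rewrite mulrCA ger_pMr // mulrC -opprB mulNr -subrX1 opprB lerBlDr lerDl.
by rewrite exprn_ge0 // divr_ge0 // ltW.
Qed.

End PolynomialInverse.

Section RealSeries.
Context {R : realType}.
Implicit Types u F : nat -> R.

Lemma cvg_sum (I : Type) (s : seq I) (G : I -> nat -> R) (l : I -> R) :
  (forall i, G i @ \oo --> l i) ->
  (fun n => \sum_(i <- s) G i n) @ \oo --> \sum_(i <- s) l i.
Proof.
move=> Gl; elim: s => [|i s IH].
  by rewrite big_nil; under eq_fun do rewrite big_nil; exact: cvg_cst.
by rewrite big_cons; under eq_fun do rewrite big_cons; exact: cvgD.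
Qed.

Lemma l1_tail u e : l1 u -> 0 < e ->
  exists M, forall N, \sum_(M <= k < N) `|u k| <= e.
Proof.
move=> [B uB] e0; pose s N := \sum_(0 <= k < N) `|u k|.
have sB N : s N <= B by rewrite /s big_mkord.
have ub : has_sup (range s).
  by split; [exists (s 0%N), 0%N | exists B => _ [N _ <-]].
have [_ [M _ <-] sM] := sup_adherent e0 ub.
exists M => N; have [MN|/ltnW NM] := leqP M N; last by rewrite big_geq // ltW.
have : s N <= sup (range s) by apply: (@ub_le_sup _ (range s)); [case: ub | exists N].
have : s N = s M + \sum_(M <= k < N) `|u k| by rewrite /s (big_cat_nat (n := M)).
lra.
Qed.

Lemma l1_le u v : (forall k, `|u k| <= `|v k|) -> l1 v -> l1 u.
Proof.
by move=> uv [B vB]; exists B => N; apply: le_trans (vB N); apply: ler_sum => i _.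
Qed.

Lemma l1_cvg u : l1 u -> cvgn (fun N => \sum_(0 <= k < N) u k).
Proof.
move=> [B uB]; apply: (@normed_cvg _ _ u).
apply: nondecreasing_is_cvgn.
  by apply: (@nondecreasing_series _ (fun k => `|u k|) xpredT 0) => n _ _; exact: normr_ge0.
by exists B => _ [N _ <-]; change (\sum_(0 <= k < N) `|u k| <= B); rewrite big_mkord.
Qed.

Lemma l1_cvg1 u : l1 u -> (fun N => \sum_(1 <= k < N) u k) @ \oo --> rser u.
Proof.
move=> lu; rewrite /rser.
pose v k := if k is 0%N then 0 else u k.
have -> : (fun N => \sum_(1 <= k < N) u k) = (fun N => \sum_(0 <= k < N) v k).
  apply/funext => -[|N]; first by rewrite !big_geq.
  by rewrite [RHS]big_nat_recl // add0r big_add1.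
apply: l1_cvg; apply: (@l1_le _ u) => // -[|k] //=.
by rewrite normr0.
Qed.

Lemma rser_approx u M e : l1 u -> (0 < M)%N ->
  (forall N, \sum_(M <= k < N) `|u k| <= e) ->
  `|rser u - \sum_(1 <= k < M) u k| <= e.
Proof.
move=> lu M0 ue.
have cv : (fun N => `|\sum_(1 <= k < N) u k - \sum_(1 <= k < M) u k|) @ \oo -->
    `|rser u - \sum_(1 <= k < M) u k|.
  by apply: cvg_norm; apply: cvgB; [exact: l1_cvg1 | exact: cvg_cst].
apply: (cvgr_to_le cv).
near=> N; have MN : (M <= N)%N by near: N; exact: nbhs_infty_ge.
rewrite (big_cat_nat M0 MN) /= addrAC subrr add0r.
by rewrite (le_trans (ler_norm_sum _ _ _)).
Unshelve. all: by end_near. Qed.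

End RealSeries.

(** * The inverse of the autoregressive power series *)

Section ComplexModulus.
Context {R : realType}.
Local Notation C := R[i].
Local Notation toC := (real_complex R).

(** The norm of [R[i]] takes its values in [R[i]]; a real-valued modulus is needed to compare with
    real series and bounds. *)
Definition modc (z : C) : R := Num.sqrt (complex.Re z ^+ 2 + complex.Im z ^+ 2).

Lemma norm_modc z : `|z| = toC (modc z).
Proof. by rewrite normc_def. Qed.

Lemma modc_ge0 z : 0 <= modc z. Proof. exact: sqrtr_ge0. Qed.

Lemma modcM z w : modc (z * w) = modc z * modc w.
Proof. by apply: complexI; rewrite -norm_modc normrM !norm_modc rmorphM. Qed.

Lemma modcX z n : modc (z ^+ n) = modc z ^+ n.
Proof. by apply: complexI; rewrite -norm_modc normrX norm_modc rmorphXn. Qed.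

Lemma modcD z w : modc (z + w) <= modc z + modc w.
Proof. by rewrite -lecR rmorphD /= -!norm_modc ler_normD. Qed.

Lemma modcN z : modc (- z) = modc z.
Proof. by apply: complexI; rewrite -!norm_modc normrN. Qed.

Lemma modc_chain a a0 p p0 :
  modc a0 <= modc a + modc (a - p) + modc (p - p0) + modc (a0 - p0).
Proof.
have {1}-> : a0 = a - (a - p) - (p - p0) + (a0 - p0) by ring.
rewrite (le_trans (modcD _ _)) // lerD2r (le_trans (modcD _ _)) // modcN lerD2r.
by rewrite (le_trans (modcD _ _)) // modcN.
Qed.

Lemma modc_real x : modc (toC x) = `|x|.
Proof. by rewrite /modc /= expr0n addr0 sqrtr_sqr. Qed.

Lemma modc_sum (I : Type) (s : seq I) (F : I -> C) :
  modc (\sum_(i <- s) F i) <= \sum_(i <- s) modc (F i).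
Proof.
elim/big_ind2 : _ => [|x a y b xa yb|//]; last exact: le_trans (modcD _ _) (lerD xa yb).
by rewrite (modc_real 0) normr0.
Qed.

Lemma Re_le_modc z : `|complex.Re z| <= modc z.
Proof. by rewrite -sqrtr_sqr ler_wsqrtr // lerDl sqr_ge0. Qed.

Lemma Im_le_modc z : `|complex.Im z| <= modc z.
Proof. by rewrite -sqrtr_sqr ler_wsqrtr // lerDr sqr_ge0. Qed.

Lemma modc_le z : modc z <= `|complex.Re z| + `|complex.Im z|.
Proof.
rewrite -[leRHS]ger0_norm ?addr_ge0 // -[leRHS]sqrtr_sqr ler_wsqrtr //.
rewrite sqrrD !real_normK ?num_real // lerD2r lerDl.
by rewrite mulrn_wge0 // mulr_ge0.
Qed.

Lemma modc_eq0 z : (modc z == 0) = (z == 0).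
Proof. by rewrite -[RHS]normr_eq0 norm_modc (inj_eq (@complexI _)). Qed.

Lemma Re_sum (I : Type) (s : seq I) (F : I -> C) :
  complex.Re (\sum_(i <- s) F i) = \sum_(i <- s) complex.Re (F i).
Proof.
by apply: (big_ind2 (fun (z : C) r => complex.Re z = r)) => // -[x x'] a [y y'] b /= <- <-.
Qed.

Lemma Im_sum (I : Type) (s : seq I) (F : I -> C) :
  complex.Im (\sum_(i <- s) F i) = \sum_(i <- s) complex.Im (F i).
Proof.
by apply: (big_ind2 (fun (z : C) r => complex.Im z = r)) => // -[x x'] a [y y'] b /= <- <-.
Qed.

Lemma complex_arch (x : C) : exists n : nat, `|x| < n%:R.
Proof.
exists (Num.truncn (modc x)).+1; rewrite norm_modc -(rmorph_nat (real_complex R)) ltcR.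
exact: truncnS_gt.
Qed.

End ComplexModulus.

Section ARInverse.
Context {R : realType}.
Local Notation C := R[i].
Local Notation toC := (real_complex R).
Variable phi : nat -> R.

(* [arcoef], [archar] and [arpoly] are the power series 1 - sum_k phi_k z^k: its coefficients,
   its value on the unit disc, and its truncations. *)
Definition arcoef (k : nat) : R := if k is 0%N then 1 else - phi k.
Definition archar (z : C) : C :=
  Complex (1 - rser (fun k => phi k * complex.Re (z ^+ k)))
          (- rser (fun k => phi k * complex.Im (z ^+ k))).
Definition arpoly (M : nat) : {poly C} := \poly_(i < M) toC (arcoef i).

Lemma l1_bounded_mul (a : nat -> R) : (forall k, `|a k| <= 1) -> l1 phi ->
  l1 (fun k => phi k * a k).
Proof.
move=> a1; apply: l1_le => k; rewrite normrM -[leRHS]mulr1 ler_wpM2l //.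
Qed.

Lemma arpoly_horner M z : (0 < M)%N ->
  (arpoly M).[z] = Complex (1 - \sum_(1 <= k < M) phi k * complex.Re (z ^+ k))
                     (- \sum_(1 <= k < M) phi k * complex.Im (z ^+ k)).
Proof.
case: M => // M _; rewrite horner_poly.
rewrite -(big_mkord xpredT (fun i => toC (arcoef i) * z ^+ i)) big_nat_recl //= expr0.
rewrite !big_add1 /=; apply/eqP; rewrite eq_complex /= !raddfD /=.
rewrite Re_sum Im_sum !mulr1 !mulr0 subr0 addr0 add0r -!sumrN.
apply/andP; split; apply/eqP; first congr (_ + _).
  by apply: eq_bigr => i _; case: (z ^+ _) => a b /=; rewrite mul0r subr0 mulNr.
by apply: eq_bigr => i _; case: (z ^+ _) => a b /=; rewrite mul0r addr0 mulNr.
Qed.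

(** The error doubles because the real and imaginary parts are truncated separately. *)
Lemma archar_approx M e z : l1 phi -> (0 < M)%N ->
  (forall N, \sum_(M <= k < N) `|phi k| <= e) -> modc z <= 1 ->
  modc (archar z - (arpoly M).[z]) <= e + e.
Proof.
move=> lphi M0 phie z1.
have zk k : modc (z ^+ k) <= 1 by rewrite modcX exprn_ile1 // modc_ge0.
have rez k : `|complex.Re (z ^+ k)| <= 1 := le_trans (Re_le_modc _) (zk k).
have imz k : `|complex.Im (z ^+ k)| <= 1 := le_trans (Im_le_modc _) (zk k).
have bnd (a : nat -> R) : (forall k, `|a k| <= 1) ->
    `|rser (fun k => phi k * a k) - \sum_(1 <= k < M) phi k * a k| <= e.
  move=> a1; apply: rser_approx => //; first exact: l1_bounded_mul.
  move=> N; apply: le_trans (phie N); apply: ler_sum => k _.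
  by rewrite normrM ler_piMr.
rewrite arpoly_horner // (le_trans (modc_le _)) //= lerD //.
  by rewrite opprB addrC addrA subrK distrC; exact: bnd.
by rewrite opprK addrC distrC bnd.
Qed.

(** Radius 2 rather than 1 leaves room to step slightly outside the closed unit disc, as Wiener's
    lemma requires. *)
Lemma arpoly_lipschitz M : exists2 L, 0 < L & forall z w, modc z <= 2 -> modc w <= 2 ->
  modc ((arpoly M).[z] - (arpoly M).[w]) <= L * modc (z - w).
Proof.
exists (1 + \sum_(k < M) `|arcoef k| * (k%:R * (2 ^+ k * 2 ^+ k))).
  by rewrite ltr_pwDl // sumr_ge0 // => k _; rewrite !mulr_ge0.
move=> z w z2 w2; rewrite !horner_poly -sumrB (le_trans (modc_sum _ _)) //.
rewrite mulrDl mul1r ler_wpDl ?modc_ge0 // mulr_suml; apply: ler_sum => k _.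
rewrite -mulrBr modcM modc_real -mulrA ler_wpM2l // subrXX modcM mulrC.
rewrite ler_wpM2r ?modc_ge0 // (le_trans (modc_sum _ _)) //.
have -> : k%:R = \sum_(i < k) (1 : R) by rewrite sumr_const card_ord.
rewrite mulr_suml; apply: ler_sum => i _.
have pow2 u j : modc u <= 2 -> (j <= k)%N -> modc (u ^+ j) <= 2 ^+ k.
  move=> u2 jk; rewrite modcX (@le_trans _ _ (2 ^+ j)) ?ler_weXn2l ?ler1n //.
  by rewrite lerXn2r ?nnegrE ?modc_ge0.
rewrite mul1r modcM ler_pM ?modc_ge0 ?pow2 //; last by rewrite ltnW.
by rewrite (leq_trans (leq_subr _ _)) ?leq_pred.
Qed.

Lemma disc_compact : compact [set p : R * R | p.1 ^+ 2 + p.2 ^+ 2 <= 1].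
Proof.
apply: (@subclosed_compact (R * R)%type _ ((`[-1, 1]%classic : set R) `*` (`[-1, 1]%classic : set R))).
- apply: (@closed_comp _ _ (fun p : R * R => p.1 ^+ 2 + p.2 ^+ 2) [set x | x <= 1]).
    move=> p _; apply: cvgD; rewrite /= ?expr2.
      by apply: cvgM; exact: cvg_fst.
    by apply: cvgM; exact: cvg_snd.
  exact: closed_le.
- by apply: compact_setX; exact: segment_compact.
- move=> [x y] /= xy; rewrite !in_itv /=.
  have := sqr_ge0 x; have := sqr_ge0 y; split; nra.
Qed.

(** The three approximation errors in the next proof cost at most c/4 each, leaving a quarter of the
    modulus [c] at the centre. *)
Lemma quarter_bound (c a b e1 e2 l q : R) : c <= a + b + e1 + e2 -> b <= c / 8 + c / 8 ->
  e2 <= c / 8 + c / 8 -> e1 <= l -> l <= c / 4 -> q <= c / 4 -> q <= a.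
Proof. lra. Qed.

Lemma archar_lower_bound : l1 phi -> ar_invertible phi ->
  exists2 m, 0 < m & forall z, modc z <= 1 -> m <= modc (archar z).
Proof.
move=> lphi inv; pose D := [set p : R * R | p.1 ^+ 2 + p.2 ^+ 2 <= 1].
have modD p : D p -> modc (Complex p.1 p.2) <= 1.
  by rewrite /D /= => Dp; rewrite /modc /= -sqrtr1 ler_wsqrtr.
(* Looking for a bound of the form 1/(n+1) allows compactness in its near-covering form: a bound
   valid near each point for all large [n] is valid on the whole disc for all large [n]. Near a
   point it comes from a Lipschitz truncation, so continuity of [archar] is never proved. *)
have near1 : \forall n \near \oo, D `<=` (fun p => n.+1%:R^-1 <= modc (archar (Complex p.1 p.2))).
  have /compact_near_coveringP/near_covering_withinP := disc_compact.
  apply; move=> [x0 y0] Dp0; set z0 := Complex x0 y0.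
  have z01 : modc z0 <= 1 by exact: (modD (x0, y0)).
  have c0 : 0 < modc (archar z0).
    rewrite lt0r modc_ge0 andbT modc_eq0; apply/negP; rewrite eq_complex /=.
    rewrite subr_eq0 oppr_eq0 eq_sym => /andP[/eqP re /eqP im].
    by apply: (inv z0).
  set c := modc (archar z0) in c0.
  have c8 : 0 < c / 8 by rewrite divr_gt0.
  have [M0 phiM0] := l1_tail lphi c8.
  pose M := M0.+1.
  have phiM N : \sum_(M <= k < N) `|phi k| <= c / 8.
    apply: le_trans (phiM0 N); have [MN|NM] := ltnP M0 N.
      by rewrite [leRHS](big_cat_nat (n := M)) //= lerDr sumr_ge0.
    by rewrite big_geq ?sumr_ge0 // ltnW.
  have [L L0 lipL] := arpoly_lipschitz M.
  have d0 : 0 < c / (8 * L) by rewrite divr_gt0 // mulr_gt0.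
  have F1 : \forall p \near (x0, y0), `|x0 - p.1| < c / (8 * L).
    by apply/nbhs_ballP; exists (c / (8 * L)) => //= p [].
  have F2 : \forall p \near (x0, y0), `|y0 - p.2| < c / (8 * L).
    by apply/nbhs_ballP; exists (c / (8 * L)) => //= p [].
  near=> p n => Dp.
  have z1 := modD _ Dp; rewrite /= in z1 *; set z := Complex p.1 p.2 in z1 *.
  have dz : modc (z - z0) <= c / (8 * L) + c / (8 * L).
    rewrite (le_trans (modc_le _)) //= lerD // ltW // distrC.
      by near: p.
    by near: p.
  have A1 := archar_approx lphi (ltn0Sn M0) phiM z1.
  have A2 := archar_approx lphi (ltn0Sn M0) phiM z01.
  have one2 : 1 <= 2 :> R by rewrite ler1n.
  have A3 := lipL _ _ (le_trans z1 one2) (le_trans z01 one2).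
  have T : c <= modc (archar z) + modc (archar z - (arpoly M).[z]) +
      modc ((arpoly M).[z] - (arpoly M).[z0]) + modc (archar z0 - (arpoly M).[z0]).
    exact: modc_chain.
  have A4 : L * modc (z - z0) <= c / 4.
    rewrite (le_trans (ler_wpM2l (ltW L0) dz)) // le_eqVlt; apply/orP; left; apply/eqP.
    by field; rewrite gt_eqF.
  have A5 : n.+1%:R^-1 <= c / 4.
    near: n; exists (Num.truncn (4 / c)) => // n /= nc.
    rewrite -[leRHS]invf_div lef_pV2 ?posrE ?divr_gt0 // ltW //.
    by rewrite (lt_le_trans (truncnS_gt _)) // ler_nat ltnS.
  exact: (quarter_bound T A1 A2 A3 A4 A5).
have [N _ N1] := near1.
exists N.+1%:R^-1; first by rewrite invr_gt0.
move=> [x y] z1; apply: (N1 N _ (x, y)) => //=.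
by rewrite -[leRHS]sqrtr1 /modc /= ler_sqrt in z1.
Unshelve. all: by end_near. Qed.

(** Neumann series of 1/(1 - phi) with the value at 0 erased; its n-th power starts at degree n, so
    coefficient [k] is a finite sum. *)
Definition arinv (k : nat) : R :=
  \sum_(n < k.+1) convX (fun i => if i is 0%N then 0 else phi i) n k.

Lemma conv_arinv : conv arcoef arinv =1 cdelta.
Proof.
set phi0 := fun i => if i is 0%N then 0 else phi i.
have arinvE L k : (k < L)%N -> arinv k = \sum_(n < L) convX phi0 n k.
  move=> kL; rewrite /arinv -!(big_mkord xpredT (fun n => convX phi0 n k)).
  rewrite [RHS](big_cat_nat (n := k.+1)) //= [X in _ + X](_ : _ = 0) ?addr0 //.
  by rewrite big_nat big1 // => n /andP[kn _]; rewrite convX_order.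
move=> k; rewrite (@eq_conv1 _ _ (fun i => cdelta i - phi0 i) _ arinv) //; last first.
  by case=> [|i]; rewrite /cdelta /= ?subr0 ?sub0r.
rewrite convBl conv1 (arinvE k.+2) // big_ord_recl.
rewrite (@eq_conv _ _ phi0 _ (fun i => \sum_(n < k.+1) convX phi0 n i) k.+1) //; last first.
  by move=> i; exact: arinvE.
by rewrite conv_sumr addrK.
Qed.

End ARInverse.

Section ARInverseSummable.
Context {R : realType}.
Local Notation C := R[i].
Local Notation toC := (real_complex R).
Variable phi : nat -> R.
Local Notation arcoef := (arcoef phi).
Local Notation arpoly := (arpoly phi).
Local Notation archar := (archar phi).
Local Notation arinv := (arinv phi).

Lemma l1_arinv : l1 phi -> ar_invertible phi -> l1 arinv.
Proof.
move=> lphi inv; have [m m0 mP] := archar_lower_bound lphi inv.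
(* A tail of m/24 costs m/12 on the disc, leaving 11m/12 for the truncation; enlarging the radius to
   1 + x costs another m/12. The resulting 5m/6 exceeds the l1 norm m/24 of the tail, as
   [wiener_bound] demands. *)
have m24 : 0 < m / 24 by rewrite divr_gt0.
have [M0 phiM0] := l1_tail lphi m24; pose M := M0.+1.
have phiM N : \sum_(M <= k < N) `|phi k| <= m / 24.
  apply: le_trans (phiM0 N); have [MN|NM] := ltnP M0 N.
    by rewrite [leRHS](big_cat_nat (n := M)) //= lerDr sumr_ge0.
  by rewrite big_geq ?sumr_ge0 // ltnW.
have PM z : modc z <= 1 -> m * (11 / 12) <= modc (arpoly M).[z].
  move=> z1; have A := archar_approx lphi (ltn0Sn M0) phiM z1.
  have := modcD (archar z - (arpoly M).[z]) (arpoly M).[z].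
  rewrite subrK; have := mP z z1; rewrite -/M in A *; lra.
have [L L0 lipL] := arpoly_lipschitz phi M.
pose x := Num.min 1 (m / (12 * L)).
have x0 : 0 < x by rewrite lt_min ltr01 divr_gt0 // mulr_gt0.
have x1 : x <= 1 by rewrite ge_min lexx.
have xL : L * x <= m / 12.
  have xm : x <= m / (12 * L) by rewrite ge_min lexx orbT.
  rewrite (le_trans (ler_wpM2l (ltW L0) xm)) // le_eqVlt; apply/orP; left; apply/eqP.
  by field; rewrite gt_eqF.
have PM' z : modc z <= 1 + x -> m * (5 / 6) <= modc (arpoly M).[z].
  move=> z1; pose w := z * toC (1 + x)^-1.
  have x10 : 0 < 1 + x by rewrite addr_gt0.
  have zw : z = w * toC (1 + x).
    by rewrite /w -mulrA -rmorphM mulVf ?gt_eqF // rmorph1 mulr1.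
  have w1 : modc w <= 1.
    by rewrite modcM modc_real gtr0_norm ?invr_gt0 // ler_pdivrMr // mul1r.
  have zmw : modc (z - w) <= x.
    rewrite zw -{2}[w]mulr1 -mulrBr -(rmorph1 (real_complex R)) -rmorphB /= modcM modc_real.
    by rewrite addrAC subrr add0r (gtr0_norm x0) ler_piMl // ltW.
  have := lipL z w; rewrite (le_trans z1) ?(le_trans w1) ?ler1n //; last by lra.
  move=> /(_ isT isT) H; have := ler_wpM2l (ltW L0) zmw => H2.
  have := modcD ((arpoly M).[w] - (arpoly M).[z]) (arpoly M).[z].
  rewrite subrK -opprB modcN; have := PM w w1; lra.
(* The full series is the polynomial minus the tail of [phi], which plays the role of [q]. *)
have fE : conv (fun k => (arpoly M)`_k - toC (if (k < M)%N then 0 else phi k))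
    (fun k => toC (arinv k)) =1 cdelta.
  move=> k; transitivity (toC (conv arcoef arinv k)); last first.
    by rewrite (conv_arinv phi) /cdelta; case: eqP => _; rewrite ?rmorph1 ?rmorph0.
  rewrite /conv rmorph_sum; apply: eq_bigr => i _; rewrite rmorphM; congr (_ * _).
  rewrite coef_poly; case: ifP => iM; first by rewrite rmorph0 subr0.
  by rewrite sub0r -rmorphN; case: (i : nat) iM.
have qe N : \sum_(k < N) `|toC (if (k < M)%N then 0 else phi k)| <= toC (m / 24).
  under eq_bigr do rewrite norm_modc modc_real.
  rewrite -rmorph_sum lecR (le_trans _ (phiM N)) //.
  rewrite -(big_mkord xpredT (fun k => `|if (k < M)%N then 0 else phi k|)).
  have [NM|MN] := leqP N M.
    rewrite (@big_geq _ _ _ M) // big_nat big1 // => i /andP[_ iN].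
    by rewrite (leq_trans iN) // normr0.
  rewrite (big_cat_nat (n := M)) ?(ltnW MN) //= big_nat big1 ?add0r => [|i /andP[_ ->]]; last first.
    by rewrite normr0.
  by rewrite big_nat [leRHS]big_nat; apply: ler_sum => i /andP[Mi _]; rewrite ltnNge Mi.
have H := @wiener_bound _ (@complex_arch R) (arpoly M) _ _ (toC (1 + x)) (toC (m * (5 / 6)))
   (toC (m / 24)) _ _ _ _ _ qe fE.
exists ((1 + x) / (1 + x - 1) / (m * (5 / 6) - m / 24)) => N.
rewrite -lecR rmorph_sum.
have := H; rewrite -(rmorph1 (real_complex R)) -!rmorphB -!fmorphV -!rmorphM !lecR !ltcR.
move=> /(_ _ _ _ _ _ N) {}H.
rewrite (eq_bigr (fun k : 'I_N => `|toC (arinv k)|)); last first.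
  by move=> k _; rewrite norm_modc modc_real.
apply: H.
- by rewrite ltrDl.
- by rewrite ltW.
- by lra.
- move=> z; rewrite norm_modc lecR => z1; rewrite norm_modc lecR; exact: PM'.
- by rewrite rmorph0.
Qed.

End ARInverseSummable.

(** * Autocovariances *)

Section CauchySchwarz.
Context {R : realDomainType}.

Lemma sqr_sum_le (A B C a b c : R) : 0 <= A -> 0 <= B -> 0 <= a -> 0 <= b ->
  C ^+ 2 <= A * B -> c ^+ 2 <= a * b -> (C + c) ^+ 2 <= (A + a) * (B + b).
Proof.
move=> A0 B0 a0 b0 CAB cab.
have H : 2 * (C * c) <= A * b + a * B.
  have Ab : 0 <= A * b + a * B by rewrite addr_ge0 ?mulr_ge0.
  rewrite (le_trans (ler_norm _)) // -(@ler_sqr R) ?nnegrE //.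
  rewrite real_normK ?num_real //.
  have : C ^+ 2 * c ^+ 2 <= (A * B) * (a * b) by rewrite ler_pM ?sqr_ge0.
  have := sqr_ge0 (A * b - a * B); nra.
nra.
Qed.

Lemma sum_sqr_le (I : Type) (s : seq I) (a b c : I -> R) :
  (forall i, 0 <= a i) -> (forall i, 0 <= b i) -> (forall i, c i ^+ 2 <= a i * b i) ->
  (\sum_(i <- s) c i) ^+ 2 <= (\sum_(i <- s) a i) * \sum_(i <- s) b i.
Proof.
move=> a0 b0 cab; elim: s => [|i s IH]; first by rewrite !big_nil expr0n mul0r.
rewrite !big_cons addrC [a i + _]addrC [b i + _]addrC.
by apply: sqr_sum_le => //; exact: sumr_ge0.
Qed.

Lemma cauchy_schwarz (I : Type) (s : seq I) (a b : I -> R) :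
  (\sum_(i <- s) a i * b i) ^+ 2 <= (\sum_(i <- s) a i ^+ 2) * \sum_(i <- s) b i ^+ 2.
Proof. by apply: sum_sqr_le => i; rewrite ?sqr_ge0 ?exprMn. Qed.

(** Writing |p| as the square of its root: only the l1 norm of the weights appears, so bounds
    derived from it do not depend on the number of terms. *)
Lemma weighted_cauchy_schwarz (I : Type) (s : seq I) (p x : I -> R) :
  (\sum_(i <- s) p i * x i) ^+ 2 <=
  (\sum_(i <- s) `|p i|) * \sum_(i <- s) `|p i| * x i ^+ 2.
Proof.
apply: sum_sqr_le => i //; first by rewrite mulr_ge0 // sqr_ge0.
by rewrite mulrA -expr2 real_normK ?num_real // exprMn.
Qed.

(** Young's inequality l1 * l2 -> l2; it localises to the first [N] terms since a Cauchy product
    there sees only those terms. *)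
Lemma young_conv (f z : nat -> R) (F : R) (N : nat) :
  \sum_(k < N) `|f k| <= F ->
  \sum_(k < N) conv f z k ^+ 2 <= F ^+ 2 * \sum_(k < N) z k ^+ 2.
Proof.
move=> fF; have F0 : 0 <= F by apply: le_trans fF; exact: sumr_ge0.
have fk k : (k < N)%N -> \sum_(i < k.+1) `|f i| <= F.
  move=> kN; apply: le_trans fF.
  rewrite -!(big_mkord xpredT (fun k => `|f k|)) [leRHS](big_cat_nat (n := k.+1)) //=.
  by rewrite lerDl sumr_ge0.
apply: (@le_trans _ _ (\sum_(k < N) F * `|conv (fun i => `|f i|) (fun i => z i ^+ 2) k|)).
  apply: ler_sum => k _; rewrite (le_trans (weighted_cauchy_schwarz _ _ _)) //.
  rewrite ger0_norm ?sumr_ge0 // => [|i _]; last by rewrite mulr_ge0 // sqr_ge0.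
  rewrite ler_wpM2r ?fk // sumr_ge0 // => i _; by rewrite mulr_ge0 // sqr_ge0.
rewrite -mulr_sumr expr2 -mulrA ler_wpM2l // (le_trans (sum_norm_conv _ _ _)) //.
rewrite (eq_bigr (fun k : 'I_N => `|f k|)) => [|k _]; last by rewrite normr_id.
rewrite [X in _ * X](eq_bigr (fun k : 'I_N => z k ^+ 2)) => [|k _]; last first.
  by rewrite ger0_norm // sqr_ge0.
by rewrite ler_wpM2r // sumr_ge0 // => k _; exact: sqr_ge0.
Qed.

End CauchySchwarz.

Section Autocovariance.
Context {R : realType}.
Variables (f psi : nat -> R) (F S s2 : R).
Hypothesis fpsi : conv f psi =1 cdelta.
Hypothesis fF : forall N, \sum_(k < N) `|f k| <= F.
Hypothesis psiS : forall N, \sum_(k < N) `|psi k| <= S.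
Hypothesis s2_ge0 : 0 <= s2.

(* [shift_coef j i] is the coefficient of eps_{t-i} in Y_{t-j} = sum_i psi_i eps_{t-j-i}, so that
   [acov j k] is E[Y_{t-j} Y_{t-k}] when the innovations have variance [s2]. *)
Definition shift_coef (j i : nat) : R := if (j <= i)%N then psi (i - j)%N else 0.
Definition acov_trunc (L j k : nat) : R :=
  s2 * \sum_(i < L) shift_coef j i * shift_coef k i.
Definition acov (j k : nat) : R := limn (fun L => acov_trunc L j k).

Lemma sum_shift_coef j L : \sum_(i < L) `|shift_coef j i| <= S.
Proof.
have -> : \sum_(i < L) `|shift_coef j i| = \sum_(j <= i < L) `|psi (i - j)%N|.
  rewrite big_geq_mkord [RHS]big_mkcond; apply: eq_bigr => i _ /=.
  by rewrite /shift_coef; case: ifP; rewrite ?normr0.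
rewrite -{1}[j]add0n big_addn big_mkord.
rewrite (eq_bigr (fun i : 'I__ => `|psi i|)) ?psiS // => i _.
by rewrite addnK.
Qed.

Lemma shift_coef_le j i : `|shift_coef j i| <= S.
Proof.
apply: le_trans (sum_shift_coef j i.+1).
by rewrite big_ord_recr /= lerDr sumr_ge0.
Qed.

Lemma l1_shift_coefM j k : l1 (fun i => shift_coef j i * shift_coef k i).
Proof.
exists (S * S) => N; apply: (@le_trans _ _ (\sum_(i < N) S * `|shift_coef k i|)).
  by apply: ler_sum => i _; rewrite normrM ler_wpM2r // shift_coef_le.
rewrite -mulr_sumr ler_wpM2l ?sum_shift_coef //.
by apply: le_trans (sum_shift_coef 0 0); rewrite big_ord0.
Qed.

Lemma acov_cvg j k : (fun L => acov_trunc L j k) @ \oo --> acov j k.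
Proof.
have : cvgn (fun L => s2 * \sum_(0 <= i < L) shift_coef j i * shift_coef k i).
  by apply: is_cvgM; [exact: is_cvg_cst | apply: l1_cvg; exact: l1_shift_coefM].
by rewrite /acov /acov_trunc; under eq_fun do rewrite big_mkord.
Qed.

Lemma conv_shift (x : nat -> R) L i : (i < L)%N ->
  \sum_(j < L) x j * shift_coef j i = conv x psi i.
Proof.
move=> iL; rewrite /conv (big_ord_widen L (fun j => x j * psi (i - j)%N)) //.
rewrite [RHS]big_mkcond; apply: eq_bigr => j _; rewrite /shift_coef ltnS.
by case: ifP; rewrite ?mulr0.
Qed.

(** Gram structure: [conv x psi i] is the coefficient of eps_{t-i} in sum_j x_j Y_{t-j}. *)
Lemma acov_trunc_quad (x y : nat -> R) L :
  \sum_(j < L) \sum_(k < L) x j * y k * acov_trunc L j k =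
  s2 * \sum_(i < L) conv x psi i * conv y psi i.
Proof.
transitivity (\sum_(i < L) \sum_(j < L) \sum_(k < L)
    s2 * ((x j * shift_coef j i) * (y k * shift_coef k i))).
  rewrite [RHS]exchange_big; apply: eq_bigr => j _ /=.
  rewrite [RHS]exchange_big; apply: eq_bigr => k _ /=.
  rewrite /acov_trunc mulr_sumr mulr_sumr; apply: eq_bigr => i _; ring.
rewrite mulr_sumr; apply: eq_bigr => i _.
rewrite -!(conv_shift _ (ltn_ord i)) mulr_suml mulr_sumr; apply: eq_bigr => j _.
by rewrite -!mulr_sumr.
Qed.

Lemma sum_widen0 (G : nat -> R) J L : (J <= L)%N -> (forall j, (J <= j)%N -> G j = 0) ->
  \sum_(j < L) G j = \sum_(j < J) G j.
Proof.
move=> JL G0; rewrite -!(big_mkord xpredT G) (big_cat_nat (n := J)) //=.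
by rewrite [X in _ + X]big_nat [X in _ + X]big1 ?addr0 // => j /andP[Jj _]; exact: G0.
Qed.

Lemma acov_quad_cvg (x y : nat -> R) J :
  (fun L => \sum_(j < J) \sum_(k < J) x j * y k * acov_trunc L j k) @ \oo -->
  \sum_(j < J) \sum_(k < J) x j * y k * acov j k.
Proof.
apply: cvg_sum => j; apply: cvg_sum => k.
by apply: cvgM; [exact: cvg_cst | exact: acov_cvg].
Qed.

Lemma acov_trunc_widen (x y : nat -> R) J L : (J <= L)%N ->
  (forall j, (J <= j)%N -> x j = 0) -> (forall j, (J <= j)%N -> y j = 0) ->
  \sum_(j < J) \sum_(k < J) x j * y k * acov_trunc L j k =
  s2 * \sum_(i < L) conv x psi i * conv y psi i.
Proof.
move=> JL x0 y0; rewrite -acov_trunc_quad.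
rewrite [RHS](@sum_widen0 (fun j => \sum_(k < L) x j * y k * acov_trunc L j k) J) //.
  apply: eq_bigr => j _.
  rewrite [RHS](@sum_widen0 (fun k => x j * y k * acov_trunc L j k) J) // => k Jk.
  by rewrite y0 // mulr0 mul0r.
by move=> j Jj; rewrite big1 // => k _; rewrite x0 // !mul0r.
Qed.

(** Deconvolution: x = f * (x * psi), so Young's inequality with the l1 bound [F] of [f] bounds x by
    x * psi in l2. In spectral terms the density is at least a multiple of s2 / F^2. *)
Lemma acov_lower (x : nat -> R) J : (forall j, (J <= j)%N -> x j = 0) ->
  s2 * \sum_(j < J) x j ^+ 2 <= F ^+ 2 * \sum_(j < J) \sum_(k < J) x j * x k * acov j k.
Proof.
move=> x0.
have cv : (fun L => F ^+ 2 * \sum_(j < J) \sum_(k < J) x j * x k * acov_trunc L j k) @ \oo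
    --> F ^+ 2 * \sum_(j < J) \sum_(k < J) x j * x k * acov j k.
  by apply: cvgM; [exact: cvg_cst | exact: acov_quad_cvg].
apply: (cvgr_to_ge cv); near=> L; have JL : (J <= L)%N by near: L; exact: nbhs_infty_ge.
rewrite acov_trunc_widen // mulrCA ler_wpM2l //.
rewrite -(sum_widen0 JL (G := fun j => x j ^+ 2)) => [|j Jj]; last by rewrite x0 // expr0n.
have xE : x =1 conv f (conv x psi).
  by move=> k; rewrite convCA (eq_conv1 (fun=> erefl) fpsi) conv1r.
rewrite (eq_bigr (fun j : 'I_L => conv f (conv x psi) j ^+ 2)) => [|j _]; last by rewrite -xE.
by apply: young_conv.
Unshelve. all: by end_near. Qed.

(** With all of [f] the form would be (f * psi, y * psi) = y_0 psi_0 = 0, that is, eps_t is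
    orthogonal to the past. Keeping only the indices below [J] thus leaves minus the contribution of
    the tail of [f]. *)
Lemma acov_tail (y : nat -> R) J r2 : (forall j, (J <= j)%N -> y j = 0) -> y 0%N = 0 ->
  (forall N, \sum_(J <= j < N) f j ^+ 2 <= r2) ->
  (\sum_(j < J) \sum_(k < J) f j * y k * acov j k) ^+ 2 <=
  (s2 * S ^+ 2) ^+ 2 * r2 * \sum_(k < J) y k ^+ 2.
Proof.
move=> yJ y0 fr2.
pose f1 j := if (j < J)%N then f j else 0.
pose f2 j := if (j < J)%N then 0 else f j.
have cv : (fun L => (\sum_(j < J) \sum_(k < J) f1 j * y k * acov_trunc L j k) ^+ 2) @ \oo
    --> (\sum_(j < J) \sum_(k < J) f1 j * y k * acov j k) ^+ 2.
  by rewrite expr2; under eq_fun do rewrite expr2; apply: cvgM; exact: acov_quad_cvg.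
have -> : \sum_(j < J) \sum_(k < J) f j * y k * acov j k =
    \sum_(j < J) \sum_(k < J) f1 j * y k * acov j k.
  by apply: eq_bigr => j _; apply: eq_bigr => k _; rewrite /f1 ltn_ord.
apply: (cvgr_to_le cv); near=> L; have JL : (J <= L)%N by near: L; exact: nbhs_infty_ge.
rewrite acov_trunc_widen // => [|j Jj]; last by rewrite /f1 ltnNge Jj.
have -> : \sum_(i < L) conv f1 psi i * conv y psi i =
    - \sum_(i < L) conv f2 psi i * conv y psi i.
  rewrite -sumrN; apply: eq_bigr => i _; rewrite -mulNr.
  (* At i = 0 the factor y * psi vanishes because [y 0 = 0]; elsewhere f * psi vanishes, so f1 * psi
     = - f2 * psi. *)
  have [->|i0] := eqVneq (i : nat) 0%N.
    by rewrite [conv y _ _]big_ord1 y0 mul0r !mulr0.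
  congr (_ * _); apply/eqP; rewrite -addr_eq0.
  have -> : conv f1 psi i + conv f2 psi i = conv f psi i.
    rewrite /conv -big_split; apply: eq_bigr => j _; rewrite /= -mulrDl; congr (_ * _).
    by rewrite /f1 /f2; case: ifP; rewrite ?addr0 ?add0r.
  by rewrite fpsi /cdelta (negbTE i0).
rewrite mulrN sqrrN exprMn (le_trans (ler_wpM2l (sqr_ge0 _) (cauchy_schwarz _ _ _))) //.
have fS g : \sum_(i < L) conv g psi i ^+ 2 <= S ^+ 2 * \sum_(i < L) g i ^+ 2.
  rewrite (eq_bigr (fun i : 'I_L => conv psi g i ^+ 2)) => [|i _]; last by rewrite convC.
  exact: young_conv.
have yE : \sum_(i < L) y i ^+ 2 = \sum_(k < J) y k ^+ 2.
  by apply: (sum_widen0 JL (G := fun j => y j ^+ 2)) => j Jj; rewrite yJ // expr0n.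
have f2E : \sum_(i < L) f2 i ^+ 2 <= r2.
  apply: le_trans (fr2 L); rewrite -(big_mkord xpredT (fun i => f2 i ^+ 2)).
  rewrite (big_cat_nat (n := J)) //= big_nat big1 ?add0r => [|i /andP[_ iJ]]; last first.
    by rewrite /f2 iJ expr0n.
  rewrite big_nat [leRHS]big_nat; apply: ler_sum => i /andP[Ji _].
  by rewrite /f2 ltnNge Ji.
have -> : (s2 * S ^+ 2) ^+ 2 * r2 * \sum_(k < J) y k ^+ 2 =
    s2 ^+ 2 * ((S ^+ 2 * r2) * (S ^+ 2 * \sum_(k < J) y k ^+ 2)) by ring.
rewrite ler_wpM2l ?sqr_ge0 // ler_pM ?sumr_ge0 // => [i _|i _||]; rewrite ?sqr_ge0 //.
  by rewrite (le_trans (fS f2)) // ler_wpM2l ?sqr_ge0.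
by rewrite -yE.
Unshelve. all: by end_near. Qed.

End Autocovariance.

(** * The basic inequality for the penalized criterion *)

Section CoreInequality.
Context {R : realType}.
Implicit Types a b x y lam phi : nat -> R.

Definition qform (J : nat) (g : nat -> nat -> R) x y : R :=
  \sum_(j < J) \sum_(k < J) x j * y k * g j k.

(* Index 0 carries the coefficient 1 of Y_t in Y_t - sum_k b_k Y_{t-k}. *)
Definition weight1 lam (k : nat) : R := if k is 0%N then 1 else lam k.

(** Squared Hilbert-Schmidt norm of the difference of the two forms, in coordinates rescaled by the
    weights of E. *)
Definition wdist2 (J : nat) lam (g h : nat -> nat -> R) : R :=
  \sum_(j < J) \sum_(k < J) ((g j k - h j k) / (weight1 lam j * weight1 lam k)) ^+ 2.

Lemma qform_dist_le J lam g h x y : (forall k, 0 < weight1 lam k) ->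
  (qform J g x y - qform J h x y) ^+ 2 <=
  (\sum_(j < J) (weight1 lam j * x j) ^+ 2) * (\sum_(k < J) (weight1 lam k * y k) ^+ 2) *
  wdist2 J lam g h.
Proof.
move=> v0; set v := weight1 lam.
have v0' k : v k != 0 by rewrite gt_eqF.
have -> : qform J g x y - qform J h x y =
    \sum_(p : 'I_J * 'I_J) ((v p.1 * x p.1) * (v p.2 * y p.2)) *
      ((g p.1 p.2 - h p.1 p.2) / (v p.1 * v p.2)).
  rewrite -(pair_bigA _ (fun j k : 'I_J => ((v j * x j) * (v k * y k)) *
      ((g j k - h j k) / (v j * v k)))) /= /qform -sumrB.
  apply: eq_bigr => j _; rewrite -sumrB; apply: eq_bigr => k _.
  by field; rewrite !v0'.
apply: le_trans (cauchy_schwarz _ _ _) _; rewrite le_eqVlt; apply/orP; left; apply/eqP.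
congr (_ * _).
  rewrite -(pair_bigA _ (fun j k : 'I_J =>
    ((v j * x j) * (v k * y k)) ^+ 2)) /= mulr_suml.
  by apply: eq_bigr => j _; rewrite mulr_sumr; apply: eq_bigr => k _; rewrite exprMn.
by rewrite -(pair_bigA _ (fun j k : 'I_J =>
    ((g j k - h j k) / (v j * v k)) ^+ 2)).
Qed.

(** Here [n] is the l2 error, [x] the error in E, [L] and [r] the low and high parts of the penalty
    bias. Young's inequality on 2 tau L n uses up exactly the remaining c/2 n^2; after division by
    [tau], [x >= e0] would give x^2/2 <= x^2/8 + x^2/8. *)
Lemma penalized_basic_ineq (c tau eta n x L r Fp e0 : R) :
  0 < c -> 0 < tau -> eta <= 2^-1 -> 0 <= x -> 0 < e0 ->
  c * n ^+ 2 - eta * tau * x ^+ 2 - 2 * (c / 4 * n ^+ 2 + Fp * x * (eta * tau))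
    + tau * (x ^+ 2 - 2 * (L * n + r * x)) <= 0 ->
  16 * (Fp * eta + r) <= e0 -> 4 / c * tau * L ^+ 2 <= e0 ^+ 2 / 4 -> x < e0.
Proof.
move=> c0 t0 eta2 x0 e00 H H1 H2; rewrite ltNge; apply/negP => ex.
have A1 : 2 * tau * L * n <= c / 2 * n ^+ 2 + 2 / c * tau ^+ 2 * L ^+ 2.
  rewrite -subr_ge0.
  have -> : c / 2 * n ^+ 2 + 2 / c * tau ^+ 2 * L ^+ 2 - 2 * tau * L * n =
    (c * n - 2 * tau * L) ^+ 2 / (2 * c) by field; rewrite gt_eqF.
  by rewrite divr_ge0 ?sqr_ge0 // mulr_ge0 // ltW.
have A2 : tau * ((1 - eta) * x ^+ 2) <= tau * (2 * (Fp * eta + r) * x + 2 / c * tau * L ^+ 2).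
  have -> : tau * (2 * (Fp * eta + r) * x + 2 / c * tau * L ^+ 2) =
    tau * (2 * (Fp * eta + r) * x) + 2 / c * tau ^+ 2 * L ^+ 2 by ring.
  move: A1 H; set Z := 2 / c * _ * _; nra.
rewrite ler_pM2l // in A2.
have A3 : 2 * (Fp * eta + r) * x <= e0 / 8 * x by rewrite ler_wpM2r //; lra.
have A4 : 2 / c * tau * L ^+ 2 <= e0 ^+ 2 / 8.
  have -> : 2 / c * tau * L ^+ 2 = (4 / c * tau * L ^+ 2) / 2 by field; rewrite gt_eqF.
  lra.
have A5 : 2^-1 * x ^+ 2 <= (1 - eta) * x ^+ 2 by rewrite ler_wpM2r ?sqr_ge0 //; lra.
have A6 : e0 ^+ 2 <= x ^+ 2 by rewrite lerXn2r // nnegrE ltW.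
have A7 : e0 * x <= x ^+ 2 by rewrite expr2 ler_wpM2r.
have : 0 < e0 ^+ 2 by rewrite exprn_gt0.
lra.
Qed.

Lemma le_sqrM (a b c : R) : 0 <= c -> a ^+ 2 <= b * c ^+ 2 -> 0 <= b -> a <= Num.sqrt b * c.
Proof.
move=> c0 H b0; rewrite (le_trans (ler_norm _)) // -[leRHS]ger0_norm ?mulr_ge0 ?sqrtr_ge0 //.
by rewrite -ler_sqr ?nnegrE // !real_normK ?num_real // exprMn sqr_sqrtr.
Qed.

(* In the first alternative the l2 error is of the order of the l2 tail of [phi] beyond the sieve
   dimension, which the growth of [lam] then converts into a small error in the norm of E. *)
Lemma penalized_dichotomy (J M : nat) lam phi b (g gh : nat -> nat -> R)
    (c Cq r2 tau eta L2 rM2 Phi e0 : R) :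
  (forall k, 0 < weight1 lam k) -> (0 < M)%N -> (M <= J)%N ->
  0 < c -> 0 <= Cq -> 0 < tau -> 0 <= eta <= 2^-1 -> 0 < e0 -> 0 <= r2 ->
  (forall j k, gh j k = gh k j) ->
  (forall y, (forall k, (J <= k)%N -> y k = 0) -> c * \sum_(k < J) y k ^+ 2 <= qform J g y y) ->
  (forall y, (forall k, (J <= k)%N -> y k = 0) -> y 0%N = 0 ->
     qform J g (arcoef phi) y ^+ 2 <= Cq * r2 * \sum_(k < J) y k ^+ 2) ->
  wdist2 J lam gh g <= (eta * tau) ^+ 2 ->
  \sum_(1 <= k < J) (lam k * phi k) ^+ 2 <= Phi ->
  \sum_(1 <= k < M) (lam k ^+ 2 * phi k) ^+ 2 <= L2 ->
  \sum_(M <= k < J) (lam k * phi k) ^+ 2 <= rM2 ->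
  qform J gh (arcoef b) (arcoef b) + tau * \sum_(1 <= k < J) (lam k * b k) ^+ 2 <=
  qform J gh (arcoef phi) (arcoef phi) + tau * \sum_(1 <= k < J) (lam k * phi k) ^+ 2 ->
  16 * (Num.sqrt (1 + Phi) * eta + Num.sqrt rM2) <= e0 ->
  4 / c * tau * L2 <= e0 ^+ 2 / 4 ->
  \sum_(1 <= k < J) (b k - phi k) ^+ 2 < 16 * Cq / c ^+ 2 * r2 \/
  \sum_(1 <= k < J) (lam k * (b k - phi k)) ^+ 2 < e0 ^+ 2.
Proof.
move=> v0 M0 MJ c0 Cq0 t0 /andP[eta0 eta2] e00 r20 ghC gl gt T PhiE L2E rM2E Hmin He0 Ht.
pose D k := if (0 < k < J)%N then b k - phi k else 0.
have D0 : D 0%N = 0 by [].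
have DJ k : (J <= k)%N -> D k = 0 by move=> Jk; rewrite /D [(k < J)%N]ltnNge Jk andbF.
have sumD (G : nat -> R -> R) : (forall k, G k 0 = 0) ->
    \sum_(k < J) G k (D k) = \sum_(1 <= k < J) G k (b k - phi k).
  move=> G0; rewrite -(big_mkord xpredT (fun k => G k (D k))) big_ltn ?(leq_trans M0) //.
  rewrite D0 G0 add0r big_nat [RHS]big_nat; apply: eq_bigr => k /andP[k1 kJ].
  by rewrite /D kJ andbT k1.
set N2 := \sum_(1 <= k < J) (b k - phi k) ^+ 2.
set E2 := \sum_(1 <= k < J) (lam k * (b k - phi k)) ^+ 2.
have N2D : \sum_(k < J) D k ^+ 2 = N2.
  by rewrite (sumD (fun _ d => d ^+ 2)) // => k; rewrite expr0n.
have E2D : \sum_(k < J) (weight1 lam k * D k) ^+ 2 = E2.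
  rewrite (sumD (fun k d => (weight1 lam k * d) ^+ 2)) => [|k]; last by rewrite mulr0 expr0n.
  by rewrite big_nat [RHS]big_nat; apply: eq_bigr => -[].
(* Above this threshold the bound Cq r2 N2 on the square of the truncation term is at most (c/4
   N2)^2, so that term is absorbed by the curvature. *)
have [N2r|N2r] := ltP N2 (16 * Cq / c ^+ 2 * r2); [by left | right].
have N20 : 0 <= N2 by rewrite -N2D sumr_ge0 // => k _; exact: sqr_ge0.
have E20 : 0 <= E2 by rewrite -E2D sumr_ge0 // => k _; exact: sqr_ge0.
have T0 : 0 <= wdist2 J lam gh g.
  by apply: sumr_ge0 => j _; apply: sumr_ge0 => k _; exact: sqr_ge0.
pose f := arcoef phi.
have fb k : (k < J)%N -> arcoef b k = f k - D k.
  case: k => [|k] kJ; first by rewrite D0 subr0.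
  by rewrite /f /D /= kJ opprB addKr.
have qb : qform J gh (arcoef b) (arcoef b) =
    qform J gh f f - 2 * qform J gh f D + qform J gh D D.
  have -> : qform J gh (arcoef b) (arcoef b) =
     qform J gh f f - qform J gh f D - qform J gh D f + qform J gh D D.
    rewrite /qform -!sumrB -big_split; apply: eq_bigr => j _.
    rewrite -!sumrB -big_split; apply: eq_bigr => k _ /=; rewrite !fb //; ring.
  have -> : qform J gh D f = qform J gh f D.
    rewrite /qform exchange_big; apply: eq_bigr => j _; apply: eq_bigr => k _ /=.
    by rewrite ghC; ring.
  ring.
set P := \sum_(1 <= k < J) (lam k ^+ 2 * phi k) * (b k - phi k).
have bE : \sum_(1 <= k < J) (lam k * b k) ^+ 2 =
    \sum_(1 <= k < J) (lam k * phi k) ^+ 2 + E2 + 2 * P.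
  by rewrite mulr_sumr -!big_split; apply: eq_bigr => k _ /=; ring.
have E2s : Num.sqrt E2 ^+ 2 = E2 by rewrite sqr_sqrtr.
have N2s : Num.sqrt N2 ^+ 2 = N2 by rewrite sqr_sqrtr.
have et0 : 0 <= eta * tau by rewrite mulr_ge0 // ltW.
have devU x : qform J gh x D - qform J g x D <=
   Num.sqrt (\sum_(j < J) (weight1 lam j * x j) ^+ 2) * (Num.sqrt E2 * (eta * tau)).
  apply: le_sqrM; rewrite ?mulr_ge0 ?sqrtr_ge0 ?(ltW t0) //; last first.
    by apply: sumr_ge0 => j _; exact: sqr_ge0.
  rewrite (le_trans (qform_dist_le _ _ _ _ _ v0)) // E2D exprMn E2s -!mulrA.
  rewrite ler_wpM2l ?ler_wpM2l //.
  by apply: sumr_ge0 => j _; exact: sqr_ge0.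
have dev' : qform J g D D - qform J gh D D <= eta * tau * E2.
  rewrite (le_trans (ler_norm _)) // -(@ler_sqr R) ?nnegrE ?mulr_ge0 ?(ltW t0) //.
  rewrite real_normK ?num_real // -sqrrN opprB.
  rewrite (le_trans (qform_dist_le _ _ _ _ _ v0)) // E2D -expr2 mulrC exprMn.
  by rewrite ler_wpM2r ?sqr_ge0.
have fnorm : \sum_(j < J) (weight1 lam j * f j) ^+ 2 <= 1 + Phi.
  rewrite -(big_mkord xpredT (fun j => (weight1 lam j * f j) ^+ 2)) big_ltn ?(leq_trans M0) //.
  rewrite /f /= mul1r expr1n lerD2l (le_trans _ PhiE) // le_eqVlt; apply/orP; left; apply/eqP.
  by rewrite big_nat [RHS]big_nat; apply: eq_bigr => -[//|k] _ /=; rewrite mulrN sqrrN.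
have devf : qform J gh f D <= c / 4 * N2 + Num.sqrt (1 + Phi) * Num.sqrt E2 * (eta * tau).
  have H1 := devU f; have H2 : qform J g f D <= c / 4 * N2.
    rewrite (le_trans (ler_norm _)) // -(@ler_sqr R) ?nnegrE //; last first.
      by rewrite mulr_ge0 // divr_ge0 // ltW.
    rewrite real_normK ?num_real // (le_trans (gt D DJ D0)) // N2D exprMn [N2 ^+ 2]expr2 mulrA.
    rewrite ler_wpM2r // -ler_pdivrMl; last by rewrite exprn_gt0 // divr_gt0.
    rewrite (le_trans _ N2r) // le_eqVlt; apply/orP; left; apply/eqP.
    by field; rewrite gt_eqF.
  have H3 : Num.sqrt (\sum_(j < J) (weight1 lam j * f j) ^+ 2) * (Num.sqrt E2 * (eta * tau)) <=
      Num.sqrt (1 + Phi) * Num.sqrt E2 * (eta * tau).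
    by rewrite mulrA ler_wpM2r // ler_wpM2r ?sqrtr_ge0 // ler_wsqrtr.
  lra.
(* The cross term of the penalty is cut at [M]: below, lam^2 phi is paired with the l2 error; above,
   lam phi is paired with the error in E. *)
have PE : - P <= Num.sqrt L2 * Num.sqrt N2 + Num.sqrt rM2 * Num.sqrt E2.
  have L20 : 0 <= L2 by apply: le_trans L2E; apply: sumr_ge0 => k _; exact: sqr_ge0.
  have rM20 : 0 <= rM2 by apply: le_trans rM2E; apply: sumr_ge0 => k _; exact: sqr_ge0.
  rewrite /P (big_cat_nat M0 MJ) opprD lerD //.
    apply: le_sqrM; rewrite ?sqrtr_ge0 // sqrrN N2s (le_trans (cauchy_schwarz _ _ _)) //.
    rewrite ler_pM // ?sumr_ge0 // => [i _|i _|]; rewrite ?sqr_ge0 //.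
    rewrite /N2 (big_cat_nat M0 MJ) lerDl sumr_ge0 // => i _; exact: sqr_ge0.
  apply: le_sqrM; rewrite ?sqrtr_ge0 // sqrrN E2s.
  have -> : \sum_(M <= k < J) lam k ^+ 2 * phi k * (b k - phi k) =
     \sum_(M <= k < J) (lam k * phi k) * (lam k * (b k - phi k)).
    by apply: eq_bigr => k _; ring.
  rewrite (le_trans (cauchy_schwarz _ _ _)) // ler_pM // ?sumr_ge0 // => [i _|i _|]; rewrite ?sqr_ge0 //.
  rewrite /E2 [leRHS](big_cat_nat M0 MJ) lerDr sumr_ge0 // => i _; exact: sqr_ge0.
have glD := gl D DJ; rewrite N2D in glD.
rewrite -E2s ltr_pXn2r ?nnegrE ?sqrtr_ge0 ?(ltW e00) //.
have L20 : 0 <= L2 by apply: le_trans L2E; apply: sumr_ge0 => k _; exact: sqr_ge0.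
apply: (@penalized_basic_ineq c tau eta (Num.sqrt N2) _ (Num.sqrt L2) (Num.sqrt rM2)
  (Num.sqrt (1 + Phi))) => //; rewrite ?sqrtr_ge0 ?N2s ?E2s ?(sqr_sqrtr L20) //.
move: Hmin; rewrite qb bE.
have tP : tau * - P <= tau * (Num.sqrt L2 * Num.sqrt N2 + Num.sqrt rM2 * Num.sqrt E2).
  by rewrite ler_pM2l.
move: devf dev' glD tP; clear.
move: (qform J gh f D) (qform J gh D D) (qform J g D D) (qform J gh f f).
move: (\sum_(1 <= k < J) (lam k * phi k) ^+ 2) (Num.sqrt (1 + Phi) * Num.sqrt E2).
move: (Num.sqrt L2 * Num.sqrt N2 + Num.sqrt rM2 * Num.sqrt E2); move: N2 E2 P.
move=> N2 E2 P Q a0 a1 a2 a3 a4 a5 *; nra.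
Qed.

End CoreInequality.

(** * The weights and the space E *)

Section ZetaBound.
Context {R : realType}.

(* Cauchy condensation *)
Lemma zeta_bound (a : R) : 1 < a ->
  exists W, forall N, \sum_(1 <= k < N) (k%:R `^ a)^-1 <= W.
Proof.
move=> a1; have a0 : 0 <= a by apply: ltW; apply: lt_trans a1.
(* The block from 2^m to 2^(m+1) has 2^m terms, each at most 2^(-ma), so it contributes at most
   q^m. *)
pose q : R := 2 / 2 `^ a.
have q0 : 0 <= q by rewrite divr_ge0 ?powR_ge0.
have q1 : q < 1.
  rewrite ltr_pdivrMr ?powR_gt0 // mul1r -mulr_powRB1 ?(lt_trans ltr01) // ltr_pMr //.
  have := @gt0_ltr_powR R (a - 1); rewrite subr_gt0 => /(_ a1 1 2).
  by rewrite powR1; apply; rewrite ?nnegrE ?ltr1n.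
have step m : \sum_(1 <= k < (2 ^ m)%N) (k%:R `^ a)^-1 <= \sum_(i < m) q ^+ i.
  elim: m => [|m IH]; first by rewrite big_geq // big_ord0.
  have m0 : (0 < 2 ^ m)%N by rewrite expn_gt0.
  rewrite big_ord_recr (big_cat_nat (n := (2 ^ m)%N)) //=; last by rewrite leq_exp2l.
  rewrite lerD // (@le_trans _ _ (\sum_(2 ^ m <= k < 2 ^ m.+1) ((2 ^ m)%:R `^ a)^-1)) //.
    rewrite big_nat [leRHS]big_nat; apply: ler_sum => k /andP[mk _].
    rewrite lef_pV2 ?posrE ?powR_gt0 ?ltr0n ?(leq_trans m0) //.
    by rewrite ge0_ler_powR ?nnegrE ?ler0n // ler_nat.
  rewrite sumr_const_nat expnS mul2n -addnn addnK -[leLHS]mulr_natl natrX.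
  rewrite -(powR_mulrn m (ler0n R 2)) [X in _ / X]powRAC !powR_mulrn ?powR_ge0 //.
  by rewrite /q exprMn exprVn.
exists (1 - q)^-1 => N.
apply: (@le_trans _ _ (\sum_(1 <= k < (2 ^ N)%N) (k%:R `^ a)^-1)).
  have [N0|N0] := posnP N; first by rewrite N0 !big_geq.
  rewrite [leRHS](big_cat_nat N0 (ltnW (ltn_expl N (isT : (1 < 2)%N)))) /= lerDl; apply: sumr_ge0 => k _.
  by rewrite invr_ge0 powR_ge0.
apply: le_trans (step N) _.
rewrite -[leRHS]mul1r ler_pdivlMr ?subr_gt0 // mulrC -opprB mulNr -subrX1 opprB.
by rewrite lerBlDr lerDl exprn_ge0.
Qed.

End ZetaBound.

Section ESpace.
Context {R : realType}.
Variables (lambda c1 c2 : R) (lam : nat -> R).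
Hypothesis lambda_gt : 1 / 2 < lambda.
Hypothesis c1_gt0 : 0 < c1.
Hypothesis lamP : forall k, (1 <= k)%N ->
  c1 * (k%:R `^ lambda) <= lam k /\ lam k <= c2 * (k%:R `^ lambda).
Implicit Types b phi : nat -> R.

Let lambda_ge0 : 0 <= lambda.
Proof. by move: lambda_gt; lra. Qed.

Lemma lam_gt0 k : (0 < k)%N -> 0 < lam k.
Proof.
move=> k0; have [H _] := lamP k0.
by rewrite (lt_le_trans _ H) // mulr_gt0 // powR_gt0 // ltr0n.
Qed.

(** Comparison with the zeta series of exponent 2 lambda > 1. *)
Lemma sum_inv_lam : exists W, forall N, \sum_(1 <= k < N) (lam k ^+ 2)^-1 <= W.
Proof.
have [|W WP] := @zeta_bound R (2 * lambda); first by move: lambda_gt; lra.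
exists ((c1 ^+ 2)^-1 * W) => N.
rewrite (le_trans _ (ler_wpM2l _ (WP N))) ?invr_ge0 ?sqr_ge0 // mulr_sumr.
rewrite big_nat [leRHS]big_nat; apply: ler_sum => k /andP[k0 _].
rewrite -invfM lef_pV2 ?posrE ?exprn_gt0 ?lam_gt0 ?mulr_gt0 ?exprn_gt0 ?powR_gt0 ?ltr0n //.
rewrite mulrC [2 * _]mulrC powRrM powR_mulrn ?powR_ge0 // -exprMn mulrC.
have [H _] := lamP k0.
by rewrite lerXn2r ?nnegrE ?(ltW (lam_gt0 k0)) // mulr_ge0 ?powR_ge0 // ltW.
Qed.

Lemma Espace_sum phi : in_Espace lam phi ->
  exists Phi, forall N, \sum_(1 <= k < N) (lam k * phi k) ^+ 2 <= Phi.
Proof.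
rewrite /in_Espace /enorm2; set s := (\sum_(_ <= _ <oo) _)%E => sfin.
have s0 : (0 <= s)%E by apply: nneseries_ge0 => k _ _; rewrite lee_fin mulr_ge0 ?sqr_ge0.
exists (fine s) => N; rewrite -lee_fin fineK; last by rewrite ge0_fin_numE.
rewrite -sumEFin.
under eq_bigr do rewrite exprMn.
by apply: nneseries_lim_ge => k _ _; rewrite lee_fin mulr_ge0 ?sqr_ge0.
Qed.

Lemma Espace_l1_sqr phi : in_Espace lam phi ->
  l1 (fun k => if k is 0%N then 0 else (lam k * phi k) ^+ 2).
Proof.
move=> /Espace_sum[Phi PhiP]; exists Phi => -[|N].
  by rewrite big_ord0; apply: le_trans (PhiP 0%N); rewrite big_geq.
rewrite big_ord_recl normr0 add0r (le_trans _ (PhiP N.+1)) // big_add1 big_mkord.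
by apply: ler_sum => k _; rewrite ger0_norm // sqr_ge0.
Qed.

Lemma Espace_tail phi e : in_Espace lam phi -> 0 < e ->
  exists M, forall J, (M <= J)%N -> forall N, \sum_(J <= k < N) (lam k * phi k) ^+ 2 <= e.
Proof.
move=> /Espace_l1_sqr/l1_tail/[apply] -[M MP]; exists M.+1 => J MJ N.
apply: le_trans (MP N); have [JN|NJ] := leqP J N; last first.
  by rewrite big_geq ?sumr_ge0 // ltnW.
rewrite [leRHS](big_cat_nat (n := J)) //=; last by rewrite ltnW.
apply: ler_wpDl; first exact: sumr_ge0.
rewrite big_nat [leRHS]big_nat; apply: ler_sum => -[|k] /andP[Jk _].
  by move: MJ; rewrite leqNgt ltnS (leq_trans Jk).
by rewrite ger0_norm // sqr_ge0.
Qed.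

Lemma Espace_l1 phi : in_Espace lam phi -> l1 phi.
Proof.
move=> /Espace_sum[Phi PhiP]; have [W WP] := sum_inv_lam.
exists (`|phi 0%N| + (Phi + W)) => -[|N].
  rewrite big_ord0 addr_ge0 // addr_ge0 //.
    by apply: le_trans (PhiP 0%N); rewrite big_geq.
  by apply: le_trans (WP 0%N); rewrite big_geq.
rewrite -(big_mkord xpredT (fun k => `|phi k|)) big_ltn // lerD2l.
rewrite (le_trans _ (lerD (PhiP N.+1) (WP N.+1))) // -big_split /= big_nat [leRHS]big_nat.
apply: ler_sum => k /andP[k0 _]; have l0 := lam_gt0 k0.
have -> : `|phi k| = (lam k * `|phi k|) * (lam k)^-1 by field; rewrite gt_eqF.
have -> : (lam k * phi k) ^+ 2 = (lam k * `|phi k|) ^+ 2.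
  by rewrite !exprMn real_normK ?num_real.
rewrite -exprVn; move: (lam k * _) (lam k)^-1 => u v.
have := sqr_ge0 (u - v); have := sqr_ge0 u; have := sqr_ge0 v; nra.
Qed.

Lemma l2_tail_le phi (K : nat) e : (0 < K)%N ->
  (forall N, \sum_(K.+1 <= k < N) (lam k * phi k) ^+ 2 <= e) ->
  forall N, \sum_(K.+1 <= k < N) phi k ^+ 2 <= e / (c1 * (K%:R `^ lambda)) ^+ 2.
Proof.
move=> K0 eP N.
have cK0 : 0 < c1 * (K%:R `^ lambda) by rewrite mulr_gt0 // powR_gt0 // ltr0n.
rewrite ler_pdivlMr ?exprn_gt0 // (le_trans _ (eP N)) // mulr_suml.
rewrite big_nat [leRHS]big_nat; apply: ler_sum => k /andP[Kk _].
rewrite [leRHS]exprMn mulrC ler_wpM2r ?sqr_ge0 //.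
have k0 : (0 < k)%N by apply: leq_trans Kk.
rewrite lerXn2r ?nnegrE ?(ltW (lam_gt0 k0)) ?(ltW cK0) // (le_trans _ (lamP k0).1) //.
rewrite ler_wpM2l ?(ltW c1_gt0) // ge0_ler_powR ?nnegrE ?ler0n // ler_nat.
exact: ltnW.
Qed.

(** Inverse inequality on the sieve: the factor K^lambda cancels the one gained in [l2_tail_le], up
    to c2 / c1. *)
Lemma enorm_le_l2 (x : nat -> R) K : (0 < K)%N ->
  \sum_(1 <= k < K.+1) (lam k * x k) ^+ 2 <=
  (c2 * (K%:R `^ lambda)) ^+ 2 * \sum_(1 <= k < K.+1) x k ^+ 2.
Proof.
move=> K0; rewrite mulr_sumr big_nat [leRHS]big_nat; apply: ler_sum => k /andP[k0 kK].
rewrite exprMn ler_wpM2r ?sqr_ge0 //.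
have c20 : 0 < c2.
  have := lt_le_trans (lam_gt0 k0) (lamP k0).2.
  by rewrite pmulr_lgt0 // powR_gt0 // ltr0n.
rewrite lerXn2r ?nnegrE ?(ltW (lam_gt0 k0)) ?mulr_ge0 ?(ltW c20) ?powR_ge0 //.
rewrite (le_trans (lamP k0).2) // ler_wpM2l ?(ltW c20) // ge0_ler_powR ?nnegrE ?ler0n //.
by rewrite ler_nat -ltnS.
Qed.

(** Isolates the random part of a norm in a finite sum plus a deterministic constant, which makes it
    visibly measurable. *)
Lemma enorm2_split b phi J : (0 < J)%N -> in_Espace lam phi ->
  (forall k, (J <= k)%N -> b k = phi k) ->
  enorm lam b = Num.sqrt (\sum_(1 <= k < J) (lam k * b k) ^+ 2 +
    fine (\sum_(J <= k <oo) ((lam k ^+ 2 * phi k ^+ 2)%:E))%E).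
Proof.
move=> J0 phiE bphi; rewrite /enorm /enorm2; congr Num.sqrt.
have pos (c : nat -> R) k : (0 <= ((lam k ^+ 2 * c k ^+ 2)%:E))%E.
  by rewrite lee_fin mulr_ge0 ?sqr_ge0.
have split c : (\sum_(1 <= k <oo) ((lam k ^+ 2 * c k ^+ 2)%:E) =
   \sum_(1 <= k < J) ((lam k ^+ 2 * c k ^+ 2)%:E) +
   \sum_(J <= k <oo) ((lam k ^+ 2 * c k ^+ 2)%:E))%E.
  have [j ->] : exists j, J = (1 + j)%N by exists J.-1; rewrite add1n prednK.
  by rewrite -nneseries_split.
rewrite split; have -> : (\sum_(J <= k <oo) ((lam k ^+ 2 * b k ^+ 2)%:E) =
   \sum_(J <= k <oo) ((lam k ^+ 2 * phi k ^+ 2)%:E))%E.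
  apply/congr_lim/funext => n; apply: eq_big_nat => k /andP[Jk _].
  by rewrite bphi.
rewrite sumEFin fineD //.
  by rewrite /=; congr (_ + _); apply: eq_bigr => k _; rewrite exprMn.
rewrite ge0_fin_numE; last by apply: nneseries_ge0.
apply: le_lt_trans phiE; rewrite /enorm2 split leeDr //.
by apply: sume_ge0.
Qed.

Lemma enorm_triangle (b phi : nat -> R) J :
  Num.sqrt (\sum_(1 <= k < J) (lam k * b k) ^+ 2) <=
  Num.sqrt (\sum_(1 <= k < J) (lam k * phi k) ^+ 2) +
  Num.sqrt (\sum_(1 <= k < J) (lam k * (b k - phi k)) ^+ 2).
Proof.
have s0 (c : nat -> R) : 0 <= \sum_(1 <= k < J) (lam k * c k) ^+ 2.
  by apply: sumr_ge0 => k _; exact: sqr_ge0.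
rewrite -(@ler_sqr R) ?nnegrE ?addr_ge0 ?sqrtr_ge0 // sqrrD !sqr_sqrtr ?s0 ?(s0 (fun k => b k - phi k)) //.
have -> : \sum_(1 <= k < J) (lam k * b k) ^+ 2 =
   \sum_(1 <= k < J) (lam k * phi k) ^+ 2 +
   (\sum_(1 <= k < J) (lam k * phi k) * (lam k * (b k - phi k))) *+ 2 +
   \sum_(1 <= k < J) (lam k * (b k - phi k)) ^+ 2.
  by rewrite -sumrMnl -!big_split; apply: eq_bigr => k _ /=; ring.
rewrite lerD2r lerD2l lerMn2r /= (le_trans (ler_norm _)) //.
by rewrite -sqrtrM ?s0 // -sqrtr_sqr ler_wsqrtr // cauchy_schwarz.
Qed.

End ESpace.

(** * Moments of the innovations *)

Section IndependentProduct.
Context {R : realType} {d : measure_display} {Omega : measurableType d}.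
Variable P : probability Omega R.

(** Rectangles determine a measure on the plane, so the joint law is the product law and Fubini
    factorises the integral. *)
Lemma expectation_indep_prod (X Z : {mfun Omega >-> R}) :
  (forall A B : set R, measurable A -> measurable B ->
     P (X @^-1` A `&` Z @^-1` B) = (P (X @^-1` A) * P (Z @^-1` B))%E) ->
  P.-integrable setT (EFin \o X) -> P.-integrable setT (EFin \o Z) ->
  P.-integrable setT (fun w => (X w * Z w)%:E) ->
  (\int[P]_w (X w * Z w)%:E = (\int[P]_w (X w)%:E) * \int[P]_w (Z w)%:E)%E.
Proof.
move=> XZ iX iZ iXZ.
have mXZ : measurable_fun setT (fun w => (X w, Z w)).
  by apply/measurable_fun_pairP; split.
pose XZ' : {mfun Omega >-> (R * R)%type} := HB.pack (fun w => (X w, Z w))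
  (isMeasurableFun.Build _ _ _ _ _ mXZ).
have mulm : measurable_fun [set: R * R] (EFin \o (fun z : R * R => z.1 * z.2)).
  by apply/measurable_EFinP; apply: measurable_funM.
have dist S : measurable S -> (distribution P X \x distribution P Z)%E S = distribution P XZ' S.
  by apply: product_measure_unique => A B mA mB; rewrite /distribution /pushforward -XZ.
have iprod : (distribution P X \x distribution P Z)%E.-integrable setT
    (fun z : R * R => (z.1 * z.2)%:E).
  have /integrableP[_ H] := integrable_pushforward mXZ mulm iXZ measurableT.
  apply/integrableP; split => //; apply: le_lt_trans H.
  rewrite (@eq_measure_integral _ _ _ _ (distribution P XZ')) // => A mA _.
  exact: dist.
transitivity (\int[distribution P XZ']_z (z.1 * z.2)%:E)%E.
  by rewrite integral_distribution.
transitivity (\int[distribution P X \x distribution P Z]_z (z.1 * z.2)%:E)%E.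
  by apply: eq_measure_integral => A mA _; exact: (esym (dist _ mA)).
rewrite -integral12_prod_meas1 // /fubini_F.
have EZ : (\int[distribution P Z]_y y%:E = \int[P]_w (Z w)%:E)%E.
  by rewrite integral_distribution //; exact/measurable_EFinP.
have EX : (\int[distribution P X]_y y%:E = \int[P]_w (X w)%:E)%E.
  by rewrite integral_distribution //; exact/measurable_EFinP.
have iZ' : (distribution P Z).-integrable setT (EFin : R -> \bar R).
  exact: (integrable_pushforward (measurable_funP Z) _ iZ measurableT).
have iX' : (distribution P X).-integrable setT (EFin : R -> \bar R).
  exact: (integrable_pushforward (measurable_funP X) _ iX measurableT).
have EZfin : (\int[P]_w (Z w)%:E)%E \is a fin_num by exact: integrable_fin_num.
transitivity (\int[distribution P X]_x (x%:E * \int[P]_w (Z w)%:E))%E.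
  apply: eq_integral => x _ /=.
  by under eq_integral do rewrite EFinM; rewrite integralZl // EZ.
by rewrite -(fineK EZfin) integralZr // EX.
Qed.

End IndependentProduct.

Section IndependentSequence.
Context {R : realType} {d : measure_display} {Omega : measurableType d}.
Variable P : probability Omega R.
Variable eps : int -> Omega -> R.
Hypothesis meps : forall t, measurable_fun setT (eps t).
Hypothesis indep : mutually_independent P eps.

(** A pi-system generating the sigma-algebra of all innovations except the i-th. *)
Definition cylinders_off (i : int) : set (set Omega) :=
  [set A | exists (I : seq int) (B : int -> set R), [/\ uniq I, i \notin I,
     forall j, measurable (B j) & A = \bigcap_(j in [set` I]) (eps j @^-1` B j)]].

Lemma meas_eps_preimage t (B : set R) : measurable B -> measurable (eps t @^-1` B).
Proof. by move=> mB; rewrite -[X in measurable X]setTI; exact: meps. Qed.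

Lemma cylinders_off_setI i : setI_closed (cylinders_off i).
Proof.
move=> _ _ [I1 [B1 [u1 i1 m1 ->]]] [I2 [B2 [u2 i2 m2 ->]]].
(* [setT] imposes nothing at an index missing from one list, and [undup] restores the uniqueness
   under which independence is stated. *)
exists (undup (I1 ++ I2)), (fun j => (if j \in I1 then B1 j else setT) `&`
  (if j \in I2 then B2 j else setT)); split.
- exact: undup_uniq.
- by rewrite mem_undup mem_cat negb_or i1.
- by move=> j; apply: measurableI; case: ifP.
- apply/seteqP; split => [w [w1 w2] j /=|w Hw].
    by rewrite mem_undup mem_cat => _; split; case: ifP => // jI; [exact: w1|exact: w2].
  split=> j /= jI; have := Hw j; rewrite /= mem_undup mem_cat jI ?orbT => /(_ isT).
    by case.
  by case.
Qed.

Lemma cylinder_off_measurable i A : cylinders_off i A -> measurable A.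
Proof.
move=> [I [B [_ _ mB ->]]]; rewrite bigcap_seq; apply: bigsetI_measurable => j _.
exact: meas_eps_preimage.
Qed.

(** Pi-lambda argument: the sets independent of a fixed event of the i-th innovation form a
    lambda-system, and cylinders belong to it by mutual independence applied to [i :: I]. *)
Lemma indep_off i (B : set R) (A : set Omega) : measurable B -> <<s cylinders_off i >> A ->
  P (eps i @^-1` B `&` A) = (P (eps i @^-1` B) * P A)%E.
Proof.
move=> mB; set E := eps i @^-1` B; have mE : measurable E by exact: meas_eps_preimage.
have Efin : P E \is a fin_num by exact: fin_num_measure.
suff : <<s cylinders_off i >> `<=` [set A | measurable A /\ P (E `&` A) = (P E * P A)%E].
  by move=> /[apply] -[].
apply: lambda_system_subset; [exact: cylinders_off_setI| | |by []].
- apply/dynkin_lambda_system; split => /=.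
  + by split => //; rewrite setIT probability_setT mule1.
  + move=> C [mC PC]; split; first exact: measurableC.
    rewrite -setDE measureD //= ?ltey_eq ?fin_num_measure // probability_setC //.
    rewrite PC muleBr ?mule1 //.
  + move=> F tF mF; have mFk k : measurable (F k) by case: (mF k).
    split; first exact: bigcup_measurable.
    rewrite setI_bigcupr !measure_bigcup //.
    * rewrite -(fineK Efin) -nneseriesZl //; apply: eq_eseriesr => k _; rewrite fineK //.
      by case: (mF k).
    * by move=> k _; exact: measurableI.
    * exact: trivIset_setIl.
- move=> C CA; split; first exact: cylinder_off_measurable CA.
  have [I [D [uI iI mD ->]]] := CA.
  pose D' j := if j == i then B else D j.
  have mD' j : measurable (D' j) by rewrite /D'; case: ifP.
  have DD' j : j \in I -> D' j = D j.
    by move=> jI; rewrite /D'; case: eqP => // ji; rewrite -ji jI in iI.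
  have := @indep (i :: I) D'; rewrite /= iI uI => /(_ isT mD').
  have -> : \bigcap_(j in [set` i :: I]) (eps j @^-1` D' j) =
      E `&` \bigcap_(j in [set` I]) (eps j @^-1` D j).
    apply/seteqP; split => [w Hw|w [Ew Hw] j /=].
      split; first by have := Hw i; rewrite /= mem_head /D' eqxx; apply.
      by move=> j /= jI; have := Hw j; rewrite /= in_cons jI orbT DD' //; apply.
    by rewrite in_cons => /predU1P[->|jI]; [rewrite /D' eqxx | rewrite DD' //; exact: Hw].
  move=> ->; rewrite big_cons {1}/D' eqxx; congr (_ * _)%E.
  rewrite indep //; rewrite !big_seq; apply: eq_bigr => j jI.
  by rewrite DD'.
Qed.

Lemma expectation_off (i : int) (g : R -> R) (W : Omega -> R) :
  measurable_fun setT g ->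
  measurable_fun [set: g_sigma_algebraType (cylinders_off i)] (W : _ -> R) ->
  P.-integrable setT (EFin \o (g \o eps i)) -> P.-integrable setT (EFin \o W) ->
  P.-integrable setT (fun w => (g (eps i w) * W w)%:E) ->
  (\int[P]_w (g (eps i w) * W w)%:E = (\int[P]_w (g (eps i w))%:E) * \int[P]_w (W w)%:E)%E.
Proof.
move=> mg mW ig iW igW.
have mX : measurable_fun setT (g \o eps i) by exact: measurableT_comp.
have mWO : measurable_fun [set: Omega] W by apply/measurable_EFinP; exact: measurable_int iW.
pose X : {mfun Omega >-> R} := HB.pack (g \o eps i) (isMeasurableFun.Build _ _ _ _ _ mX).
pose Z : {mfun Omega >-> R} := HB.pack W (isMeasurableFun.Build _ _ _ _ _ mWO).
apply: (@expectation_indep_prod _ _ _ P X Z) => // A B mA mB.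
rewrite -[X @^-1` A]/(eps i @^-1` (g @^-1` A)); apply: indep_off.
  by rewrite -[X in measurable X]setTI; exact: mg.
by have := mW measurableT B mB; rewrite setTI.
Qed.

Lemma eps_off_measurable i j : j != i ->
  measurable_fun [set: g_sigma_algebraType (cylinders_off i)] (eps j : _ -> R).
Proof.
move=> ji _ B mB; rewrite setTI; apply: sub_sigma_algebra.
exists [:: j], (fun=> B); split => //; first by rewrite inE eq_sym.
by rewrite bigcap_seq big_seq1.
Qed.

End IndependentSequence.

Section RealExpectation.
Context {R : realType} {d : measure_display} {Omega : measurableType d}.
Variable P : probability Omega R.
Implicit Types f g : Omega -> R.

Definition rintegrable f := P.-integrable setT (EFin \o f).
Definition rmean f : R := Rintegral P setT f.

Lemma rmeanE f : rintegrable f -> (\int[P]_w (f w)%:E)%E = (rmean f)%:E.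
Proof. by move=> fi; rewrite /rmean /Rintegral fineK //; exact: integrable_fin_num. Qed.

Lemma rintegrable_cst c : rintegrable (fun=> c).
Proof. exact: finite_measure_integrable_cst. Qed.

Lemma rintegrableD f g : rintegrable f -> rintegrable g -> rintegrable (fun w => f w + g w).
Proof.
move=> fi gi; rewrite /rintegrable (_ : EFin \o _ = (EFin \o f) \+ (EFin \o g))%E //.
exact: integrableD.
Qed.

Lemma rintegrableZ c f : rintegrable f -> rintegrable (fun w => c * f w).
Proof.
move=> fi; rewrite /rintegrable (_ : EFin \o _ = fun w => (c%:E * (EFin \o f) w)%E) //.
exact: integrableZl.
Qed.

Lemma rintegrable_sum (I : Type) (s : seq I) (F : I -> Omega -> R) :
  (forall i, rintegrable (F i)) -> rintegrable (fun w => \sum_(i <- s) F i w).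
Proof.
move=> Fi; rewrite /rintegrable.
rewrite (_ : EFin \o _ = fun w => (\sum_(i <- s) (EFin \o F i) w)%E).
  by apply: integrable_sum => // i _; exact: Fi.
by apply/funext => w /=; rewrite sumEFin.
Qed.

Lemma rintegrable_le f g : measurable_fun setT f -> (forall w, `|f w| <= g w) ->
  rintegrable g -> rintegrable f.
Proof.
move=> mf fg; apply: le_integrable => //; first exact/measurable_EFinP.
by move=> w _ /=; rewrite lee_fin (le_trans (fg w)) // ler_norm.
Qed.

Lemma rmeanD f g : rintegrable f -> rintegrable g ->
  rmean (fun w => f w + g w) = rmean f + rmean g.
Proof. by move=> fi gi; rewrite /rmean RintegralD. Qed.

Lemma rmeanZ c f : rintegrable f -> rmean (fun w => c * f w) = c * rmean f.
Proof. by move=> fi; rewrite /rmean RintegralZl. Qed.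

Lemma rmean_cst c : rmean (fun=> c) = c.
Proof. by rewrite /rmean /Rintegral integral_cst // [X in (_ * X)%E](probability_setT P) mule1. Qed.

Lemma rmean_sum (I : Type) (s : seq I) (F : I -> Omega -> R) :
  (forall i, rintegrable (F i)) ->
  rmean (fun w => \sum_(i <- s) F i w) = \sum_(i <- s) rmean (F i).
Proof.
move=> Fi; elim: s => [|i s IH].
  by rewrite big_nil -[RHS](rmean_cst 0); congr rmean; apply/funext => w; rewrite big_nil.
rewrite big_cons -IH -rmeanD //; last exact: rintegrable_sum.
by congr rmean; apply/funext => w; rewrite big_cons.
Qed.

Lemma rmean_le f g : rintegrable f -> rintegrable g -> (forall w, f w <= g w) ->
  rmean f <= rmean g.
Proof. by move=> fi gi fg; apply: le_Rintegral. Qed.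

End RealExpectation.

(** Makes every product of four innovations integrable from fourth moments alone, whatever
    coincidences occur among the indices. *)
Lemma normM4_le (R : realType) (x y z u : R) :
  `|x * y * z * u| <= x ^+ 4 + y ^+ 4 + z ^+ 4 + u ^+ 4.
Proof.
have AM (a b : R) : `|a * b| <= a ^+ 2 + b ^+ 2.
  rewrite ler_norml; have := sqr_ge0 (a + b); have := sqr_ge0 (a - b).
  have := sqr_ge0 a; have := sqr_ge0 b; move=> *; apply/andP; split; nra.
have e4 (a : R) : a ^+ 4 = (a ^+ 2) ^+ 2 by rewrite -exprM.
rewrite -mulrA (le_trans (AM _ _)) // !exprMn !e4 -!addrA addrA.
by rewrite lerD // (le_trans (ler_norm _)) // AM.
Qed.

Section SecondMoments.
Context {R : realType} {d : measure_display} {Omega : measurableType d}.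
Variable P : probability Omega R.
Variable eps : int -> Omega -> R.
Hypothesis meps : forall t, measurable_fun setT (eps t).
Hypothesis indep : mutually_independent P eps.
Hypothesis ident : identically_distributed P eps.
Hypothesis ieps : forall t, P.-integrable setT (fun w => (eps t w)%:E).
Hypothesis eps_mean0 : forall t, (\int[P]_w (eps t w)%:E = 0)%E.
Hypothesis eps4 : forall t, (\int[P]_w ((eps t w) ^+ 4)%:E < +oo)%E.

Local Notation rintegrable := (rintegrable P).
Local Notation rmean := (rmean P).

Lemma rintegrable_eps4 t : rintegrable (fun w => eps t w ^+ 4).
Proof.
apply/integrableP; split; first by apply/measurable_EFinP; exact: measurable_funX.
have p4 w : 0 <= eps t w ^+ 4 by rewrite (exprM _ 2 2) sqr_ge0.
under eq_integral do rewrite /= ger0_norm //.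
exact: eps4.
Qed.

Lemma rintegrable_M4 s t u v : rintegrable (fun w => eps s w * eps t w * eps u w * eps v w).
Proof.
apply: (rintegrable_le _ (fun w => normM4_le _ _ _ _)).
  by do 3! apply: measurable_funM => //.
do 3! (apply: rintegrableD; last exact: rintegrable_eps4).
exact: rintegrable_eps4.
Qed.

Lemma rintegrable_M3 s t u : rintegrable (fun w => eps s w * eps t w * eps u w).
Proof.
apply: (@rintegrable_le _ _ _ _ _
  (fun w => eps s w ^+ 4 + eps t w ^+ 4 + eps u w ^+ 4 + 1 ^+ 4)).
- by do 2! apply: measurable_funM => //.
- by move=> w; have := normM4_le (eps s w) (eps t w) (eps u w) 1; rewrite mulr1.
- apply: rintegrableD; last exact: rintegrable_cst.
  do 2! (apply: rintegrableD; last exact: rintegrable_eps4).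
  exact: rintegrable_eps4.
Qed.

Lemma rintegrable_sqr t : rintegrable (fun w => eps t w ^+ 2).
Proof.
apply: (@rintegrable_le _ _ _ _ _ (fun w => eps t w ^+ 4 + 1)).
- exact: measurable_funX.
- move=> w; rewrite ger0_norm ?sqr_ge0 //.
  have -> : eps t w ^+ 4 = (eps t w ^+ 2) ^+ 2 by rewrite -exprM.
  have := sqr_ge0 (eps t w ^+ 2 - 1); have := sqr_ge0 (eps t w); nra.
- by apply: rintegrableD; [exact: rintegrable_eps4 | exact: rintegrable_cst].
Qed.

Lemma rmean_ident (g : R -> R) s t : measurable_fun setT g -> (forall x, 0 <= g x) ->
  rmean (fun w => g (eps s w)) = rmean (fun w => g (eps t w)).
Proof.
move=> mg g0; rewrite /rmean /Rintegral; congr fine.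
have mgE : measurable_fun setT (EFin \o g) by exact/measurable_EFinP.
pose X s : {mfun Omega >-> R} := HB.pack (eps s) (isMeasurableFun.Build _ _ _ _ _ (meps s)).
have E s' : (\int[distribution P (X s')]_y (g y)%:E = \int[P]_w (g (eps s' w))%:E)%E.
  by rewrite ge0_integral_distribution // => y; rewrite lee_fin.
rewrite -!E; apply: eq_measure_integral => A mA _.
exact: ident.
Qed.

Definition eps_var : R := rmean (fun w => eps 0 w ^+ 2).
Definition eps_m4 : R := rmean (fun w => eps 0 w ^+ 4).

Lemma rmean_eps2 t : rmean (fun w => eps t w ^+ 2) = eps_var.
Proof. by apply: (@rmean_ident (fun x => x ^+ 2)) => // x; exact: sqr_ge0. Qed.

Lemma rmean_eps4 t : rmean (fun w => eps t w ^+ 4) = eps_m4.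
Proof.
apply: (@rmean_ident (fun x => x ^+ 4)) => // x; by rewrite (exprM _ 2 2) sqr_ge0.
Qed.

Lemma rmean_off (i : int) (g : R -> R) (W : Omega -> R) :
  measurable_fun setT g ->
  measurable_fun [set: g_sigma_algebraType (cylinders_off eps i)] (W : _ -> R) ->
  rintegrable (g \o eps i) -> rintegrable W -> rintegrable (fun w => g (eps i w) * W w) ->
  rmean (fun w => g (eps i w) * W w) = rmean (g \o eps i) * rmean W.
Proof.
move=> mg mW ig iW igW; apply: EFin_inj; rewrite EFinM -!rmeanE //.
exact: (expectation_off meps indep).
Qed.

Lemma rmean_unique_index i a b c : a != i -> b != i -> c != i ->
  rmean (fun w => eps i w * (eps a w * eps b w * eps c w)) = 0.
Proof.
move=> ai bi ci; rewrite (@rmean_off i id) //.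
- have -> : rmean (id \o eps i) = 0 by rewrite /rmean /Rintegral /= eps_mean0.
  by rewrite mul0r.
- by apply: measurable_funM; first apply: measurable_funM; exact: eps_off_measurable.
- exact: ieps.
- exact: rintegrable_M3.
- have -> : (fun w => id (eps i w) * (eps a w * eps b w * eps c w)) =
    (fun w => eps i w * eps a w * eps b w * eps c w) by apply/funext => w; rewrite /=; ring.
  exact: rintegrable_M4.
Qed.

Definition eps_dev (p q t : nat) (w : Omega) : R :=
  eps (t%:Z - p%:Z) w * eps (t%:Z - q%:Z) w - (p == q)%:R * eps_var.

Lemma rintegrable_M2 s t : rintegrable (fun w => eps s w * eps t w).
Proof.
apply: (@rintegrable_le _ _ _ _ _ (fun w => eps s w ^+ 2 + eps t w ^+ 2)).
- exact: measurable_funM.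
- move=> w; rewrite ler_norml; move: (eps s w) (eps t w) => a b.
  have := sqr_ge0 (a + b); have := sqr_ge0 (a - b).
  have := sqr_ge0 a; have := sqr_ge0 b; move=> *; apply/andP; split; nra.
- by apply: rintegrableD; exact: rintegrable_sqr.
Qed.

Lemma eps_devM_expand p q s t : (fun w => eps_dev p q s w * eps_dev p q t w) =
  (fun w => eps (s%:Z - p%:Z) w * eps (s%:Z - q%:Z) w * eps (t%:Z - p%:Z) w * eps (t%:Z - q%:Z) w +
    (- ((p == q)%:R * eps_var) * (eps (s%:Z - p%:Z) w * eps (s%:Z - q%:Z) w) +
    (- ((p == q)%:R * eps_var) * (eps (t%:Z - p%:Z) w * eps (t%:Z - q%:Z) w) +
     ((p == q)%:R * eps_var) ^+ 2))).
Proof. by apply/funext => w; rewrite /eps_dev; ring. Qed.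

Lemma rintegrable_eps_devM p q s t : rintegrable (fun w => eps_dev p q s w * eps_dev p q t w).
Proof.
rewrite eps_devM_expand; apply: rintegrableD; first exact: rintegrable_M4.
apply: rintegrableD; first by apply: rintegrableZ; exact: rintegrable_M2.
apply: rintegrableD; last exact: rintegrable_cst.
by apply: rintegrableZ; exact: rintegrable_M2.
Qed.

Lemma eps_dev_diag p t : eps_dev p p t = fun w => eps (t%:Z - p%:Z) w ^+ 2 - eps_var.
Proof. by apply/funext => w; rewrite /eps_dev eqxx mul1r expr2. Qed.

Lemma rintegrable_sqrB t : rintegrable (fun w => eps t w ^+ 2 - eps_var).
Proof. by apply: rintegrableD; [exact: rintegrable_sqr | exact: rintegrable_cst]. Qed.

Lemma rmean_sqrB t : rmean (fun w => eps t w ^+ 2 - eps_var) = 0.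
Proof.
by rewrite (rmeanD (rintegrable_sqr t) (rintegrable_cst P (- eps_var))) rmean_eps2 rmean_cst subrr.
Qed.

(** If p = q, these are centred squares at distinct times. Otherwise one of the four indices s-p,
    s-q, t-p, t-q occurs only once: s-p, unless s-p = t-q, in which case s-q does. The mean-zero
    factor at that index is independent of the rest. *)
Lemma eps_dev_orth p q s t : s != t -> rmean (fun w => eps_dev p q s w * eps_dev p q t w) = 0.
Proof.
move=> st; have [pq|pq] := eqVneq p q.
  subst q; rewrite !eps_dev_diag (@rmean_off (s%:Z - p%:Z) (fun x => x ^+ 2 - eps_var)
    (fun w => eps (t%:Z - p%:Z) w ^+ 2 - eps_var)).
  - have -> : rmean ((fun x => x ^+ 2 - eps_var) \o eps (s%:Z - p%:Z)) = 0.
      exact: rmean_sqrB.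
    by rewrite mul0r.
  - by apply: measurable_funB => //; exact: measurable_funX.
  - apply: measurable_funB => //; apply: measurable_funX; apply: eps_off_measurable.
    by rewrite (inj_eq (addIr _)) eqz_nat eq_sym.
  - exact: rintegrable_sqrB.
  - exact: rintegrable_sqrB.
  - by have := rintegrable_eps_devM p p s t; rewrite !eps_dev_diag.
have E4 : rmean (fun w => eps_dev p q s w * eps_dev p q t w) =
   rmean (fun w => eps (s%:Z - p%:Z) w * eps (s%:Z - q%:Z) w * eps (t%:Z - p%:Z) w *
     eps (t%:Z - q%:Z) w).
  by congr rmean; apply/funext => w; rewrite /eps_dev (negbTE pq) mul0r !subr0; ring.
rewrite E4; have [E|N] := eqVneq (s%:Z - p%:Z) (t%:Z - q%:Z).
  rewrite -[RHS](@rmean_unique_index (s%:Z - q%:Z) (s%:Z - p%:Z) (t%:Z - p%:Z) (t%:Z - q%:Z)).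
  - by congr rmean; apply/funext => w; ring.
  - lia.
  - lia.
  - lia.
rewrite -[RHS](@rmean_unique_index (s%:Z - p%:Z) (s%:Z - q%:Z) (t%:Z - p%:Z) (t%:Z - q%:Z)).
- by congr rmean; apply/funext => w; ring.
- lia.
- lia.
- lia.
Qed.

Lemma eps_dev_sqr p q t : rmean (fun w => eps_dev p q t w ^+ 2) <= 4 * eps_m4 + 2 * eps_var ^+ 2.
Proof.
set a := eps (t%:Z - p%:Z); set b := eps (t%:Z - q%:Z).
have i4 : rintegrable (fun w => 2 * (a w ^+ 4 + b w ^+ 4)).
  by apply: rintegrableZ; apply: rintegrableD; exact: rintegrable_eps4.
have ic := rintegrable_cst P (2 * eps_var ^+ 2).
have -> : 4 * eps_m4 + 2 * eps_var ^+ 2 =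
    rmean (fun w => 2 * (a w ^+ 4 + b w ^+ 4) + 2 * eps_var ^+ 2).
  rewrite rmeanD // rmean_cst rmeanZ; last by apply: rintegrableD; exact: rintegrable_eps4.
  by rewrite rmeanD ?rmean_eps4; [congr (_ + _); ring | exact: rintegrable_eps4 ..].
apply: rmean_le; first 1 last.
- exact: rintegrableD.
- move=> w; rewrite /eps_dev -/a -/b; move: (a w) (b w) eps_var => x y v.
  have e4 (z : R) : z ^+ 4 = (z ^+ 2) ^+ 2 by rewrite -exprM.
  have H1 : (x * y) ^+ 2 <= x ^+ 4 + y ^+ 4.
    rewrite exprMn !e4; have := sqr_ge0 (x ^+ 2 - y ^+ 2); have := sqr_ge0 (x ^+ 2 + y ^+ 2); nra.
  have H2 : (x * y - (p == q)%:R * v) ^+ 2 <= 2 * (x * y) ^+ 2 + 2 * ((p == q)%:R * v) ^+ 2.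
    have := sqr_ge0 (x * y + (p == q)%:R * v); nra.
  have H3 : ((p == q)%:R * v) ^+ 2 <= v ^+ 2.
    by case: eqP => _; rewrite ?mul1r ?mul0r ?expr0n ?sqr_ge0.
  lra.
- have := rintegrable_eps_devM p q t t.
  by rewrite (_ : (fun w => _ * _) = (fun w => eps_dev p q t w ^+ 2)) //; apply/funext => w; rewrite expr2.
Qed.

End SecondMoments.

Section MeanSquare.
Context {R : realType} {d : measure_display} {Omega : measurableType d}.
Variable P : probability Omega R.
Variable eps : int -> Omega -> R.
Hypothesis meps : forall t, measurable_fun setT (eps t).
Hypothesis indep : mutually_independent P eps.
Hypothesis ident : identically_distributed P eps.
Hypothesis ieps : forall t, P.-integrable setT (fun w => (eps t w)%:E).
Hypothesis eps_mean0 : forall t, (\int[P]_w (eps t w)%:E = 0)%E.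
Hypothesis eps4 : forall t, (\int[P]_w ((eps t w) ^+ 4)%:E < +oo)%E.
Variables (psi : nat -> R) (S : R).
Hypothesis psiS : forall N, \sum_(k < N) `|psi k| <= S.

Local Notation rintegrable := (rintegrable P).
Local Notation rmean := (rmean P).
Local Notation eps_dev := (eps_dev P eps).
Local Notation eps_var := (eps_var P eps).
Local Notation eps_m4 := (eps_m4 P eps).

(** Crude bound on the second moment of [eps_dev], uniform in the lags and the time. *)
Definition kap : R := 4 * eps_m4 + 2 * eps_var ^+ 2.

Definition eps_avg (p q n : nat) (w : Omega) : R :=
  n%:R^-1 * \sum_(1 <= t < n.+1) eps_dev p q t w.

Lemma eps_avg_sqrE p q n : (fun w => eps_avg p q n w ^+ 2) =
  (fun w => n%:R^-1 ^+ 2 *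
     \sum_(1 <= s < n.+1) \sum_(1 <= t < n.+1) eps_dev p q s w * eps_dev p q t w).
Proof.
apply/funext => w; rewrite /eps_avg exprMn [X in _ * X]expr2 mulr_suml; congr (_ * _).
by apply: eq_bigr => s _; rewrite mulr_sumr.
Qed.

Lemma rintegrable_eps_avg_sqr p q n : rintegrable (fun w => eps_avg p q n w ^+ 2).
Proof.
rewrite eps_avg_sqrE; apply: rintegrableZ; apply: rintegrable_sum => s.
by apply: rintegrable_sum => t; exact: rintegrable_eps_devM.
Qed.

Lemma rmean_eps_avg_sqr p q n : (0 < n)%N -> rmean (fun w => eps_avg p q n w ^+ 2) <= kap / n%:R.
Proof.
move=> n0; have i2 s t : rintegrable (fun w => eps_dev p q s w * eps_dev p q t w).
  exact: rintegrable_eps_devM.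
have i1 s : rintegrable (fun w => \sum_(1 <= t < n.+1) eps_dev p q s w * eps_dev p q t w).
  exact: rintegrable_sum.
rewrite eps_avg_sqrE rmeanZ ?rmean_sum //; last exact: rintegrable_sum.
have E s : (1 <= s < n.+1)%N ->
    rmean (fun w => \sum_(1 <= t < n.+1) eps_dev p q s w * eps_dev p q t w) <= kap.
  move=> sn; rewrite rmean_sum // (bigD1_seq s) ?iota_uniq ?mem_index_iota //=.
  rewrite big1 ?addr0 => [|t ts]; last by apply: eps_dev_orth => //; rewrite eq_sym.
  have := @eps_dev_sqr _ _ _ P eps meps ident eps4 p q s.
  by rewrite (_ : (fun w => _ ^+ 2) = (fun w => eps_dev p q s w * eps_dev p q s w)) //;
    apply/funext => w; rewrite expr2.
apply: (@le_trans _ _ (n%:R^-1 ^+ 2 * \sum_(1 <= s < n.+1) kap)).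
  rewrite ler_wpM2l ?sqr_ge0 // big_nat [leRHS]big_nat; apply: ler_sum => s; exact: E.
rewrite sumr_const_nat subn1 /= -[kap *+ _]mulr_natl expr2 -mulrA [_^-1 * (n%:R * _)]mulrA.
by rewrite mulVf ?mul1r ?pnatr_eq0 -?lt0n // mulrC.
Qed.

(* Y_{t-j} truncated to the innovations eps_t, ..., eps_{t-L+1}. *)
Definition trunc_proc (j L t : nat) (w : Omega) : R :=
  \sum_(i < L) shift_coef psi j i * eps (t%:Z - i%:Z) w.

Definition acov_dev (L j k n : nat) (w : Omega) : R :=
  n%:R^-1 * (\sum_(1 <= t < n.+1) trunc_proc j L t w * trunc_proc k L t w) -
  acov_trunc psi eps_var L j k.

(** Expanding both factors, the centring is needed only for p = q, and there it sums to
    [acov_trunc]. What remains is linear in the [eps_avg]. *)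
Lemma acov_devE L j k n w : (0 < n)%N -> acov_dev L j k n w =
  \sum_(p : 'I_L * 'I_L) (shift_coef psi j p.1 * shift_coef psi k p.2) * eps_avg p.1 p.2 n w.
Proof.
move=> n0.
have E t : trunc_proc j L t w * trunc_proc k L t w =
  \sum_(p : 'I_L * 'I_L) (shift_coef psi j p.1 * shift_coef psi k p.2) * eps_dev p.1 p.2 t w
   + acov_trunc psi eps_var L j k.
  rewrite -(pair_bigA _ (fun a b : 'I_L =>
    (shift_coef psi j a * shift_coef psi k b) * eps_dev a b t w)) /=.
  rewrite /acov_trunc [X in _ = _ + X]mulr_sumr -big_split /= /trunc_proc mulr_suml.
  apply: eq_bigr => a _.
  transitivity (\sum_(b < L) (shift_coef psi j a * shift_coef psi k b * eps_dev a b t w +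
      shift_coef psi j a * shift_coef psi k b * (((a : nat) == b)%:R * eps_var))).
    by rewrite mulr_sumr; apply: eq_bigr => b _; rewrite /eps_dev; ring.
  rewrite big_split /=; congr (_ + _); rewrite (bigD1 a) //= big1 ?addr0.
    by rewrite eqxx mul1r mulrC.
  by move=> b; rewrite -val_eqE /= eq_sym => /negbTE ->; rewrite mul0r mulr0.
rewrite /acov_dev (eq_bigr _ (fun t _ => E t)) big_split /= mulrDr exchange_big /=.
rewrite sumr_const_nat subn1 /= -[acov_trunc _ _ _ _ _ *+ n]mulr_natl mulrA.
rewrite mulVf ?pnatr_eq0 -?lt0n // mul1r addrK.
by rewrite mulr_sumr; apply: eq_bigr => p _; rewrite -mulr_sumr /eps_avg mulrCA.
Qed.

Lemma kap_ge0 : 0 <= kap.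
Proof.
apply: addr_ge0; apply: mulr_ge0 => //; last exact: sqr_ge0.
apply: Rintegral_ge0 => w _.
by rewrite (exprM _ 2 2) sqr_ge0.
Qed.

Lemma measurable_acov_dev L j k n : measurable_fun setT (acov_dev L j k n).
Proof.
apply: measurable_funB => //; apply: measurable_funM => //; apply: measurable_sum => t.
by apply: measurable_funM; apply: measurable_sum => i; exact: measurable_funM.
Qed.

(** The coefficients have l1 norm at most S^2, which enters twice through the weighted
    Cauchy-Schwarz inequality. The bound is free of [L], [j] and [k]. *)
Lemma rmean_acov_dev_sqr L j k n : (0 < n)%N ->
  rintegrable (fun w => acov_dev L j k n w ^+ 2) /\
  rmean (fun w => acov_dev L j k n w ^+ 2) <= S ^+ 4 * (kap / n%:R).
Proof.
move=> n0.
pose c (p : 'I_L * 'I_L) := shift_coef psi j p.1 * shift_coef psi k p.2.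
have cS : \sum_p `|c p| <= S ^+ 2.
  rewrite -(pair_bigA _ (fun a b : 'I_L =>
    `|shift_coef psi j a * shift_coef psi k b|)) /=.
  apply: (@le_trans _ _ (\sum_(a < L) `|shift_coef psi j a| * S)).
    apply: ler_sum => a _; under eq_bigr do rewrite normrM; rewrite -mulr_sumr.
    by rewrite ler_wpM2l // (sum_shift_coef psiS).
  rewrite -mulr_suml expr2 ler_wpM2r ?(sum_shift_coef psiS) //.
  by apply: le_trans (psiS 0); rewrite big_ord0.
have S20 : 0 <= S ^+ 2 by exact: sqr_ge0.
pose g w := S ^+ 2 * \sum_p `|c p| * eps_avg p.1 p.2 n w ^+ 2.
have ip (p : 'I_L * 'I_L) : rintegrable (fun w => `|c p| * eps_avg p.1 p.2 n w ^+ 2).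
  by apply: rintegrableZ; exact: rintegrable_eps_avg_sqr.
have gi : rintegrable g by apply: rintegrableZ; exact: rintegrable_sum.
have le_g w : acov_dev L j k n w ^+ 2 <= g w.
  rewrite acov_devE // (le_trans (weighted_cauchy_schwarz _ _ _)) //.
  by rewrite ler_wpM2r ?sumr_ge0 // => p _; rewrite mulr_ge0 ?sqr_ge0.
have mD := measurable_acov_dev L j k n.
have Di : rintegrable (fun w => acov_dev L j k n w ^+ 2).
  apply: (@rintegrable_le _ _ _ _ _ g) => //; first exact: measurable_funX.
  by move=> w; rewrite ger0_norm ?sqr_ge0.
split=> //; apply: (le_trans (rmean_le Di gi le_g)).
rewrite rmeanZ; last exact: rintegrable_sum.
rewrite rmean_sum // (exprD _ 2 2) -mulrA ler_wpM2l //.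
apply: (@le_trans _ _ (\sum_p `|c p| * (kap / n%:R))).
  apply: ler_sum => p _; rewrite rmeanZ; last exact: rintegrable_eps_avg_sqr.
  by rewrite ler_wpM2l // rmean_eps_avg_sqr.
by rewrite -mulr_suml ler_wpM2r // divr_ge0 // kap_ge0.
Qed.

End MeanSquare.

(** * The moving average representation *)

Section PathInverse.
Context {R : realType}.
Variables (phi psi : nat -> R).
Local Notation f := (arcoef phi).

Lemma sum_conv (a b y : nat -> R) L : \sum_(l < L) conv a b l * y l =
  \sum_(i < L) \sum_(k < L - i) a i * b k * y (i + k)%N.
Proof.
transitivity (\sum_(l < L) \sum_(i < L | (i <= l)%N) a i * b (l - i)%N * y l).
  apply: eq_bigr => l _; rewrite mulr_suml.
  rewrite (big_ord_widen L (fun i : nat => a i * b (l - i)%N * y l)) //.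
rewrite (exchange_big_dep predT) //=; apply: eq_bigr => i _.
rewrite -(big_geq_mkord i L xpredT (fun l => a i * b (l - i)%N * y l)).
rewrite -{1}[i : nat]add0n big_addn big_mkord; apply: eq_bigr => k _.
by rewrite addnK addnC.
Qed.

Lemma double_sum_conv (a b y : nat -> R) N M :
  \sum_(i < N) \sum_(k < M) a i * b k * y (i + k)%N =
  \sum_(l < N + M) conv (fun i => if (i < N)%N then a i else 0)
                        (fun k => if (k < M)%N then b k else 0) l * y l.
Proof.
rewrite sum_conv.
set a' := fun i => if (i < N)%N then a i else 0; set b' := fun k => if (k < M)%N then b k else 0.
rewrite (sum_widen0 (leq_addr M N)
  (G := fun i => \sum_(k < N + M - i) a' i * b' k * y (i + k)%N)).
  apply: eq_bigr => i _.
  have MNi : (M <= N + M - i)%N by have := ltn_ord i; lia.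
  rewrite (sum_widen0 MNi (G := fun k => a' i * b' k * y (i + k)%N)).
    by apply: eq_bigr => k _; rewrite /a' /b' !ltn_ord.
  by move=> k Mk; rewrite /b' ltnNge Mk mulr0 mul0r.
by move=> i Ni; rewrite big1 // => k _; rewrite /a' ltnNge Ni !mul0r.
Qed.

(** Deterministic inversion along one path, [y j] standing for Y_{s-j}. For fixed [N] each [e i] is
    a limit of finite autoregressive sums; in the double sum the coefficient of [y l] is that of psi
    * f for l < N, leaving [y 0], and the others are dominated by a tail of the summable c_l
    |y_l|. *)
Lemma ar_path_inverse (y e : nat -> R) : conv f psi =1 cdelta ->
  (forall j, (fun M => \sum_(1 <= k < M) phi k * y (j + k)%N) @ \oo --> y j - e j) ->
  l1 (fun l => conv (fun i => `|psi i|) (fun i => `|f i|) l * `|y l|) ->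
  (fun N => \sum_(i < N) psi i * e i) @ \oo --> y 0%N.
Proof.
move=> fpsi ye ly; set c := conv _ _ in ly.
have c0 l : 0 <= c l by apply: sumr_ge0 => i _; rewrite mulr_ge0.
have fe j : (fun M => \sum_(k < M.+1) f k * y (j + k)%N) @ \oo --> e j.
  have -> : e j = y j - (y j - e j) by rewrite opprB addrCA subrr addr0.
  have -> : (fun M => \sum_(k < M.+1) f k * y (j + k)%N) =
      (fun M => y j - \sum_(1 <= k < M.+1) phi k * y (j + k)%N).
    apply/funext => M; rewrite -(big_mkord xpredT (fun k => f k * y (j + k)%N)) big_ltn //.
    rewrite /= mul1r addn0 -sumrN; congr (_ + _).
    by rewrite big_nat [RHS]big_nat; apply: eq_bigr => -[//|k] _; rewrite mulNr.
  apply: cvgB; first exact: cvg_cst.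
  by rewrite (cvg_shiftS (fun M => \sum_(1 <= k < M) phi k * y (j + k)%N)); exact: ye.
apply/cvgrPdist_le => /= eta eta0.
have [M0 M0P] := l1_tail ly eta0.
exists M0.+1 => // N /= M0N.
have cv : (fun M => `|y 0%N - \sum_(i < N) psi i * \sum_(k < M.+1) f k * y (i + k)%N|) @ \oo
    --> `|y 0%N - \sum_(i < N) psi i * e i|.
  apply: cvg_norm; apply: cvgB; first exact: cvg_cst.
  by apply: cvg_sum => i; apply: cvgM; [exact: cvg_cst | exact: fe].
apply: (cvgr_to_le cv); near=> M.
have NM : (N <= M)%N by near: M; exact: nbhs_infty_ge.
under eq_bigr do rewrite mulr_sumr.
have -> : \sum_(i < N) \sum_(k < M.+1) psi i * (f k * y (i + k)%N) =
    \sum_(i < N) \sum_(k < M.+1) psi i * f k * y (i + k)%N.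
  by apply: eq_bigr => i _; apply: eq_bigr => k _; rewrite mulrA.
rewrite double_sum_conv; set a' := (fun i => if _ then psi i else 0).
set b' := (fun i => if _ then f i else 0).
have N0 : (0 < N)%N by apply: leq_ltn_trans M0N.
rewrite -(big_mkord xpredT (fun l => conv a' b' l * y l)).
rewrite (big_cat_nat (n := N)) ?leq_addr //= [X in _ - (X + _)](_ : _ = y 0%N); last first.
  rewrite big_ltn // big_nat big1 ?addr0 => [|l /andP[l0 lN]].
    rewrite (@eq_conv _ _ psi _ f N) //; last first.
    - move=> k kN; rewrite /b' ifT //; lia.
    - by move=> k kN; rewrite /a' kN.
    by rewrite convC fpsi /cdelta mul1r.
  rewrite (@eq_conv _ _ psi _ f N) //; last first.
  - move=> k kN; rewrite /b' ifT //; lia.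
  - by move=> k kN; rewrite /a' kN.
  by rewrite convC fpsi /cdelta gtn_eqF // mul0r.
rewrite opprD addrA subrr add0r normrN (le_trans (ler_norm_sum _ _ _)) //.
apply: (@le_trans _ _ (\sum_(N <= l < N + M.+1) `|c l * `|y l| |)).
  apply: ler_sum => l _; rewrite normrM [leRHS]normrM normr_id ler_wpM2r //.
  rewrite [leRHS]ger0_norm // (le_trans (ler_norm_sum _ _ _)) //.
  apply: ler_sum => i _; rewrite normrM ler_pM // /a' /b'; case: ifP => //; by rewrite normr0.
apply: le_trans (M0P (N + M.+1)%N).
rewrite [leRHS](big_cat_nat (n := N)) ?leq_addr //=; last exact: ltnW.
by rewrite lerDr sumr_ge0.
Unshelve. all: by end_near. Qed.

End PathInverse.

(** * Almost sure summability and Fatou's lemma *)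

Section AlmostSure.
Context {R : realType} {d : measure_display} {Omega : measurableType d}.
Variable P : probability Omega R.

(** By Tonelli the series has expectation at most [B * M], hence is finite almost everywhere. *)
Lemma ae_summable (X : nat -> Omega -> R) (c : nat -> R) (M : R) :
  (forall l, measurable_fun setT (X l)) -> (forall l, 0 <= c l) -> l1 c ->
  (forall l, (\int[P]_w (`|X l w|)%:E <= M%:E)%E) ->
  {ae P, forall w, l1 (fun l => c l * `|X l w|)}.
Proof.
move=> mX c0 [B cB] XM.
have mcX l : measurable_fun setT (fun w => (c l * `|X l w|)%:E).
  by apply/measurable_EFinP; apply: measurable_funM => //; exact: measurableT_comp.
have cX0 l w : (0 <= (c l * `|X l w|)%:E)%E by rewrite lee_fin mulr_ge0.
have fi : P.-integrable setT (fun w => \sum_(l <oo) (c l * `|X l w|)%:E)%E.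
  apply/integrableP; split.
    by apply: ge0_emeasurable_sum => // l w _ _; exact: cX0.
  under eq_integral do rewrite gee0_abs ?nneseries_ge0 //.
  rewrite integral_nneseries //.
  apply: (@le_lt_trans _ _ (B * M)%:E); last exact: ltry.
  apply: lime_le.
    by apply: is_cvg_nneseries => l _ _; exact: integral_ge0.
  near=> N.
  have M0 : 0 <= M by rewrite -lee_fin (le_trans _ (XM 0%N)) // integral_ge0.
  apply: (@le_trans _ _ (\sum_(0 <= l < N) (c l * M)%:E)%E).
    apply: lee_sum => l _.
    under eq_integral do rewrite EFinM.
    rewrite ge0_integralZl_EFin //.
      by rewrite EFinM lee_wpmul2l // lee_fin.
    by apply/measurable_EFinP; exact: measurableT_comp.
  rewrite sumEFin lee_fin -mulr_suml ler_wpM2r // big_mkord (le_trans _ (cB N)) //.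
  by apply: ler_sum => l _; exact: ler_norm.
have := integrable_ae measurableT fi; apply: filterS => w /(_ I) wfin.
exists (fine (\sum_(l <oo) (c l * `|X l w|)%:E)%E) => N.
rewrite -lee_fin fineK // -sumEFin (eq_bigr (fun l : 'I_N => (c l * `|X l w|)%:E)).
  by rewrite -(big_mkord xpredT (fun l => (c l * `|X l w|)%:E)); exact: nneseries_lim_ge.
by move=> l _; rewrite ger0_norm // mulr_ge0.
Unshelve. all: by end_near. Qed.

Lemma fatou_sqr (X : nat -> Omega -> R) (Z : Omega -> R) (C : R) :
  (forall L, rintegrable P (fun w => X L w ^+ 2)) -> (forall L, measurable_fun setT (X L)) ->
  measurable_fun setT Z ->
  (forall L, rmean P (fun w => X L w ^+ 2) <= C) ->
  {ae P, forall w, (fun L => X L w) @ \oo --> Z w} ->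
  (\int[P]_w (Z w ^+ 2)%:E <= C%:E)%E.
Proof.
move=> Xi mX mZ XC XZ.
have mX2 L : measurable_fun setT (fun w => (X L w ^+ 2)%:E).
  by apply/measurable_EFinP; exact: measurable_funX.
have X20 L w : setT w -> (0 <= (X L w ^+ 2)%:E)%E by rewrite lee_fin sqr_ge0.
have := fatou P measurableT mX2 X20.
rewrite (_ : (\int[P]_w limn_einf _)%E = (\int[P]_w (Z w ^+ 2)%:E)%E).
  move=> /le_trans; apply; rewrite limn_einf_lim; apply: lime_le; first exact: is_cvg_einfs.
  near=> L; apply: (@le_trans _ _ (\int[P]_w (X L w ^+ 2)%:E)%E).
    by apply: ereal_inf_lbound; exists L => //=.
  by rewrite rmeanE // lee_fin.
apply: ae_eq_integral => //.
- under eq_fun do rewrite limn_einf_lim.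
  apply: (emeasurable_fun_cvg (fun m w => einfs (fun L => (X L w ^+ 2)%:E) m)).
    by move=> m; exact: (measurable_fun_einfs mX2 m).
  by move=> w _; exact: is_cvg_einfs.
- by apply/measurable_EFinP; exact: measurable_funX.
apply: filterS XZ => w Xw _.
suff /cvg_limn_einf_sup[-> _] : (fun L => (X L w ^+ 2)%:E) @ \oo --> (Z w ^+ 2)%:E by [].
by apply: cvg_EFin; [exact: nearW | rewrite expr2; under eq_fun do rewrite expr2; exact: cvgM].
Unshelve. all: by end_near. Qed.

End AlmostSure.

(** * The penalized criterion and its normal equations *)

Section PenalizedCriterion.
Context {R : realType}.
Variables (lam : nat -> R) (K : nat).
Implicit Types (b : nat -> R) (y : int -> R).

Lemma rser_finite (F : nat -> R) J : (0 < J)%N -> (forall k, (J <= k)%N -> F k = 0) ->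
  rser F = \sum_(1 <= k < J) F k.
Proof.
move=> J0 F0; apply/cvg_lim => //; apply: cvg_near_cst; near=> N.
have JN : (J <= N)%N by near: N; exact: nbhs_infty_ge.
rewrite (big_cat_nat J0 JN) /= [X in _ + X]big_nat [X in _ + X]big1 ?addr0 // => k /andP[Jk _].
exact: F0.
Unshelve. all: by end_near. Qed.

Lemma enorm2_finite b J : (0 < J)%N -> (forall k, (J <= k)%N -> b k = 0) ->
  enorm2 lam b = (\sum_(1 <= k < J) (lam k * b k) ^+ 2)%:E.
Proof.
move=> J0 b0; rewrite /enorm2; apply/cvg_lim => //; apply: cvg_near_cst; near=> N.
have JN : (J <= N)%N by near: N; exact: nbhs_infty_ge.
rewrite sumEFin (big_cat_nat J0 JN) /= [X in (_ + X)%:E]big_nat [X in (_ + X)%:E]big1 ?addr0.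
  by under eq_bigr do rewrite -exprMn.
by move=> k /andP[Jk _]; rewrite b0 // expr0n mulr0.
Unshelve. all: by end_near. Qed.

Lemma in_EK_P b : in_EK lam K b <-> b 0%N = 0 /\ (forall k, (K < k)%N -> b k = 0).
Proof.
split=> [[_ //]|[b0 bK]]; split => //.
by rewrite /in_Espace (enorm2_finite (ltn0Sn K) bK) ltry.
Qed.

Definition path_acov (n : nat) y (j k : nat) : R :=
  n%:R^-1 * \sum_(1 <= t < n.+1) y (t%:Z - j%:Z) * y (t%:Z - k%:Z).

Lemma path_acovC n y j k : path_acov n y j k = path_acov n y k j.
Proof. by congr (_ * _); apply: eq_bigr => t _; rewrite mulrC. Qed.

Lemma qform_path_acov J n y (a c : nat -> R) : qform J (path_acov n y) a c =
  n%:R^-1 * \sum_(1 <= t < n.+1) (\sum_(j < J) a j * y (t%:Z - j%:Z)) *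
                                 (\sum_(k < J) c k * y (t%:Z - k%:Z)).
Proof.
rewrite /qform.
transitivity (\sum_(1 <= t < n.+1) \sum_(j < J) \sum_(k < J)
   n%:R^-1 * ((a j * y (t%:Z - j%:Z)) * (c k * y (t%:Z - k%:Z)))).
  rewrite [RHS]exchange_big; apply: eq_bigr => j _ /=; rewrite [RHS]exchange_big.
  apply: eq_bigr => k _ /=; rewrite /path_acov mulrCA mulr_sumr mulr_sumr.
  by apply: eq_bigr => t _; ring.
rewrite mulr_sumr; apply: eq_bigr => t _; rewrite mulr_suml mulr_sumr; apply: eq_bigr => j _.
by rewrite mulr_sumr mulr_sumr.
Qed.

Lemma Qcrit_qform y n tau b : in_EK lam K b ->
  Qcrit lam y n tau b = qform K.+1 (path_acov n y) (arcoef b) (arcoef b) +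
    tau * \sum_(1 <= k < K.+1) (lam k * b k) ^+ 2.
Proof.
move=> /in_EK_P[b0 bK]; rewrite /Qcrit (enorm2_finite (ltn0Sn K) bK); congr (_ + _).
rewrite qform_path_acov; congr (_ * _); apply: eq_bigr => t _; rewrite -expr2; congr (_ ^+ 2).
rewrite /Xt (rser_finite (ltn0Sn K)) => [|k Kk]; last by rewrite bK // mul0r.
rewrite -(big_mkord xpredT (fun j => arcoef b j * y (t%:Z - j%:Z))) big_ltn //= mul1r subr0.
rewrite -sumrN; congr (_ + _); apply: eq_big_nat => -[//|k] _ /=.
by rewrite mulNr.
Qed.

Lemma pen_est_le y n tau b phi : is_pen_est lam y K n tau b ->
  qform K.+1 (path_acov n y) (arcoef b) (arcoef b) +
    tau * \sum_(1 <= k < K.+1) (lam k * b k) ^+ 2 <=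
  qform K.+1 (path_acov n y) (arcoef phi) (arcoef phi) +
    tau * \sum_(1 <= k < K.+1) (lam k * phi k) ^+ 2.
Proof.
(* Membership in E_K forces the value 0 at index 0, whatever [phi 0] is; [arcoef] overwrites that
   index anyway. *)
move=> [bK bmin]; pose phi' k := if (0 < k < K.+1)%N then phi k else 0.
have pK : in_EK lam K phi'.
  by apply/in_EK_P; split => // k Kk; rewrite /phi' ifF //; lia.
have := bmin _ pK; rewrite !Qcrit_qform //.
have -> : \sum_(1 <= k < K.+1) (lam k * phi' k) ^+ 2 = \sum_(1 <= k < K.+1) (lam k * phi k) ^+ 2.
  by rewrite big_nat [RHS]big_nat; apply: eq_bigr => k kK; rewrite /phi' kK.
suff -> : qform K.+1 (path_acov n y) (arcoef phi') (arcoef phi') =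
  qform K.+1 (path_acov n y) (arcoef phi) (arcoef phi) by [].
have E (j : 'I_K.+1) : arcoef phi' j = arcoef phi j.
  by case: j => -[|j] jK //=; rewrite /phi' /= jK.
by apply: eq_bigr => j _; apply: eq_bigr => k _; rewrite !E.
Qed.

Lemma quadratic_min (G H : R) : (forall s, 0 <= s ^+ 2 * H - 2 * s * G) -> G = 0.
Proof.
move=> HG; have H1 : 0 < `|H| + 1 by rewrite ltr_wpDl.
(* A step small enough for the linear term to beat the quadratic one, whatever the sign and size of
   [H]. *)
have := HG (G / (`|H| + 1)).
have -> : (G / (`|H| + 1)) ^+ 2 * H - 2 * (G / (`|H| + 1)) * G =
   G ^+ 2 * ((H - 2 * (`|H| + 1)) / (`|H| + 1) ^+ 2) by field; rewrite gt_eqF.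
have neg : (H - 2 * (`|H| + 1)) / (`|H| + 1) ^+ 2 < 0.
  rewrite pmulr_llt0 ?invr_gt0 ?exprn_gt0 //; have := ler_norm H; have := normr_ge0 H; lra.
rewrite nmulr_lge0 // => G2; apply/eqP; rewrite -sqrf_eq0 eq_le G2 sqr_ge0 //.
Qed.

(** First-order condition from perturbing one coordinate; it serves to express the estimator as an
    explicit function of the sample. *)
Lemma normal_equation y n tau b k : is_pen_est lam y K n tau b -> (0 < k <= K)%N ->
  \sum_(j < K.+1) arcoef b j * path_acov n y j k = tau * (lam k ^+ 2 * b k).
Proof.
move=> [bK bmin] /andP[k0 kK].
have kK' : (k < K.+1)%N by rewrite ltnS.
pose e (s : R) (j : nat) := if j == k then s else 0.
have [b0 bv] := (in_EK_P b).1 bK.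
have eK s : in_EK lam K (fun j => b j + e s j).
  apply/in_EK_P; split; first by rewrite b0 /e eq_sym gtn_eqF // addr0.
  by move=> j Kj; rewrite bv // /e gtn_eqF ?addr0 // (leq_ltn_trans kK).
apply/eqP; rewrite -subr_eq0; apply/eqP.
apply: (@quadratic_min _ (path_acov n y k k + tau * lam k ^+ 2)) => s.
have := bmin _ (eK s); rewrite !Qcrit_qform // -subr_ge0.
suff -> : qform K.+1 (path_acov n y) (arcoef (fun j => b j + e s j)) (arcoef (fun j => b j + e s j)) +
  tau * (\sum_(1 <= j < K.+1) (lam j * (b j + e s j)) ^+ 2) -
  (qform K.+1 (path_acov n y) (arcoef b) (arcoef b) +
  tau * (\sum_(1 <= j < K.+1) (lam j * b j) ^+ 2)) =
  s ^+ 2 * (path_acov n y k k + tau * lam k ^+ 2) -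
  2 * s * (\sum_(j < K.+1) arcoef b j * path_acov n y j k - tau * (lam k ^+ 2 * b k)) by [].
have pen : \sum_(1 <= j < K.+1) (lam j * (b j + e s j)) ^+ 2 =
   \sum_(1 <= j < K.+1) (lam j * b j) ^+ 2 + (lam k ^+ 2 * (2 * s * b k + s ^+ 2)).
  rewrite (bigD1_seq k) ?iota_uniq ?mem_index_iota ?k0 //=.
  rewrite [X in _ = X + _](bigD1_seq k) ?iota_uniq ?mem_index_iota ?k0 //=.
  rewrite [X in _ + X = _](eq_bigr (fun j => (lam j * b j) ^+ 2)) => [|j /negbTE jk].
    by rewrite /e eqxx; ring.
  by rewrite /e jk addr0.
pose d (j : nat) : R := if j == k then 1 else 0.
have ae j : arcoef (fun j => b j + e s j) j = arcoef b j - s * d j.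
  case: j => [|j] /=; rewrite /d.
    by rewrite eq_sym gtn_eqF // mulr0 subr0.
  by rewrite /e; case: eqP => _; ring.
have sumd (G : nat -> R) : \sum_(j < K.+1) d j * G j = G k.
  rewrite (bigD1 (Ordinal kK')) //= big1 ?addr0 => [|j]; first by rewrite /d eqxx mul1r.
  by rewrite -val_eqE /= /d => /negbTE ->; rewrite mul0r.
have qd1 : qform K.+1 (path_acov n y) (arcoef b) d = \sum_(j < K.+1) arcoef b j * path_acov n y j k.
  apply: eq_bigr => j _; rewrite -(sumd (fun i => arcoef b j * path_acov n y j i)).
  by apply: eq_bigr => i _; ring.
have qdC : qform K.+1 (path_acov n y) d (arcoef b) = qform K.+1 (path_acov n y) (arcoef b) d.
  rewrite /qform exchange_big; apply: eq_bigr => j _; apply: eq_bigr => i _ /=.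
  by rewrite path_acovC; ring.
have qdd : qform K.+1 (path_acov n y) d d = path_acov n y k k.
  rewrite -(sumd (fun i => path_acov n y i k)); apply: eq_bigr => j _.
  rewrite -(sumd (fun i => d j * path_acov n y j i)); apply: eq_bigr => i _; ring.
have -> : qform K.+1 (path_acov n y) (arcoef (fun j => b j + e s j)) (arcoef (fun j => b j + e s j)) =
   qform K.+1 (path_acov n y) (arcoef b) (arcoef b) -
   s * qform K.+1 (path_acov n y) (arcoef b) d - s * qform K.+1 (path_acov n y) d (arcoef b)
   + s ^+ 2 * qform K.+1 (path_acov n y) d d.
  rewrite /qform !mulr_sumr -!sumrB -big_split; apply: eq_bigr => i _ /=.
  rewrite !mulr_sumr -!sumrB -big_split; apply: eq_bigr => j _ /=; rewrite !ae; ring.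
rewrite qdC qd1 qdd pen; ring.
Qed.

Definition pen_matrix y n tau : 'M[R]_K :=
  \matrix_(i, l) (path_acov n y i.+1 l.+1 + (i == l)%:R * (tau * lam l.+1 ^+ 2)).

Definition pen_rhs y n : 'rV[R]_K := \row_i path_acov n y 0 i.+1.

Lemma pen_est_matrix y n tau b : is_pen_est lam y K n tau b ->
  (\row_(i < K) b i.+1) *m pen_matrix y n tau = pen_rhs y n.
Proof.
move=> bP; apply/rowP => l; rewrite !mxE.
have H := @normal_equation y n tau b l.+1 bP (ltn_ord l).
rewrite big_ord_recl /= mul1r in H.
rewrite (_ : \sum_(i < K) _ = - \sum_(i < K) b i.+1 * path_acov n y i.+1 l.+1) in H; last first.
  by rewrite -sumrN; apply: eq_bigr => i _; rewrite mulNr.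
rewrite (eq_bigr (fun i : 'I_K => b i.+1 * path_acov n y i.+1 l.+1 +
    b i.+1 * ((i == l)%:R * (tau * lam l.+1 ^+ 2)))) => [|i _]; last by rewrite !mxE mulrDr.
rewrite big_split /= [X in _ + X](bigD1 l) //= [X in _ + (_ + X)]big1 ?addr0; last first.
  by move=> i /negbTE ->; rewrite mul0r mulr0.
rewrite eqxx mul1r -[RHS](subrK (\sum_(i < K) b i.+1 * path_acov n y i.+1 l.+1)) H addrC.
by congr (_ + _); rewrite mulrCA [b _ * _]mulrC.
Qed.

(** A Gram matrix plus a strictly positive diagonal is definite, so its kernel is trivial, even when
    the sample is degenerate or n = 0. *)
Lemma pen_matrix_unit y n tau : 0 < tau -> (forall k, (0 < k)%N -> 0 < lam k) ->
  pen_matrix y n tau \in unitmx.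
Proof.
move=> t0 l0; rewrite -row_free_unit; apply: inj_row_free => v vA.
have : (v *m pen_matrix y n tau *m v^T) 0 0 = 0 by rewrite vA mul0mx mxE.
pose x k := if k is k'.+1 then (if insub k' is Some i then v 0 i else 0) else 0 : R.
have xv (i : 'I_K) : x i.+1 = v 0 i by rewrite /x /= valK.
have -> : (v *m pen_matrix y n tau *m v^T) 0 0 =
  qform K.+1 (path_acov n y) x x + tau * \sum_(i < K) (lam i.+1 * v 0 i) ^+ 2.
  rewrite mxE.
  have -> : qform K.+1 (path_acov n y) x x =
      \sum_(l < K) \sum_(i < K) v 0 i * v 0 l * path_acov n y i.+1 l.+1.
    rewrite /qform big_ord_recl /= big1 ?add0r => [|k _]; last by rewrite /= !mul0r.
    rewrite [RHS]exchange_big; apply: eq_bigr => i _ /=.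
    rewrite big_ord_recl /= mulr0 mul0r add0r; apply: eq_bigr => l _.
    by rewrite -!xv.
  rewrite mulr_sumr -big_split; apply: eq_bigr => l _ /=; rewrite !mxE mulr_suml.
  rewrite (eq_bigr (fun i : 'I_K => v 0 i * v 0 l * path_acov n y i.+1 l.+1 +
    v 0 i * v 0 l * ((i == l)%:R * (tau * lam l.+1 ^+ 2)))) => [|i _]; last by rewrite !mxE; ring.
  rewrite big_split /=; congr (_ + _); rewrite (bigD1 l) //= big1 ?addr0.
    by rewrite eqxx mul1r; ring.
  by move=> i /negbTE ->; rewrite mul0r mulr0.
rewrite qform_path_acov => E.
have q0 : 0 <= n%:R^-1 * \sum_(1 <= t < n.+1) (\sum_(j < K.+1) x j * y (t%:Z - j%:Z)) *
                                 (\sum_(k < K.+1) x k * y (t%:Z - k%:Z)).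
  by rewrite mulr_ge0 ?invr_ge0 // sumr_ge0 // => t _; rewrite -expr2 sqr_ge0.
have s0 : \sum_(i < K) (lam i.+1 * v 0 i) ^+ 2 = 0.
  apply/eqP; rewrite eq_le sumr_ge0 ?andbT => [|i _]; last exact: sqr_ge0.
  by rewrite -(pmulr_rle0 _ t0); move: E q0; set q := n%:R^-1 * _; set s := tau * _; lra.
apply/rowP => i; rewrite mxE; apply/eqP; have /eqP := s0.
rewrite psumr_eq0 => [|j _]; last exact: sqr_ge0.
by move=> /allP/(_ i (mem_index_enum i))/=; rewrite sqrf_eq0 mulf_eq0 gt_eqF ?l0.
Qed.

Lemma pen_est_inv y n tau b (i : 'I_K) : 0 < tau -> (forall k, (0 < k)%N -> 0 < lam k) ->
  is_pen_est lam y K n tau b ->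
  b i.+1 = (pen_rhs y n *m invmx (pen_matrix y n tau)) 0 i.
Proof.
move=> t0 l0 bP; rewrite -(pen_est_matrix bP) mulmxK ?pen_matrix_unit //.
by rewrite mxE.
Qed.

End PenalizedCriterion.

(** * Measurability of inverse matrices *)

Section MeasurableMatrix.
Context {R : realType} {d : measure_display} {Omega : measurableType d}.

Lemma measurable_inv (f : Omega -> R) : measurable_fun setT f ->
  measurable_fun setT (fun w => (f w)^-1).
Proof.
(* The power -1 agrees with the inverse on nonnegative reals, hence the detour through f^2; where f
   = 0 both sides are 0 by convention. *)
move=> mf; have -> : (fun w => (f w)^-1) = (fun w => f w * (f w ^+ 2) `^ (-1)).
  apply/funext => w; rewrite powR_inv1 ?sqr_ge0 //.
  have [->|f0] := eqVneq (f w) 0; first by rewrite invr0 mul0r.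
  by field.
apply: measurable_funM => //.
by apply: (measurableT_comp (measurable_powR (-1))); exact: measurable_funX.
Qed.

Lemma measurable_det K (A : Omega -> 'M[R]_K) :
  (forall i j, measurable_fun setT (fun w => A w i j)) ->
  measurable_fun setT (fun w => \det (A w)).
Proof.
move=> mA; rewrite /determinant; apply: measurable_sum => s.
by apply: measurable_funM => //; apply: measurable_prod => i _.
Qed.

Lemma measurable_invmx K (A : Omega -> 'M[R]_K) i j :
  (forall i j, measurable_fun setT (fun w => A w i j)) -> (forall w, A w \in unitmx) ->
  measurable_fun setT (fun w => invmx (A w) i j).
Proof.
move=> mA uA.
have -> : (fun w => invmx (A w) i j) = (fun w => (\det (A w))^-1 * cofactor (A w) j i).
  by apply/funext => w; rewrite /invmx uA !mxE.
apply: measurable_funM; first by apply: measurable_inv; exact: measurable_det.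
apply: measurable_funM => //; apply: measurable_det => k l.
by under eq_fun do rewrite !mxE; exact: mA.
Qed.

End MeasurableMatrix.

(** * Sample autocovariances *)

Section SampleAutocovariance.
Context {R : realType} {d : measure_display} {Omega : measurableType d}.
Variable P : probability Omega R.
Variable eps : int -> Omega -> R.
Hypothesis meps : forall t, measurable_fun setT (eps t).
Hypothesis indep : mutually_independent P eps.
Hypothesis ident : identically_distributed P eps.
Hypothesis ieps : forall t, P.-integrable setT (fun w => (eps t w)%:E).
Hypothesis eps_mean0 : forall t, (\int[P]_w (eps t w)%:E = 0)%E.
Hypothesis eps4 : forall t, (\int[P]_w ((eps t w) ^+ 4)%:E < +oo)%E.
Variables (phi psi : nat -> R) (Y : int -> Omega -> R) (S M : R).
Hypothesis fpsi : conv (arcoef phi) psi =1 cdelta.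
Hypothesis psiS : forall N, \sum_(k < N) `|psi k| <= S.
Hypothesis lphi : l1 phi.
Hypothesis Ypast : forall t, past_measurable eps t (Y t).
Hypothesis Y2 : forall t, (\int[P]_w ((Y t w) ^+ 2)%:E <= M%:E)%E.
Hypothesis YAR : forall t, {ae P, forall w,
  (fun N => \sum_(1 <= k < N) phi k * Y (t - k%:Z) w) @ \oo --> Y t w - eps t w}.

Lemma past_measurable_fun t : measurable_fun setT (Y t).
Proof.
move=> _ B mB; rewrite setTI; have := @Ypast t B mB; apply: smallest_sub => //.
  exact: sigma_algebra_measurable.
move=> _ [s [_ [D [mD ->]]]]; rewrite -[X in measurable X]setTI; exact: meps.
Qed.

Lemma Y_abs_bound t : (\int[P]_w (`|Y t w|)%:E <= (1 + M)%:E)%E.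
Proof.
have mY2 : measurable_fun setT (fun w => (Y t w ^+ 2)%:E).
  by apply/measurable_EFinP; apply: measurable_funX; exact: past_measurable_fun.
apply: (@le_trans _ _ (\int[P]_w (1 + (Y t w ^+ 2)%:E))%E).
  apply: ge0_le_integral => //.
  - by apply/measurable_EFinP; apply: measurableT_comp => //; exact: past_measurable_fun.
  - exact: emeasurable_funD.
  - move=> w _; rewrite -EFinD lee_fin -[Y t w ^+ 2]real_normK ?num_real //.
    have := sqr_ge0 (`|Y t w| - 1); have := normr_ge0 (Y t w); nra.
rewrite ge0_integralD //; last by move=> w _; rewrite lee_fin sqr_ge0.
by rewrite integral_cst // [X in (_ * X)%E](probability_setT P) mule1 EFinD leeD2l.
Qed.

(** The recursion holds almost surely at all times s - j simultaneously, by countability; bounded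
    first moments of Y make the dominating series |psi| * |f| against |Y| converge, so the pathwise
    inversion applies. *)
Lemma ae_ma_repr (s : int) : {ae P, forall w,
  (fun N => \sum_(i < N) psi i * eps (s - i%:Z) w) @ \oo --> Y s w}.
Proof.
have lf : l1 (arcoef phi).
  have [B phiB] := lphi; exists (1 + B) => N.
  apply: (@le_trans _ _ (\sum_(k < N) ((k == 0 :> nat)%:R + `|phi k|))).
    apply: ler_sum => -[[|k] kN] _ /=; first by rewrite normr1 lerDl.
    by rewrite normrN add0r.
  rewrite big_split /= lerD ?phiB //; case: N => [|N]; first by rewrite big_ord0.
  by rewrite big_ord_recl /= big1 ?addr0.
have labs (g : nat -> R) : l1 g -> l1 (fun i => `|g i|).
  by apply: l1_le => k; rewrite normr_id.
have := @ae_summable _ _ _ P (fun l => Y (s - l%:Z))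
  (conv (fun i => `|psi i|) (fun i => `|arcoef phi i|)) (1 + M).
move=> /(_ (fun l => past_measurable_fun _)) /(_ _ _ (fun l => Y_abs_bound _)) H.
have H1 : {ae P, forall w, forall j : nat,
    (fun N => \sum_(1 <= k < N) phi k * Y (s - j%:Z - k%:Z) w) @ \oo -->
    Y (s - j%:Z) w - eps (s - j%:Z) w} by apply: ae_foralln => j; exact: YAR.
have {}H : {ae P, forall w, l1 (fun l => conv (fun i => `|psi i|) (fun i => `|arcoef phi i|) l *
    `|Y (s - l%:Z) w|)}.
  apply: H; first by move=> l; apply: sumr_ge0 => i _; rewrite mulr_ge0.
  by apply: l1_conv; last exact: labs; apply: labs; exists S; exact: psiS.
apply: (filterS2 _ _ H1 H) => w {}H1 H2.
have := @ar_path_inverse _ phi psi (fun l => Y (s - l%:Z) w) (fun l => eps (s - l%:Z) w) fpsi.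
rewrite subr0; apply; last exact: H2.
move=> j /=; have -> : (fun N => \sum_(1 <= k < N) phi k * Y (s - (j + k)%N%:Z) w) =
    (fun N => \sum_(1 <= k < N) phi k * Y (s - j%:Z - k%:Z) w).
  by apply/funext => N; apply: eq_bigr => k _; rewrite PoszD opprD addrA.
exact: H1.
Qed.

Lemma ae_trunc_proc_cvg : {ae P, forall w, forall t j : nat,
  (fun L => trunc_proc eps psi j L t w) @ \oo --> Y (t%:Z - j%:Z) w}.
Proof.
apply: ae_foralln => t; apply: ae_foralln => j.
apply: filterS (ae_ma_repr (t%:Z - j%:Z)) => w.
rewrite -[X in _ -> X](cvg_shiftn j).
suff -> : (fun N => trunc_proc eps psi j (N + j) t w) =
  (fun N => \sum_(i < N) psi i * eps (t%:Z - j%:Z - i%:Z) w) by [].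
apply/funext => N; rewrite /trunc_proc.
rewrite -(big_mkord xpredT (fun i => shift_coef psi j i * eps (t%:Z - i%:Z) w)).
rewrite (big_cat_nat (n := j)) ?leq_addl //= big_nat big1 ?add0r; last first.
  by move=> i /andP[_ ij]; rewrite /shift_coef leqNgt ij mul0r.
rewrite -[X in \sum_(X <= _ < _) _]add0n big_addn addnK big_mkord; apply: eq_bigr => i _.
by rewrite /shift_coef leq_addl addnK; congr (_ * eps _ _); lia.
Qed.

Definition sample_acov (n j k : nat) (w : Omega) : R :=
  path_acov n (fun t => Y t w) j k.

Lemma measurable_sample_acov n j k : measurable_fun setT (sample_acov n j k).
Proof.
apply: measurable_funM => //; apply: measurable_sum => t.
by apply: measurable_funM; exact: past_measurable_fun.
Qed.

Local Notation acov := (acov psi (eps_var P eps)).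

(** The mean square bound for the truncated moving averages does not depend on [L], so Fatou's lemma
    carries it to Y. *)
Lemma sample_acov_dist n j k : (0 < n)%N ->
  (\int[P]_w ((sample_acov n j k w - acov j k) ^+ 2)%:E <= (S ^+ 4 * (kap P eps / n%:R))%:E)%E.
Proof.
move=> n0; apply: (@fatou_sqr _ _ _ P (fun L => acov_dev P eps psi L j k n)).
- by move=> L; have [] := rmean_acov_dev_sqr meps indep ident ieps eps_mean0 eps4 psiS L j k n0.
- by move=> L; exact: measurable_acov_dev.
- by apply: measurable_funB => //; exact: measurable_sample_acov.
- by move=> L; have [] := rmean_acov_dev_sqr meps indep ident ieps eps_mean0 eps4 psiS L j k n0.
apply: filterS ae_trunc_proc_cvg => w cw.
apply: cvgB; last exact: (acov_cvg psiS).
apply: cvgM; first exact: cvg_cst.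
by apply: cvg_sum => t; apply: cvgM; exact: cw.
Qed.

Variables (lam : nat -> R) (W : R).
Hypothesis lam_gt0 : forall k, (0 < k)%N -> 0 < lam k.
Hypothesis lamW : forall N, \sum_(1 <= k < N) (lam k ^+ 2)^-1 <= W.

(** The weights sum to at most 1 + W over each lag, the 1 coming from index 0; the bound is free of
    [J]. *)
Lemma wdist2_sample_acov n J : (0 < n)%N ->
  (\int[P]_w (wdist2 J lam (fun j k => sample_acov n j k w) acov)%:E <=
   ((1 + W) ^+ 2 * (S ^+ 4 * (kap P eps / n%:R)))%:E)%E.
Proof.
move=> n0; set C := S ^+ 4 * _.
have v0 k : 0 < weight1 lam k by case: k => [|k] //=; exact: lam_gt0.
have C0 : 0 <= C.
  by rewrite mulr_ge0 ?divr_ge0 ?(kap_ge0 P eps) // (exprM _ 2 2) sqr_ge0.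
have mD j k : measurable_fun setT (fun w => sample_acov n j k w - acov j k).
  by apply: measurable_funB => //; exact: measurable_sample_acov.
pose v j k := ((weight1 lam j ^+ 2)^-1 * (weight1 lam k ^+ 2)^-1).
have vE j k w : ((sample_acov n j k w - acov j k) / (weight1 lam j * weight1 lam k)) ^+ 2 =
    v j k * (sample_acov n j k w - acov j k) ^+ 2.
  by rewrite exprMn exprVn exprMn invfM mulrC.
have v0' j k : 0 <= v j k by rewrite mulr_ge0 // invr_ge0 sqr_ge0.
have mvD j k : measurable_fun setT (fun w => (v j k * (sample_acov n j k w - acov j k) ^+ 2)%:E).
  by apply/measurable_EFinP; apply: measurable_funM => //; exact: measurable_funX.
have vD0 j k w : (0 <= (v j k * (sample_acov n j k w - acov j k) ^+ 2)%:E)%E.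
  by rewrite lee_fin mulr_ge0 // sqr_ge0.
have vsum : \sum_(j < J) (weight1 lam j ^+ 2)^-1 <= 1 + W.
  case: J => [|J].
    by rewrite big_ord0 addr_ge0 // (le_trans _ (lamW 0)) // big_geq.
  rewrite -(big_mkord xpredT (fun j => (weight1 lam j ^+ 2)^-1)) big_ltn //= expr1n invr1 lerD2l.
  rewrite (le_trans _ (lamW J.+1)) // big_nat [leRHS]big_nat.
  by apply: ler_sum => -[].
rewrite /wdist2; under eq_integral do (under eq_bigr do under eq_bigr do rewrite vE).
under eq_integral do rewrite -sumEFin.
rewrite ge0_integral_sum //; last first.
- by move=> j w _; rewrite lee_fin sumr_ge0 // => k _; rewrite mulr_ge0 // sqr_ge0.
- move=> j; apply/measurable_EFinP; apply: measurable_sum => k.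
  by have := mvD j k => /measurable_EFinP.
apply: (@le_trans _ _ (\sum_(j < J) \sum_(k < J) (v j k * C)%:E)%E).
  apply: lee_sum => j _; under eq_integral do rewrite -sumEFin.
  rewrite ge0_integral_sum //; apply: lee_sum => k _.
  under eq_integral do rewrite EFinM.
  rewrite ge0_integralZl_EFin //.
  - by rewrite [leRHS]EFinM lee_wpmul2l ?lee_fin // sample_acov_dist.
  - by move=> w _; rewrite lee_fin sqr_ge0.
  - by apply/measurable_EFinP; exact: measurable_funX.
under eq_bigr do rewrite sumEFin; rewrite sumEFin lee_fin.
under eq_bigr do rewrite -mulr_suml -mulr_sumr.
rewrite -mulr_suml -mulr_suml ler_wpM2r // expr2 ler_pM // sumr_ge0 // => j _;
  by rewrite invr_ge0 sqr_ge0.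
Qed.

Lemma measurable_wdist2 n J :
  measurable_fun setT (fun w => wdist2 J lam (fun j k => sample_acov n j k w) acov).
Proof.
apply: measurable_sum => j; apply: measurable_sum => k; apply: measurable_funX.
by apply: measurable_funM => //; apply: measurable_funB => //; exact: measurable_sample_acov.
Qed.

Lemma prob_wdist2_ge n J (a : R) : (0 < n)%N -> 0 < a ->
  (P [set w | (a <= wdist2 J lam (fun j k => sample_acov n j k w) acov)%R] <=
   ((1 + W) ^+ 2 * (S ^+ 4 * (kap P eps / n%:R)) / a)%:E)%E.
Proof.
move=> n0 a0.
have mT := measurable_wdist2 n J.
have T0 w : 0 <= wdist2 J lam (fun j k => sample_acov n j k w) acov.
  by apply: sumr_ge0 => j _; apply: sumr_ge0 => k _; exact: sqr_ge0.
pose T : {mfun Omega >-> R} := HB.pack (fun w => wdist2 J lam (fun j k => sample_acov n j k w) acov)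
  (isMeasurableFun.Build _ _ _ _ _ mT).
have := @markov _ _ _ P T id a a0 _ _ _; rewrite unlock /= => H.
rewrite EFinM lee_pdivlMr // muleC.
have E : [set w | a <= wdist2 J lam (fun j k => sample_acov n j k w) acov] =
    [set w | (a%:E <= `|(T w)%:E|)%E].
  by apply/seteqP; split => w /=; rewrite lee_fin ger0_norm.
rewrite E (le_trans (H _ _ _)) //.
rewrite (le_trans _ (wdist2_sample_acov J n0)) // le_eqVlt; apply/orP; left; apply/eqP.
by apply: eq_integral => w _ /=; rewrite ger0_norm.
Qed.

End SampleAutocovariance.

(** * Consistency *)

Section ProbabilityLimits.
Context {R : realType}.

Lemma cvge0_near (u : nat -> \bar R) (e : R) : u @ \oo --> 0%E -> 0 < e ->
  \forall n \near \oo, (u n <= e%:E)%E.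
Proof.
move=> /fine_cvgP[ufin /cvgr_le/(_ _)/[apply]]; apply: filterS2 ufin.
by move=> n un; rewrite -lee_fin /= fineK.
Qed.

Lemma near_cvge0 (u : nat -> \bar R) : (forall n, 0 <= u n)%E ->
  (forall e, 0 < e -> \forall n \near \oo, (u n <= e%:E)%E) -> u @ \oo --> 0%E.
Proof.
move=> u0 ue; apply/fine_cvgP; split.
  by apply: filterS (ue 1 ltr01) => n un; rewrite ge0_fin_numE // (le_lt_trans un) // ltry.
apply/cvgrPdist_le => e e0; apply: filterS (ue e e0) => n un.
rewrite sub0r normrN ger0_norm ?fine_ge0 // -lee_fin fineK // ge0_fin_numE //.
by rewrite (le_lt_trans un) // ltry.
Qed.

End ProbabilityLimits.

Section MeasurableLevelSets.
Context {R : realType} {d : measure_display} {Omega : measurableType d}.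

Lemma measurable_ge (f : Omega -> R) a : measurable_fun setT f -> measurable [set w | a <= f w].
Proof.
move=> mf; have := mf measurableT `[a, +oo[%classic (measurable_itv _); rewrite setTI.
by congr measurable; apply/seteqP; split => w /=; rewrite in_itv /= andbT.
Qed.

Lemma measurable_le (f : Omega -> R) a : measurable_fun setT f -> measurable [set w | f w <= a].
Proof.
move=> mf; have := mf measurableT `]-oo, a]%classic (measurable_itv _); rewrite setTI.
by congr measurable; apply/seteqP; split => w /=; rewrite in_itv.
Qed.

Lemma measurable_lt (f : Omega -> R) a : measurable_fun setT f -> measurable [set w | f w < a].
Proof.
move=> mf; have := mf measurableT `]-oo, a[%classic (measurable_itv _); rewrite setTI.
by congr measurable; apply/seteqP; split => w /=; rewrite in_itv.
Qed.

End MeasurableLevelSets.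

Section Consistency.
Context {R : realType} {d : measure_display} {Omega : measurableType d}.
Variables (P : probability Omega R) (eps : int -> Omega -> R).
Variables (lambda c1 c2 : R) (lam phi : nat -> R) (Y : int -> Omega -> R).
Variables (K : nat -> nat) (tau : nat -> Omega -> R) (bhat : nat -> Omega -> nat -> R).
Hypothesis meps : forall t, measurable_fun setT (eps t).
Hypothesis indep : mutually_independent P eps.
Hypothesis ident : identically_distributed P eps.
Hypothesis ieps : forall t, P.-integrable setT (fun w => (eps t w)%:E).
Hypothesis eps_mean0 : forall t, (\int[P]_w (eps t w)%:E = 0)%E.
Hypothesis eps2 : forall t, (0 < \int[P]_w ((eps t w) ^+ 2)%:E < +oo)%E.
Hypothesis eps4 : forall t, (\int[P]_w ((eps t w) ^+ 4)%:E < +oo)%E.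
Hypothesis lambda_gt : 1 / 2 < lambda.
Hypothesis c1_gt0 : 0 < c1.
Hypothesis lamP : forall k, (1 <= k)%N ->
  c1 * (k%:R `^ lambda) <= lam k /\ lam k <= c2 * (k%:R `^ lambda).
Hypothesis phiE : in_Espace lam phi.
Hypothesis phi_inv : ar_invertible phi.
Hypothesis Ypast : forall t, past_measurable eps t (Y t).
Hypothesis Y2 : exists M : R, forall t, (\int[P]_w ((Y t w) ^+ 2)%:E <= M%:E)%E.
Hypothesis YAR : forall t, {ae P, forall w,
  (fun N => \sum_(1 <= k < N) phi k * Y (t - k%:Z) w) @ \oo --> Y t w - eps t w}.
Hypothesis Koo : forall M : nat, \forall n \near \oo, (M <= K n)%N.
Hypothesis tau_gt0 : forall n w, 0 < tau n w.
Hypothesis mtau : forall n, measurable_fun setT (tau n).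
Hypothesis tau0 : cvg_in_prob P tau 0.
Hypothesis tauoo : cvg_in_prob_pinfty P (fun n w => tau n w * Num.sqrt n%:R).
Hypothesis bhatP : forall n w,
  is_pen_est lam (fun t => Y t w) (K n) n (tau n w) (bhat n w).

Let lam0 : forall k, (0 < k)%N -> 0 < lam k := lam_gt0 c1_gt0 lamP.
Let lphi : l1 phi := Espace_l1 lambda_gt c1_gt0 lamP phiE.
Let mY t : measurable_fun setT (Y t) := past_measurable_fun meps Ypast t.

Lemma bhat_out n w k : (k == 0%N) || (K n < k)%N -> bhat n w k = 0.
Proof. by have [[_ [b0 bK]] _] := bhatP n w; case: eqP => [->|_] //= /bK. Qed.

Lemma measurable_bhat n k : measurable_fun setT (fun w => bhat n w k).
Proof.
have [kout|] := boolP ((k == 0%N) || (K n < k)%N).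
  rewrite (_ : (fun w => bhat n w k) = cst 0); first exact: measurable_cst.
  by apply/funext => w; exact: bhat_out.
case: k => [//|k]; rewrite /= -leqNgt => kK.
pose i := Ordinal kK.
have -> : (fun w => bhat n w k.+1) = (fun w => (pen_rhs (K n) (fun t => Y t w) n *m
   invmx (pen_matrix lam (K n) (fun t => Y t w) n (tau n w))) 0 i).
  by apply/funext => w; rewrite -(pen_est_inv i (tau_gt0 n w) lam0 (bhatP n w)).
have mac j l : measurable_fun setT (fun w => path_acov n (fun t => Y t w) j l).
  apply: measurable_funM => //; apply: measurable_sum => t.
  by apply: measurable_funM; exact: mY.
under eq_fun do rewrite mxE.
apply: measurable_sum => l; apply: measurable_funM.
  under eq_fun do rewrite mxE; exact: mac.
apply: measurable_invmx => [j m|w]; last exact: pen_matrix_unit.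
under eq_fun do rewrite mxE.
apply: measurable_funD => //; apply: measurable_funM => //.
exact: measurable_funM.
Qed.

Let Etail J := fine (\sum_(J <= k <oo) ((lam k ^+ 2 * phi k ^+ 2)%:E))%E.

Lemma Etail_le J r : (forall N, \sum_(J <= k < N) (lam k * phi k) ^+ 2 <= r) -> Etail J <= r.
Proof.
move=> rP; rewrite -lee_fin fineK.
  apply: lime_le.
    by apply: is_cvg_nneseries => k _ _; rewrite lee_fin mulr_ge0 ?sqr_ge0.
  near=> N; rewrite sumEFin lee_fin; under eq_bigr do rewrite -exprMn.
  exact: rP.
rewrite ge0_fin_numE; last first.
  by apply: nneseries_ge0 => k _ _; rewrite lee_fin mulr_ge0 ?sqr_ge0.
apply: (@le_lt_trans _ _ r%:E); last exact: ltry.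
apply: lime_le.
  by apply: is_cvg_nneseries => k _ _; rewrite lee_fin mulr_ge0 ?sqr_ge0.
near=> N; rewrite sumEFin lee_fin; under eq_bigr do rewrite -exprMn.
exact: rP.
Unshelve. all: by end_near. Qed.

Lemma Etail_ge0 J : 0 <= Etail J.
Proof.
by apply/fine_ge0/nneseries_ge0 => k _ _; rewrite lee_fin mulr_ge0 ?sqr_ge0.
Qed.

Lemma enorm_err n w : enorm lam (fun k => bhat n w k - phi k) =
  Num.sqrt (\sum_(1 <= k < (K n).+1) (lam k * (bhat n w k - phi k)) ^+ 2 + Etail (K n).+1).
Proof.
have sN J : (\sum_(J <= k <oo) (lam k ^+ 2 * (- phi k) ^+ 2)%:E =
    \sum_(J <= k <oo) (lam k ^+ 2 * phi k ^+ 2)%:E)%E.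
  by apply: eq_eseriesr => k _; rewrite sqrrN.
rewrite (@enorm2_split _ lam _ (fun k => - phi k) (K n).+1) //.
- by rewrite sN.
- by rewrite /in_Espace /enorm2 sN.
- by move=> k Kk; rewrite bhat_out ?sub0r // Kk orbT.
Qed.

Lemma measurable_enorm_err n : measurable_fun setT (fun w => enorm lam (fun k => bhat n w k - phi k)).
Proof.
under eq_fun do rewrite enorm_err.
apply: (measurableT_comp (continuous_measurable_fun (@sqrt_continuous R))).
apply: measurable_funD => //; apply: measurable_sum => k; apply: measurable_funX.
apply: measurable_funM => //; apply: measurable_funB => //; exact: measurable_bhat.
Qed.

Lemma enorm_bhat n w : enorm lam (bhat n w) =
  Num.sqrt (\sum_(1 <= k < (K n).+1) (lam k * bhat n w k) ^+ 2).
Proof.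
by rewrite /enorm (@enorm2_finite _ _ _ (K n).+1) // => k Kk; rewrite bhat_out // Kk orbT.
Qed.

Lemma measurable_enorm_bhat n : measurable_fun setT (fun w => enorm lam (bhat n w)).
Proof.
under eq_fun do rewrite enorm_bhat.
apply: (measurableT_comp (continuous_measurable_fun (@sqrt_continuous R))).
apply: measurable_sum => k; apply: measurable_funX.
by apply: measurable_funM => //; exact: measurable_bhat.
Qed.

Lemma enorm_bhat_le n w :
  enorm lam (bhat n w) <= enorm lam phi + enorm lam (fun k => bhat n w k - phi k).
Proof.
rewrite enorm_bhat enorm_err (@enorm2_split _ lam phi phi (K n).+1) //.
rewrite (le_trans (enorm_triangle _ _ phi _)) //.
by apply: lerD; rewrite ler_wsqrtr // lerDl; exact: Etail_ge0.
Qed.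

Lemma consistency : cvg_in_prob P (fun n w => enorm lam (fun k => bhat n w k - phi k)) 0.
Proof.
have [M YM] := Y2.
have conv_inv := conv_arinv phi; set psi := arinv phi in conv_inv.
have [S0 S0P] : l1 psi by exact: l1_arinv.
have [W WP] := sum_inv_lam lambda_gt c1_gt0 lamP.
have [B phiB] := lphi.
have B0 : 0 <= B by apply: le_trans (phiB 0%N); rewrite big_ord0.
pose F := 1 + B.
have FP N : \sum_(k < N) `|arcoef phi k| <= F.
  case: N => [|N]; first by rewrite big_ord0 addr_ge0.
  rewrite big_ord_recl normr1 lerD2l (le_trans _ (phiB N.+1)) // big_ord_recl ler_wpDl //.
  by apply: ler_sum => i _; rewrite normrN.
have F0 : 0 < F by rewrite ltr_wpDr.
pose s2 := eps_var P eps.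
have s20 : 0 < s2.
  have /andP[] := eps2 0; rewrite (rmeanE (rintegrable_sqr meps eps4 0)) lte_fin //.
pose c := s2 / F ^+ 2.
have c0 : 0 < c by rewrite divr_gt0 // exprn_gt0.
pose Cq := (s2 * S0 ^+ 2) ^+ 2.
have Cq0 : 0 <= Cq by exact: sqr_ge0.
have [Phi PhiP] := Espace_sum phiE.
move=> e e0.
pose h := e / 2; have h0 : 0 < h by rewrite divr_gt0.
pose A := (c2 / c1) ^+ 2 * (16 * Cq / c ^+ 2).
have A0 : 0 <= A by rewrite mulr_ge0 ?sqr_ge0 // divr_ge0 ?sqr_ge0 // mulr_ge0.
(* Small enough both for the tail of [phi] (rho < h^2) and for the l2 alternative of the dichotomy,
   converted back to E with factor [A]. *)
pose rho := h ^+ 2 / (A + 1) / 2.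
have rho0 : 0 < rho by rewrite divr_gt0 // divr_gt0 ?exprn_gt0 // ltr_wpDl.
have rhoh : rho < h ^+ 2.
  by rewrite /rho -mulrA gtr_pMr ?exprn_gt0 // -invfM invf_lt1 ?mulr_gt0 ?ltr_wpDl //; lra.
have Arho : A * rho < h ^+ 2.
  rewrite /rho mulrA ltr_pdivrMr // mulrA ltr_pdivrMr ?ltr_wpDl // [A * _]mulrC -mulrA.
  by rewrite ltr_pM2l ?exprn_gt0 //; lra.
(* With sqrt(1 + Phi) eta <= h/32 as well, the requirement 16 (h/32 + h/32) <= h holds. *)
pose rM2 := (h / 32) ^+ 2.
have [M0 M0P] := Espace_tail phiE (exprn_gt0 2 (divr_gt0 h0 (ltr0n R 32))).
pose M1 := M0.+1.
have [K0 K0P] := Espace_tail phiE rho0.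
pose eta := Num.min 2^-1 (h / (32 * Num.sqrt (1 + Phi))).
have Phi0 : 0 <= Phi by apply: le_trans (PhiP 0%N); rewrite big_geq.
have sPhi : 0 < Num.sqrt (1 + Phi) by rewrite sqrtr_gt0 ltr_pwDl.
have eta0 : 0 < eta by rewrite lt_min invr_gt0 ltr0n divr_gt0 // mulr_gt0.
have eta2 : eta <= 2^-1 by rewrite ge_min lexx.
have etaPhi : Num.sqrt (1 + Phi) * eta <= h / 32.
  have : eta <= h / (32 * Num.sqrt (1 + Phi)) by rewrite ge_min lexx orbT.
  rewrite !ler_pdivlMr ?mulr_gt0 // => H; rewrite (le_trans _ H) // le_eqVlt.
  by apply/orP; left; apply/eqP; ring.
pose L2 := \sum_(1 <= k < M1) (lam k ^+ 2 * phi k) ^+ 2.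
have L20 : 0 <= L2 by apply: sumr_ge0 => k _; exact: sqr_ge0.
(* Chosen so that 4 / c * delta * (L2 + 1) = h^2 / 4. *)
pose delta := h ^+ 2 * c / (16 * (L2 + 1)).
have delta0 : 0 < delta by apply: divr_gt0; apply: mulr_gt0; rewrite ?exprn_gt0 // ltr_wpDl.
(* The deterministic core: the error on the sieve and the tail of [phi] each have square below h^2,
   and 2 h^2 < e^2. *)
have key n w : (0 < n)%N -> (maxn M1 K0 <= K n)%N -> tau n w < delta ->
    wdist2 (K n).+1 lam (fun j k => sample_acov Y n j k w) (acov psi s2) <= (eta * tau n w) ^+ 2 ->
    enorm lam (fun k => bhat n w k - phi k) < e.
  move=> n0 Kn td T.
  have [M1K K0K] : (M1 <= K n)%N /\ (K0 <= K n)%N by move: Kn; rewrite geq_max => /andP[].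
  have Kn0 : (0 < K n)%N by apply: leq_trans M1K.
  have tail := K0P (K n).+1 (leqW K0K).
  have KL : 0 < (K n)%:R `^ lambda by rewrite powR_gt0 // ltr0n.
  pose r2 := rho / (c1 * (K n)%:R `^ lambda) ^+ 2.
  have r20 : 0 <= r2 by rewrite divr_ge0 ?sqr_ge0 // ltW.
  have E2h : \sum_(1 <= k < (K n).+1) (lam k * (bhat n w k - phi k)) ^+ 2 < h ^+ 2.
    have [] := @penalized_dichotomy R (K n).+1 M1 lam phi (bhat n w) (acov psi s2)
      (path_acov n (fun t => Y t w)) c Cq r2 (tau n w) eta L2 rM2 Phi h.
    - by case=> [|k] //=; exact: lam0.
    - by [].
    - exact: leqW.
    - by [].
    - by [].
    - exact: tau_gt0.
    - by rewrite (ltW eta0).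
    - by [].
    - by [].
    - exact: path_acovC.
    - move=> y yJ; rewrite mulrAC ler_pdivrMr ?exprn_gt0 // mulrC [leRHS]mulrC.
      by rewrite mulrC; exact: (acov_lower conv_inv FP S0P (ltW s20)).
    - move=> y yJ y0; apply: (acov_tail s2 conv_inv S0P) => // N.
      rewrite (eq_big_nat _ _ (F2 := fun k => phi k ^+ 2)) => [|[//|k] _] /=; last by rewrite sqrrN.
      exact: (l2_tail_le lambda_gt c1_gt0 lamP Kn0).
    - exact: T.
    - exact: PhiP.
    - exact: lexx.
    - exact: M0P.
    - exact: pen_est_le.
    - by rewrite sqrtr_sqr ger0_norm; lra.
    - have c4 : 4 / c * tau n w * L2 <= 4 / c * delta * L2.
        by rewrite ler_wpM2r // ler_wpM2l ?(ltW td) // divr_ge0 // ltW.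
      have -> : h ^+ 2 / 4 = 4 / c * delta * (L2 + 1).
        rewrite /delta; move: (L2) L20 (h) => l l0 h'.
        by field; rewrite !gt_eqF // ltr_wpDl.
      rewrite (le_trans c4) // ler_wpM2l ?lerDl //.
      by rewrite mulr_ge0 ?(ltW delta0) // divr_ge0 // ltW.
    - move=> N2h; have := enorm_le_l2 lambda_gt c1_gt0 lamP (fun k => bhat n w k - phi k) Kn0.
      move=> /le_lt_trans; apply.
      rewrite (le_lt_trans _ Arho) //.
      have -> : A * rho = (c2 * (K n)%:R `^ lambda) ^+ 2 * (16 * Cq / c ^+ 2 * r2).
        by rewrite /A /r2; field; rewrite !gt_eqF.
      by rewrite ler_wpM2l ?sqr_ge0 // ltW.
    - by [].
  rewrite enorm_err -(ger0_norm (ltW e0)) -sqrtr_sqr ltr_sqrt ?exprn_gt0 //.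
  have := Etail_le tail; have -> : e = 2 * h by rewrite /h; field.
  by rewrite exprMn; move: E2h rhoh; have := exprn_gt0 2 h0; lra.
apply: near_cvge0 => // e' e'0.
pose C0 := (1 + W) ^+ 2 * (S0 ^+ 4 * kap P eps) / eta ^+ 2.
have C00 : 0 <= C0.
  by rewrite divr_ge0 ?sqr_ge0 // mulr_ge0 ?sqr_ge0 // mulr_ge0 ?kap_ge0 // (exprM _ 2 2) sqr_ge0.
(* Makes C0 / A1^2 <= e'/3. Where tau_n sqrt n > A1, the level (eta A1)^2 / n lies below (eta
   tau_n)^2, and Markov's bound at that level is exactly C0 / A1^2, whatever [n]. *)
pose A1 := Num.sqrt (3 * C0 / e' + 1).
have A1s : A1 ^+ 2 = 3 * C0 / e' + 1.
  by rewrite sqr_sqrtr // addr_ge0 // divr_ge0 ?(ltW e'0) // mulr_ge0.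
have A1s0 : 0 < A1 ^+ 2.
  by rewrite A1s ltr_wpDl // divr_ge0 ?(ltW e'0) // mulr_ge0.
have A10 : 0 < A1 by rewrite sqrtr_gt0 -A1s.
have C0A1 : C0 / A1 ^+ 2 <= e' / 3.
  rewrite ler_pdivrMr // A1s mulrDr mulr1.
  have -> : e' / 3 * (3 * C0 / e') = C0 by field; rewrite gt_eqF.
  by rewrite lerDl divr_ge0 // ltW.
have e'3 : 0 < e' / 3 by rewrite divr_gt0.
have N1 := cvge0_near (tau0 delta0) e'3.
have N2 := cvge0_near (tauoo A1) e'3.
near=> n.
have n0 : (0 < n)%N by near: n; exact: nbhs_infty_gt.
have nR : 0 < n%:R :> R by rewrite ltr0n.
have P1 : (P [set w | (delta <= `|tau n w - 0|)%R] <= (e' / 3)%:E)%E by near: n; exact: N1.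
have P2 : (P [set w | (tau n w * Num.sqrt n%:R <= A1)%R] <= (e' / 3)%:E)%E.
  by near: n; exact: N2.
pose E1 := [set w | delta <= `|tau n w - 0|].
pose E2 := [set w | tau n w * Num.sqrt n%:R <= A1].
pose E3 := [set w | (eta * A1) ^+ 2 / n%:R <=
  wdist2 (K n).+1 lam (fun j k => sample_acov Y n j k w) (acov psi s2)].
have P3 : (P E3 <= (e' / 3)%:E)%E.
  have a0 : 0 < (eta * A1) ^+ 2 / n%:R by rewrite divr_gt0 // exprn_gt0 // mulr_gt0.
  have := prob_wdist2_ge meps indep ident ieps eps_mean0 eps4 conv_inv S0P lphi Ypast YM YAR
    lam0 WP (K n).+1 n0 a0.
  move=> /le_trans; apply; rewrite lee_fin (le_trans _ C0A1) // le_eqVlt; apply/orP; left.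
  apply/eqP; rewrite /C0; move: (kap P eps) => k'.
  by field; rewrite !gt_eqF.
have mE1 : measurable E1.
  apply: measurable_ge; apply: measurableT_comp => //; exact: measurable_funB.
have mE2 : measurable E2 by apply: measurable_le; exact: measurable_funM.
have mE3 : measurable E3.
  by apply: measurable_ge; exact: (measurable_wdist2 P meps psi Ypast lam).
have mE : measurable [set w | e <= `|enorm lam (fun k => bhat n w k - phi k) - 0|].
  apply: measurable_ge; apply: measurableT_comp => //; apply: measurable_funB => //.
  exact: measurable_enorm_err.
apply: (@le_trans _ _ (P (E1 `|` (E2 `|` E3)))).
  apply: le_measure; rewrite ?inE //; first by do 2 apply: measurableU => //.
  move=> w /=; rewrite subr0 [X in `|X|]/enorm ger0_norm ?sqrtr_ge0 // => ew.
  apply: contrapT => /not_orP[/negP E1w /not_orP[/negP E2w /negP E3w]].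
  move: E1w E2w E3w; rewrite subr0 gtr0_norm // -!ltNge => E1w E2w E3w.
  suff : enorm lam (fun k => bhat n w k - phi k) < e by rewrite ltNge ew.
  apply: key => //; first by near: n; exact: Koo.
  rewrite (le_trans (ltW E3w)) // ler_pdivrMr // -[n%:R in leRHS]sqr_sqrtr ?ler0n //.
  rewrite -exprMn -mulrA lerXn2r ?nnegrE ?mulr_ge0 ?(ltW eta0) ?sqrtr_ge0 ?(ltW (tau_gt0 _ _)) //.
  by rewrite ler_wpM2l ?(ltW eta0) // ltW.
have -> : (e'%:E = (e' / 3)%:E + ((e' / 3)%:E + (e' / 3)%:E))%E.
  by rewrite -!EFinD; congr EFin; field.
apply: (le_trans (measureU2 _ mE1 _)); first exact: measurableU.
by apply: (leeD P1); apply: (le_trans (measureU2 _ mE2 mE3)); exact: (leeD P2).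
Unshelve. all: by end_near. Qed.

End Consistency.

Theorem theorem1 (R : realType) (d : measure_display) (Omega : measurableType d)
  (P : probability Omega R) (eps : int -> Omega -> R)
  (lambda c1 c2 : R) (lam : nat -> R) (phi : nat -> R) (Y : int -> Omega -> R)
  (K : nat -> nat) (tau : nat -> Omega -> R)
  (bhat : nat -> Omega -> nat -> R) :
  (* innovations: iid, mean 0, variance in (0,oo), finite 4th moment *)
  (forall t, measurable_fun setT (eps t)) ->
  mutually_independent P eps ->
  identically_distributed P eps ->
  (forall t, P.-integrable setT (fun w => (eps t w)%:E)) ->
  (forall t, (\int[P]_w (eps t w)%:E = 0)%E) ->
  (forall t, (0 < \int[P]_w ((eps t w) ^+ 2)%:E < +oo)%E) ->
  (forall t, (\int[P]_w ((eps t w) ^+ 4)%:E < +oo)%E) ->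
  (* weights lambda_k *)
  1 / 2 < lambda -> 0 < c1 -> c1 <= c2 ->
  (forall k, (1 <= k)%N ->
     c1 * (k%:R `^ lambda) <= lam k /\ lam k <= c2 * (k%:R `^ lambda)) ->
  (* Condition 1 *)
  in_Espace lam phi ->
  ar_invertible phi ->
  (forall t, past_measurable eps t (Y t)) ->
  (exists M : R, forall t, (\int[P]_w ((Y t w) ^+ 2)%:E <= M%:E)%E) ->
  (forall t, {ae P, forall w,
     (fun N => \sum_(1 <= k < N) phi k * Y (t - k%:Z) w) @ \oo --> Y t w - eps t w}) ->
  (* K_n -> oo *)
  (forall M : nat, \forall n \near \oo, (M <= K n)%N) ->
  (* tau_n > 0 random, tau_n -> 0 and tau_n sqrt n -> oo in probability *)
  (forall n w, 0 < tau n w) ->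
  (forall n, measurable_fun setT (tau n)) ->
  cvg_in_prob P tau 0 ->
  cvg_in_prob_pinfty P (fun n w => tau n w * Num.sqrt n%:R) ->
  (* bhat n w = b_{n,tau_n} computed from the sample path w *)
  (forall n w, is_pen_est lam (fun t => Y t w) (K n) n (tau n w) (bhat n w)) ->
  exists B : R, enorm lam phi < B /\
    (fun n => P [set w | enorm lam (bhat n w) < B]) @ \oo --> 1%E /\
    cvg_in_prob P (fun n w => enorm lam (fun k => bhat n w k - phi k)) 0.
Proof.
move=> meps indep ident ieps eps_mean0 eps2 eps4 lambda_gt c1_gt0 _ lamP phiE phi_inv Ypast Y2
  YAR Koo tau_gt0 mtau tau0 tauoo bhatP.
have cons := consistency meps indep ident ieps eps_mean0 eps2 eps4 lambda_gt c1_gt0 lamP phiE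
  phi_inv Ypast Y2 YAR Koo tau_gt0 mtau tau0 tauoo bhatP.
exists (enorm lam phi + 1); split; [by rewrite ltrDl | split=> //].
have mlt n : measurable [set w | enorm lam (bhat n w) < enorm lam phi + 1].
  by apply: measurable_lt; exact: (measurable_enorm_bhat meps c1_gt0 lamP Ypast tau_gt0 mtau bhatP).
(* By the triangle inequality the bound fails only where the error norm is at least 1, so
   consistency at e = 1 suffices. *)
have cv0 : (fun n => P (~` [set w | enorm lam (bhat n w) < enorm lam phi + 1])) @ \oo --> 0%E.
  apply: near_cvge0 => // e e0; apply: filterS (cvge0_near (cons 1 ltr01) e0) => n.
  apply: le_trans; apply: le_measure; rewrite ?inE //.
  - exact: measurableC.
  - apply: measurable_ge; apply: measurableT_comp => //; apply: measurable_funB => //.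
    exact: (measurable_enorm_err meps c1_gt0 lamP phiE Ypast tau_gt0 mtau bhatP).
  - move=> w /= /negP; rewrite -leNgt subr0 => H.
    rewrite [X in `|X|]/enorm ger0_norm ?sqrtr_ge0 // -(lerD2l (enorm lam phi)).
    by rewrite (le_trans H) // (enorm_bhat_le phiE bhatP).
have -> : (fun n => P [set w | enorm lam (bhat n w) < enorm lam phi + 1]) =
    (fun n => 1 - P (~` [set w | (enorm lam (bhat n w) < enorm lam phi + 1)%R]))%E.
  by apply/funext => n; rewrite -probability_setC ?setCK //; exact: measurableC.
rewrite -[X in _ --> X]sube0; apply: cvgeB => //; exact: cvg_cst.
Qed.
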